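(* There exists an integer $k\geq 18$ and, for each $1\leq i<j\leq 3$, a sequence $\{K_{ij,n}\}_{n\in\mathbb{N}}$ of normal, rotund, expansive (in particular finite index) subgroups of $P_{ij,0}$ such that $\bigcap_{n\in\mathbb{N}}K_{ij,n}=\{1\}$, where $P_{ij,0}$ is the group defined in the context for this value of $k$.
   Context: Fix $k\geq 2$. Let $G=\langle x_1,x_2,x_3\mid x_1^k=x_2^k=x_3^k=1\rangle$ be the free product of three copies of $\mathbb{Z}/k$. For $1\le i<j\le 3$ let $P_{ij}=\langle x_i,x_j\rangle<G$ (so $P_{ij}\cong \mathbb{Z}/k*\mathbb{Z}/k$). Let $G_0$ be the kernel of the homomorphism $G\to\mathbb{Z}/k$ sending each $x_i$ to $\bar 1$, and let $P_{ij,0}=P_{ij}\cap G_0$, a free group of rank $k-1$. For each $i<j$, $P_{ij}$ acts on the $k$-regular tree $T_k$, the Bass–Serre tree of the free splitting $P_{ij}=\langle x_i\rangle*\langle x_j\rangle$: vertices are the left cosets of $\langle x_i\rangle$ and of $\langle x_j\rangle$ in $P_{ij}$, and each $g\in P_{ij}$ gives an edge joining $g\langle x_i\rangle$ to $g\langle x_j\rangle$; $P_{ij}$ acts by left multiplication. For a finite index subgroup $N$ of $P_{ij}$, $N\backslash T_k$ denotes the finite quotient graph (possibly with multiple edges). The girth of a graph is the length of its shortest circuit (a pair of parallel edges forms a circuit of length 2). For a connected $k$-regular graph $\Gamma$ with adjacency matrix $A$, the Laplacian is $\delta=I-\frac1k A$, and $\lambda_1(\Gamma)$ is the smallest positive eigenvalue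 of $\delta$. A finite index normal subgroup $N$ of $P_{ij,0}$ is called rotund if $\mathrm{girth}(N\backslash T_k)>6$, and expansive if $\lambda_1(N\backslash T_k)>\frac12$. *)

(* Defs.v *)
From HB Require Import structures.
From mathcomp Require Import all_boot all_order all_algebra finmap.
From mathcomp Require Import all_classical all_reals ereal.

Set Implicit Arguments.
Unset Strict Implicit.
Unset Printing Implicit Defensive.

Import Order.TTheory GRing.Theory Num.Theory.

Local Open Scope classical_set_scope.
Local Open Scope quotient_scope.

Section PresentedGroup.
Variable X : choiceType.

(* The letter (x, false) stands for x and (x, true) for its inverse. *)
Definition word := seq (X * bool).

Variable rels : set word.

Inductive word_equiv : word -> word -> Prop :=
| WordRefl u : word_equiv u u
| WordSym u v : word_equiv u v -> word_equiv v u
| WordTrans v u w : word_equiv u v -> word_equiv v w -> word_equiv u w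
| WordCancel u v x b : word_equiv (u ++ (x, b) :: (x, ~~ b) :: v) (u ++ v)
| WordRel u v r : rels r -> word_equiv (u ++ r ++ v) (u ++ v).

Definition word_equivb : rel word := fun u v => `[< word_equiv u v >].

Lemma word_equivb_refl : reflexive word_equivb.
Proof. by move=> u; apply/asboolP; exact: WordRefl. Qed.

Lemma word_equivb_sym : symmetric word_equivb.
Proof. by move=> u v; apply/asboolP/asboolP; exact: WordSym. Qed.

Lemma word_equivb_trans : transitive word_equivb.
Proof.
by move=> v u w /asboolP uv /asboolP vw; apply/asboolP; exact: WordTrans uv vw.
Qed.

Canonical word_equiv_rel :=
  EquivRel word_equivb word_equivb_refl word_equivb_sym word_equivb_trans.

Definition presented_group := {eq_quot word_equiv_rel}.
HB.instance Definition _ := Choice.on presented_group.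
HB.instance Definition _ := EqQuotient.on presented_group.

Lemma pi_wordP (u v : word) :
  \pi_presented_group u = \pi_presented_group v <-> word_equiv u v.
Proof.
by split=> [/eqmodP/asboolP//|uv]; apply/eqmodP/asboolP.
Qed.

Lemma pi_surj (g : presented_group) : exists u, g = \pi_presented_group u.
Proof. by exists (repr g); rewrite reprK. Qed.

Lemma repr_word_equiv (u : word) :
  word_equiv (repr (\pi_presented_group u)) u.
Proof. by apply/pi_wordP; rewrite reprK. Qed.

Definition word_inv (u : word) : word :=
  rev [seq (p.1, ~~ p.2) | p <- u].

Lemma word_inv_cat u v : word_inv (u ++ v) = word_inv v ++ word_inv u.
Proof. by rewrite /word_inv map_cat rev_cat. Qed.

Lemma word_inv_cons p u : word_inv (p :: u) = word_inv u ++ [:: (p.1, ~~ p.2)].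
Proof. by rewrite -cat1s word_inv_cat. Qed.

Lemma word_invK : involutive word_inv.
Proof.
move=> u; rewrite /word_inv map_rev revK -map_comp -[RHS]map_id.
by apply: eq_map => -[x b] /=; rewrite negbK.
Qed.

Lemma word_equiv_ctx a b u v :
  word_equiv u v -> word_equiv (a ++ u ++ b) (a ++ v ++ b).
Proof.
elim=> {u v} [u|u v _ IH|v u w _ IHu _ IHv|u v x c|u v r Rr].
- exact: WordRefl.
- exact: WordSym.
- exact: WordTrans IHu IHv.
- by have := WordCancel (a ++ u) (v ++ b) x c; rewrite -!catA.
- by have := WordRel (a ++ u) (v ++ b) Rr; rewrite -!catA.
Qed.

Lemma word_equiv_cat u u' v v' :
  word_equiv u u' -> word_equiv v v' -> word_equiv (u ++ v) (u' ++ v').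
Proof.
move=> uu vv; apply: (WordTrans (v := u' ++ v)).
  exact: (word_equiv_ctx [::] v uu).
by have := word_equiv_ctx u' [::] vv; rewrite !cats0.
Qed.

Lemma word_mulVw u : word_equiv (word_inv u ++ u) [::].
Proof.
elim: u => [|[x b] u IH]; first exact: WordRefl.
rewrite word_inv_cons -catA /=; apply: WordTrans IH.
by have := WordCancel (word_inv u) u x (~~ b); rewrite negbK.
Qed.

Lemma word_mulwV u : word_equiv (u ++ word_inv u) [::].
Proof. by rewrite -{1}(word_invK u); exact: word_mulVw. Qed.

Lemma word_equiv_inv u v :
  word_equiv u v -> word_equiv (word_inv u) (word_inv v).
Proof.
move=> uv; apply: (WordTrans (v := word_inv u ++ (v ++ word_inv v))).
  apply: WordSym; rewrite -[X in word_equiv _ X]cats0.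
  by apply: word_equiv_cat (word_mulwV v); exact: WordRefl.
apply: (WordTrans (v := (word_inv u ++ u) ++ word_inv v)).
  rewrite -catA; apply: word_equiv_ctx (WordSym uv).
exact: word_equiv_cat (word_mulVw u) (WordRefl _).
Qed.

Definition pres_one : presented_group := \pi_presented_group [::].
Definition pres_mul (g h : presented_group) : presented_group :=
  \pi_presented_group (repr g ++ repr h).
Definition pres_inv (g : presented_group) : presented_group :=
  \pi_presented_group (word_inv (repr g)).

Lemma pres_mulE u v :
  pres_mul (\pi_presented_group u) (\pi_presented_group v) =
  \pi_presented_group (u ++ v).
Proof. by apply/pi_wordP/word_equiv_cat; exact: repr_word_equiv. Qed.

Lemma pres_invE u :
  pres_inv (\pi_presented_group u) = \pi_presented_group (word_inv u).
Proof. by apply/pi_wordP/word_equiv_inv; exact: repr_word_equiv. Qed.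

Lemma pres_mulA : associative pres_mul.
Proof.
move=> g h l; have [u ->] := pi_surj g; have [v ->] := pi_surj h.
by have [w ->] := pi_surj l; rewrite (pres_mulE u v) !pres_mulE catA.
Qed.

Lemma pres_mul1g : left_id pres_one pres_mul.
Proof. by move=> g; have [u ->] := pi_surj g; rewrite pres_mulE. Qed.

Lemma pres_mulg1 : right_id pres_one pres_mul.
Proof. by move=> g; have [u ->] := pi_surj g; rewrite pres_mulE cats0. Qed.

Lemma pres_mulVg : left_inverse pres_one pres_inv pres_mul.
Proof.
move=> g; have [u ->] := pi_surj g; rewrite pres_invE pres_mulE.
exact/pi_wordP/word_mulVw.
Qed.

Lemma pres_mulgV : right_inverse pres_one pres_inv pres_mul.
Proof.
move=> g; have [u ->] := pi_surj g; rewrite pres_invE pres_mulE.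
exact/pi_wordP/word_mulwV.
Qed.

HB.instance Definition _ := isGroup.Build presented_group
  pres_mulA pres_mul1g pres_mulg1 pres_mulVg pres_mulgV.

Definition pgen (x : X) : presented_group :=
  \pi_presented_group [:: (x, false)].

Section Lift.
Variables (H : groupType) (f : X -> H).
Local Open Scope group_scope.

Definition word_eval (u : word) : H :=
  \prod_(p <- u) (if p.2 then (f p.1)^-1 else f p.1).

Definition plift (g : presented_group) : H := word_eval (repr g).

Hypothesis f_rels : forall r, rels r -> word_eval r = 1.

Lemma word_eval_cat u v : word_eval (u ++ v) = word_eval u * word_eval v.
Proof. by rewrite /word_eval big_cat. Qed.

Lemma word_eval_nseq n x : word_eval (nseq n (x, false)) = f x ^+ n.
Proof.
elim: n => [|n IH]; first by rewrite /word_eval big_nil.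
by rewrite /= -cat1s word_eval_cat IH expgS {1}/word_eval big_seq1.
Qed.

Lemma word_eval_equiv u v : word_equiv u v -> word_eval u = word_eval v.
Proof.
elim=> {u v} // [u v w _ -> _ ->//|u v x b|u v r Rr].
  rewrite !word_eval_cat; congr (_ * _).
  rewrite /word_eval !big_cons mulgA /=.
  by case: b; rewrite ?mulgV ?mulVg mul1g.
by rewrite !word_eval_cat (f_rels Rr) mul1g.
Qed.

Lemma plift_pi u : plift (\pi_presented_group u) = word_eval u.
Proof. exact/word_eval_equiv/repr_word_equiv. Qed.

Lemma pliftM : {morph plift : g h / g * h}.
Proof.
move=> g h; have [u ->] := pi_surj g; have [v ->] := pi_surj h.
by rewrite [_ * _]pres_mulE !plift_pi word_eval_cat.
Qed.

Lemma plift_gen x : plift (pgen x) = f x.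
Proof. by rewrite plift_pi /word_eval big_seq1. Qed.

End Lift.

End PresentedGroup.

Arguments pgen {X rels} x.

Section Subgroups.
Variable G : groupType.
Local Open Scope group_scope.

Definition is_subgroup (H : set G) : Prop :=
  H 1 /\ forall g h, H g -> H h -> H (g * h^-1).

Definition generated (A : set G) : set G := smallest is_subgroup A.

Definition is_normal (N H : set G) : Prop :=
  [/\ is_subgroup N, N `<=` H & forall g h, H g -> N h -> N (h ^ g)].

Definition left_coset (g : G) (H : set G) : set G := [set g * h | h in H].

Definition finite_index (N H : set G) : Prop :=
  finite_set [set left_coset g N | g in H].

End Subgroups.

(* Each edge carries an orientation, to which adjacency and circuits are
   insensitive. *)
Record multigraph := Multigraph {
  vtype : choiceType;
  etype : choiceType;
  vertices : set vtype;
  edges : set etype;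
  src : etype -> vtype;
  tgt : etype -> vtype }.

Section Multigraphs.
Variable Gamma : multigraph.

Definition joins (e : etype Gamma) (u v : vtype Gamma) : Prop :=
  (src e = u /\ tgt e = v) \/ (src e = v /\ tgt e = u).

Definition is_circuit n (v : 'I_n -> vtype Gamma) (e : 'I_n -> etype Gamma) :=
  [/\ (0 < n)%N, injective v, injective e &
      forall t : 'I_n,
        [/\ vertices (v t), edges (e t) & joins (e t) (v t) (v (ordS t))]].

Definition circuit_length n : Prop := exists v e, @is_circuit n v e.

(* A graph without circuits has girth +oo. *)
Definition girth (R : realType) : \bar R :=
  ereal_inf [set (n%:R)%:E | n in circuit_length].

Local Notation V := (fset_set (@vertices Gamma)).

Definition oriented_edges (u v : vtype Gamma) : set (etype Gamma) :=
  [set e | [/\ edges e, src e = u & tgt e = v]].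

Local Open Scope ring_scope.

(* Meaningful only when Gamma is finite: fset_set A is empty if A is infinite.
   A loop contributes 2 to the diagonal. *)
Definition adjacency (R : realType) : 'M[R]_#|{: V}| :=
  \matrix_(a, b)
    let u := val (enum_val a) in
    let v := val (enum_val b) in
    (#|` fset_set (oriented_edges u v)|
     + #|` fset_set (oriented_edges v u)|)%:R.

Definition laplacian (R : realType) (k : nat) : 'M[R]_#|{: V}| :=
  1%:M - (k%:R)^-1 *: adjacency R.

(* The set of eigenvalues is finite, so the infimum is attained if there is a
   positive eigenvalue; otherwise it is 0. *)
Definition lambda1 (R : realType) (k : nat) : R :=
  inf [set l : R | 0 < l /\ eigenvalue (laplacian R k) l].

End Multigraphs.

(* The quotient of Gamma by N, acting by av on vertices and by ae on edges:
   vertices and edges are orbits, and the endpoints of an orbit of edges are the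
   images of that orbit under src and tgt. *)
Definition quotient_graph (G : groupType) (N : set G) (Gamma : multigraph)
    (av : G -> vtype Gamma -> vtype Gamma)
    (ae : G -> etype Gamma -> etype Gamma) : multigraph :=
  @Multigraph (set (vtype Gamma)) (set (etype Gamma))
    [set [set av g u | g in N] | u in @vertices Gamma]
    [set [set ae g e | g in N] | e in @edges Gamma]
    (fun E => @src Gamma @` E)
    (fun E => @tgt Gamma @` E).

Section FreeProduct.
Variable k : nat.
Local Open Scope group_scope.

Definition relators : set (word 'I_3) :=
  [set nseq k (i, false) | i in [set: 'I_3]].

Definition Gk := presented_group relators.

Definition gen (i : 'I_3) : Gk := pgen i.

(* The group law of the finGroupType 'Z_k is addition; 'Z_k is Z/k for 1 < k. *)
Definition deg : Gk -> 'Z_k := plift (fun _ => 1%R : 'Z_k).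

Lemma deg_relators : (1 < k)%N -> forall r, relators r ->
  word_eval (fun _ => 1%R : 'Z_k) r = 1.
Proof.
move=> k1 _ [i _ <-]; rewrite word_eval_nseq [LHS]Zp_expg; apply/val_inj.
by rewrite /= Zp_cast // (modn_small k1) mul1n modnn.
Qed.

Lemma degM : (1 < k)%N -> forall g h : Gk, deg (g * h) = (deg g + deg h)%R.
Proof. by move=> k1 g h; exact: (pliftM (deg_relators k1)). Qed.

Lemma deg_gen : (1 < k)%N -> forall i, deg (gen i) = 1%R.
Proof. by move=> k1 i; exact: (plift_gen (deg_relators k1)). Qed.

Definition G0 : set Gk := [set g | deg g = 0%R].

Definition Pij (i j : 'I_3) : set Gk := generated [set gen i; gen j].

Definition Pij0 (i j : 'I_3) : set Gk := Pij i j `&` G0.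

(* Vertices are tagged by l to keep the cosets of <x_i> and of <x_j> apart. *)
Definition tree_vertex (l : 'I_3) (g : Gk) : 'I_3 * set Gk :=
  (l, left_coset g (generated [set gen l])).

Definition tree (i j : 'I_3) : multigraph :=
  @Multigraph ('I_3 * set Gk)%type Gk
    ([set tree_vertex i g | g in Pij i j] `|`
     [set tree_vertex j g | g in Pij i j])
    (Pij i j) (tree_vertex i) (tree_vertex j).

Definition tree_quotient (N : set Gk) (i j : 'I_3) : multigraph :=
  @quotient_graph Gk N (tree i j)
    (fun g u => (u.1, left_coset g u.2)) (fun g e => g * e).

Definition rotund (R : realType) (i j : 'I_3) (N : set Gk) : Prop :=
  [/\ is_normal N (Pij0 i j), finite_index N (Pij0 i j) &
      (6%:R%:E < girth (tree_quotient N i j) R)%E].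

Definition expansive (R : realType) (i j : 'I_3) (N : set Gk) : Prop :=
  [/\ is_normal N (Pij0 i j), finite_index N (Pij0 i j) &
      (2%:R^-1 < lambda1 (tree_quotient N i j) R k)%R].

End FreeProduct.

Arguments gen k i : clear implicits.
Arguments Pij k i j : clear implicits.
Arguments Pij0 k i j : clear implicits.

(* Main.v *)
From HB Require Import structures.
Require Import Defs.
From mathcomp Require Import all_boot all_order all_algebra all_fingroup finmap.
From mathcomp Require Import all_classical all_reals ereal.
From mathcomp Require Import complex zify ring lra.

Set Implicit Arguments.
Unset Strict Implicit.
Unset Printing Implicit Defensive.

Import Order.TTheory GRing.Theory Num.Theory.

(**
For k elements t_0, ..., t_{k-1} of a finite group Q, let the edges (h, a) of
a bipartite graph join the left vertex h to the right vertex h t_a. The free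
product P_ij acts on the edges, x_i rotating them around their left ends and
x_j around their right ends, and the stabiliser K of the edge (1, 0) is a
normal subgroup of P_ij,0 such that K\T_k is the component of that edge. Thus
we need k and elements t_a, in infinitely many groups Q, such that short
reduced words t_a t_b^-1 t_c t_d^-1 ... are nontrivial and such that the
operator f |-> sum_{a,b} f(h t_a t_b^-1) has no eigenvalue strictly between
k^2/9 and k^2.

Fix a large prime p. By the pigeonhole principle there are k >= p/26244 integer
quaternions s_a of the same norm n = cp, c <= 4, such that modulo p no s_a s_b^*
and no s_a^* s_b vanishes for a <> b. As the s_a have rank one modulo p, reduced
alternating products are not divisible by p. For a prime q with a square root
of -1, the s_a, normalised, give elements of Q = SL_2(F_q), and a short word
which is trivial modulo q would be a scalar quaternion divisible by p.

For the spectral gap we follow Sarnak and Xue. An eigenspace with eigenvalue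
nu < k^2 is a nontrivial representation of SL_2(F_q), hence of dimension at
least (q-1)/2, so nu^m (q-1)/2 is at most |Q| times the number of words of
m pairs which are trivial in Q. Such a word has as its value a quaternion of
norm n^(2m) congruent to n^m modulo q; there are few of these, by a
congruence modulo q^2 for the real part and a bound for the number of integer
points on a circle, and each is the value of few words. For n^m of the order
q^(15/7) this contradicts nu > k^2/9.
*)

Local Open Scope ring_scope.

(** * Integer points on a circle *)

Lemma size_le_fibers (T U : eqType) (f : T -> U) (S : seq T) (V : seq U) c :
  {in S, forall x, f x \in V} ->
  (forall u, size [seq x <- S | f x == u] <= c)%N -> (size S <= c * size V)%N.
Proof.
elim: V S => [|u V IH] S SV fib.
  by case: S SV {fib} => // x S /(_ x (mem_head _ _)).
rewrite -(count_predC (fun x => f x == u)) -!size_filter /= mulnS.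
apply: leq_add; first exact: fib.
apply: IH => [x|v].
  rewrite mem_filter /= => /andP[fxu /SV].
  by rewrite inE (negPf fxu).
apply: leq_trans (fib v); rewrite -filter_predI !size_filter.
by apply: sub_count => x /= /andP[].
Qed.

Lemma size_le_fibers2 (T U : eqType) (f : T -> U) (S : seq T) (V : seq U) :
  uniq S -> {in S, forall x, f x \in V} ->
  (forall x y z, x \in S -> y \in S -> z \in S -> f x = f y -> f x = f z ->
     [|| x == y, x == z | y == z]) -> (size S <= 2 * size V)%N.
Proof.
move=> uS SV h; apply: (size_le_fibers SV) => u.
have := filter_uniq (fun x => f x == u) uS.
have : {subset [seq x <- S | f x == u] <= [pred x | (x \in S) && (f x == u)]}.
  by move=> x; rewrite mem_filter inE andbC.
case: [seq x <- S | f x == u] => [|x [|y [|z s]]] //= sub.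
have /[!inE]/andP[xS /eqP fx] := sub x (mem_head _ _).
have /[!inE]/andP[yS /eqP fy] : y \in [pred x | (x \in S) && (f x == u)].
  by apply: sub; rewrite !inE eqxx orbT.
have /[!inE]/andP[zS /eqP fz] : z \in [pred x | (x \in S) && (f x == u)].
  by apply: sub; rewrite !inE eqxx !orbT.
have := h x y z xS yS zS; rewrite fx fy fz => /(_ erefl erefl).
by case: (x == y) => //=; case: (x == z) => //=; case: (y == z); rewrite ?andbF.
Qed.

(* [abc = 4 R Area] for a triangle inscribed in a circle centered at 0. *)
Lemma inscribed_triangle (R : comNzRingType) (x1 y1 x2 y2 x3 y3 N : R) :
  x1 ^+ 2 + y1 ^+ 2 = N -> x2 ^+ 2 + y2 ^+ 2 = N -> x3 ^+ 2 + y3 ^+ 2 = N ->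
  ((x1 - x2) ^+ 2 + (y1 - y2) ^+ 2) * ((x1 - x3) ^+ 2 + (y1 - y3) ^+ 2) *
    ((x2 - x3) ^+ 2 + (y2 - y3) ^+ 2) =
  4%:R * N * ((x2 - x1) * (y3 - y1) - (x3 - x1) * (y2 - y1)) ^+ 2.
Proof.
have e x y : x ^+ 2 + y ^+ 2 = N -> y ^+ 2 = N - x ^+ 2.
  by move=> <-; ring.
by move=> /e h1 /e h2 /e h3; ring: h1 h2 h3.
Qed.

Definition zrange (B : nat) : seq int :=
  [seq i%:Z - B%:Z | i <- iota 0 (2 * B).+1].

Lemma mem_zrange B x : (x \in zrange B) = (`|x| <= B%:Z).
Proof.
apply/mapP/idP => [[j]|xB]; first by rewrite mem_iota => ? ->; lia.
by exists (absz (x + B%:Z)); rewrite ?mem_iota; lia.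
Qed.

Lemma size_zrange B : size (zrange B) = (2 * B).+1.
Proof. by rewrite size_map size_iota. Qed.

Section CirclePoints.
Variables (L : nat) (N : int) (S : seq (int * int)).
Hypotheses (L_gt0 : (0 < L)%N) (NL : N <= (L ^ 8)%N%:Z) (uS : uniq S).
Hypothesis SN : {in S, forall z, z.1 ^+ 2 + z.2 ^+ 2 = N}.

(** On a circle of radius at most sqrt 2 L^3 it suffices to count abscissas, each of which carries
    at most two points. *)
Lemma size_circle_points_small : N <= 2 * (L ^ 6)%N%:Z -> (size S <= 24 * L ^ 3)%N.
Proof.
move=> N6.
have /leq_trans->// : (size S <= 2 * size (zrange (2 * L ^ 3)))%N.
  apply: (@size_le_fibers2 _ _ fst) => // [[x y] /SN /= e|].
    rewrite mem_zrange; have : x ^+ 2 <= N by nia.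
    have : (L ^ 6)%N%:Z = (L ^ 3)%N%:Z ^+ 2 by rewrite -[6%N]/(3 * 2)%N expnM; nia.
    by move: (L ^ 3)%N N6 => l; nia.
  move=> [x y] [x' y'] [x'' y''] /SN/= e1 /SN/= e2 /SN/= e3 /= h1 h2.
  subst x' x''.
  have e : y' ^+ 2 = y ^+ 2 by lia.
  have e' : y'' ^+ 2 = y ^+ 2 by lia.
  move/eqP: e; rewrite eqf_sqr => /orP[/eqP->|/eqP->]; first by rewrite eqxx.
  move/eqP: e'; rewrite eqf_sqr => /orP[/eqP->|/eqP->]; by rewrite eqxx ?orbT.
rewrite size_zrange.
have : (0 < L ^ 3)%N by rewrite expn_gt0 L_gt0.
lia.
Qed.

(* Points with the same [circle_cell] lie in an arc too short to contain three
   integer points: on the part of the circle where [|x| <= |y|], the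
   difference of ordinates is at most the difference of abscissas. *)
Definition circle_cell (z : int * int) : bool * bool * int :=
  if `|z.1| <= `|z.2| then (true, 0 <= z.2, (z.1 %/ L%:Z)%Z)
  else (false, 0 <= z.1, (z.2 %/ L%:Z)%Z).

Lemma divz_close x y : (x %/ L%:Z)%Z = (y %/ L%:Z)%Z -> `|x - y| < L%:Z.
Proof.
move=> e; have L0 : L%:Z != 0 by lia.
have := divz_eq x L; have := divz_eq y L; rewrite e.
have := modz_ge0 x L0; have := modz_ge0 y L0.
have := ltz_pmod x (_ : 0 < L%:Z); have := ltz_pmod y (_ : 0 < L%:Z).
by rewrite !ltz_nat => /(_ L_gt0) ? /(_ L_gt0); lia.
Qed.

Lemma circle_cell_close z w : z \in S -> w \in S ->
  circle_cell z = circle_cell w -> (z.1 - w.1) ^+ 2 + (z.2 - w.2) ^+ 2 <= 2 * L%:Z ^+ 2.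
Proof.
have aux x y x' y' : x ^+ 2 + y ^+ 2 = N -> x' ^+ 2 + y' ^+ 2 = N ->
   `|x| <= `|y| -> `|x'| <= `|y'| -> (0 <= y) = (0 <= y') ->
   (x %/ L%:Z)%Z = (x' %/ L%:Z)%Z ->
   (x - x') ^+ 2 + (y - y') ^+ 2 <= 2 * L%:Z ^+ 2.
  move=> e e' xy xy' yy' /divz_close xL.
  (* Both sides come from y^2 - y'^2 = x'^2 - x^2. As y and y' have the same sign, |y + y'| = |y| +
     |y'| dominates |x + x'|, so |y - y'| <= |x - x'|. *)
  have : `|y - y'| * `|y + y'| = `|x - x'| * `|x + x'|.
    by rewrite -!normrM -[RHS]normrN; congr (`|_|); lia.
  have : `|x + x'| <= `|y + y'| by lia.
  have [y0|y0] := eqVneq (y + y') 0.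
    move=> _ _; have -> : x = 0 by lia.
    have -> : x' = 0 by lia.
    have -> : y = 0 by lia.
    have -> : y' = 0 by lia.
    by rewrite !subr0 expr0n mulr_ge0 // sqr_ge0.
  have : 0 < `|y + y'| by lia.
  move: (`|y + y'|) (`|x + x'|) => c d c0 hc ee.
  have yx : `|y - y'| <= `|x - x'|.
    rewrite -(ler_pM2r c0) ee; exact: ler_wpM2l.
  have sq u : `|u| <= L%:Z -> u ^+ 2 <= L%:Z ^+ 2.
    by rewrite -(real_normK (num_real u)) ler_sqr ?nnegrE.
  by rewrite (_ : 2 = 1 + 1) // mulrDl !mul1r lerD ?sq ?(le_trans yx) // ltW.
case: z w => [x y] [x' y'] /SN /= e /SN /= e'.
rewrite /circle_cell /=; case: ifP => xy; case: ifP => xy' // [yy h]; first exact: aux.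
rewrite addrC; apply: aux yy h; rewrite 1?addrC //.
  by rewrite ltW // ltNge xy.
by rewrite ltW // ltNge xy'.
Qed.

(** Three distinct points of one cell have squared sides at most 2 L^2, and the product of these is
    4 N D^2 by [inscribed_triangle]. The integer D is nonzero because the sides are, so 4 N <= 8
    L^6, the case settled before. Otherwise each of the 4 (2 L^3 + 1) cells holds at most two
    points. *)
Lemma size_circle_points : (size S <= 24 * L ^ 3)%N.
Proof.
have [N6|N6] := lerP N (2 * (L ^ 6)%N%:Z); first exact: size_circle_points_small.
have bound x : x ^+ 2 <= N -> (x %/ L%:Z)%Z \in zrange (L ^ 3).
  move=> xN; rewrite mem_zrange.
  have : `|x| <= (L ^ 4)%N%:Z.
    have : (L ^ 8)%N%:Z = (L ^ 4)%N%:Z ^+ 2 by rewrite -[8%N]/(4 * 2)%N expnM; nia.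
    by move: (L ^ 4)%N => l ; nia.
  rewrite expnS -[_ <= _]/(_ <= _).
  have L0 : 0 < L%:Z by lia.
  have := ltz_pmod x L0; have := modz_ge0 x (lt0r_neq0 L0); have := divz_eq x L.
  move: (x %/ L%:Z)%Z (L ^ 3)%N (x %% L%:Z)%Z => d l r -> ? ? ?; nia.
pose V := [seq (b, i) | b <- [:: (true, true); (true, false); (false, true); (false, false)], i <- zrange (L ^ 3)].
have /leq_trans->// : (size S <= 2 * size V)%N.
  apply: (@size_le_fibers2 _ _ circle_cell) => // [z zS|x y z xS yS zS xy xz].
    have := SN zS; case: z {zS} => x y /= e; apply/allpairsP.
    have x0 := sqr_ge0 x; have y0 := sqr_ge0 y.
    rewrite /circle_cell; case: ifP => _ /=.
      exists ((true, 0 <= y), (x %/ L%:Z)%Z); split=> //=; last by apply: bound; lia.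
      by case: (0 <= y).
    exists ((false, 0 <= x), (y %/ L%:Z)%Z); split=> //=; last by apply: bound; lia.
    by case: (0 <= x).
  have yz := etrans (esym xy) xz.
  have := circle_cell_close xS yS xy; have := circle_cell_close xS zS xz.
  have := circle_cell_close yS zS yz.
  have := inscribed_triangle (SN xS) (SN yS) (SN zS).
  set a := (x.1 - y.1) ^+ 2 + _; set b := (x.1 - z.1) ^+ 2 + _.
  set c := (y.1 - z.1) ^+ 2 + _; set D := _ - _ => e c_le b_le a_le.
  have pt0 (u v : int * int) : (u.1 - v.1) ^+ 2 + (u.2 - v.2) ^+ 2 = 0 -> u == v.
    move/eqP; rewrite paddr_eq0 ?sqr_ge0 // !sqrf_eq0 !subr_eq0 => /andP[/eqP h1 /eqP h2].
    by case: u v h1 h2 => ? ? [? ?] /= -> ->.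
  have [D0|D0] := eqVneq D 0.
    have : a * b * c == 0 by rewrite e D0 expr0n mulr0.
    rewrite !mulf_eq0 -orbA => /or3P[] /eqP /pt0 ->; by rewrite ?orbT.
  have D1 : 1 <= D ^+ 2 by rewrite -gtz0_ge1 exprn_even_gt0.
  have [a0 b0 c0] : [/\ 0 <= a, 0 <= b & 0 <= c] by split; apply: addr_ge0; apply: sqr_ge0.
  have : a * b * c <= 8 * (L ^ 6)%N%:Z.
    apply: (@le_trans _ _ ((2 * L%:Z ^+ 2) * (2 * L%:Z ^+ 2) * (2 * L%:Z ^+ 2))).
      by do 2?[apply: ler_pM => //]; apply: mulr_ge0.
    by rewrite -[(L ^ 6)%N%:Z]natz natrX natz le_eqVlt; apply/orP; left; apply/eqP; ring.
  have : 4 * N <= 4 * N * D ^+ 2 by rewrite ler_peMr //; move: N6; clear; lia.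
  rewrite -e => h1 h2; have := le_trans h1 h2; move: N6.
  by move: (L ^ 6)%N; clear; lia.
rewrite size_allpairs size_zrange /=.
have : (0 < L ^ 3)%N by rewrite expn_gt0 L_gt0.
lia.
Qed.

End CirclePoints.

Lemma Euclid_dvdzM (p : nat) (a b : int) : prime p ->
  (p %| a * b)%Z = (p %| a)%Z || (p %| b)%Z.
Proof. by move=> pp; rewrite !dvdzE abszM Euclid_dvdM. Qed.

(** * Quaternions *)

Lemma quat_ext (T : Type) (a b c d a' b' c' d' : T) :
  a = a' -> b = b' -> c = c' -> d = d' -> (a, b, c, d) = (a', b', c', d').
Proof. by move=> -> -> -> ->. Qed.

Section Quaternions.
Variable R : comNzRingType.
Implicit Types x y z : R * R * R * R.

Definition qmul x y : R * R * R * R :=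
  let: (a, b, c, d) := x in let: (a', b', c', d') := y in
  (a * a' - b * b' - c * c' - d * d', a * b' + b * a' + c * d' - d * c',
   a * c' - b * d' + c * a' + d * b', a * d' + b * c' - c * b' + d * a').
Definition qconj x : R * R * R * R := let: (a, b, c, d) := x in (a, - b, - c, - d).
Definition qnorm x : R := let: (a, b, c, d) := x in a ^+ 2 + b ^+ 2 + c ^+ 2 + d ^+ 2.
Definition qscale r x : R * R * R * R := let: (a, b, c, d) := x in (r * a, r * b, r * c, r * d).
Definition qone : R * R * R * R := (1, 0, 0, 0).
(* Half the reduced trace. *)
Definition qre x : R := x.1.1.1.

Ltac qring := intros; repeat match goal with x : (_ * _ * _ * _)%type |- _ =>
  destruct x as [[[? ?] ?] ?] end; rewrite /qmul /qconj /qnorm /qscale /qone /qre /=;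
  try apply: quat_ext; ring.

Lemma qmulA x y z : qmul x (qmul y z) = qmul (qmul x y) z.
Proof. qring. Qed.

Lemma qmul1 x : qmul x qone = x.
Proof. qring. Qed.

Lemma q1mul x : qmul qone x = x.
Proof. qring. Qed.

Lemma qconjK x : qconj (qconj x) = x.
Proof. qring. Qed.

Lemma qconjM x y : qconj (qmul x y) = qmul (qconj y) (qconj x).
Proof. qring. Qed.

Lemma qnormM x y : qnorm (qmul x y) = qnorm x * qnorm y.
Proof. qring. Qed.

Lemma qnorm_conj x : qnorm (qconj x) = qnorm x.
Proof. qring. Qed.

Lemma qmulN x : qmul x (qconj x) = qscale (qnorm x) qone.
Proof. qring. Qed.

Lemma qmulVN x : qmul (qconj x) x = qscale (qnorm x) qone.
Proof. qring. Qed.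

Lemma qscale_mull r x y : qmul (qscale r x) y = qscale r (qmul x y).
Proof. qring. Qed.

Lemma qscale_mulr r x y : qmul x (qscale r y) = qscale r (qmul x y).
Proof. qring. Qed.

Lemma qscaleA r s x : qscale r (qscale s x) = qscale (r * s) x.
Proof. qring. Qed.

Lemma qscale1 x : qscale 1 x = x.
Proof. qring. Qed.

Lemma qnorm_scale r x : qnorm (qscale r x) = r ^+ 2 * qnorm x.
Proof. qring. Qed.

Lemma qre_mulC x y : qre (qmul x y) = qre (qmul y x).
Proof. qring. Qed.

Lemma qconj_mul_cancel x y : qmul (qconj x) (qmul x y) = qscale (qnorm x) y.
Proof. qring. Qed.

Definition qadd x y : R * R * R * R :=
  let: (a, b, c, d) := x in let: (a', b', c', d') := y in
  (a + a', b + b', c + c', d + d').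

(* Cayley-Hamilton applied to [y x]. *)
Lemma qsandwich x y : qmul y (qmul x y) =
  qadd (qscale (2%:R * qre (qmul y x)) y) (qscale (- qnorm y) (qconj x)).
Proof. qring. Qed.

Lemma qmulDl x y z : qmul (qadd x y) z = qadd (qmul x z) (qmul y z).
Proof. qring. Qed.

End Quaternions.

Definition qdvd (d : int) (x : int * int * int * int) : bool :=
  let: (a, b, c, e) := x in [&& (d %| a)%Z, (d %| b)%Z, (d %| c)%Z & (d %| e)%Z].

Lemma dvdzN (d a : int) : (d %| - a)%Z = (d %| a)%Z.
Proof. exact: rpredN. Qed.

Section IntQuaternions.
Implicit Types (d : int) (x y z : int * int * int * int).

Lemma qdvdP d x : reflect (exists y, x = qscale d y) (qdvd d x).
Proof.
case: x => [[[a b] c] e]; apply: (iffP and4P).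
  move=> [/dvdzP[a' ->] /dvdzP[b' ->] /dvdzP[c' ->] /dvdzP[e' ->]].
  by exists (a', b', c', e'); rewrite /qscale ![d * _]mulrC.
by move=> [[[[a' b'] c'] e'] [-> -> -> ->]]; split; rewrite dvdz_mulr.
Qed.

Lemma qdvd_scale d x : qdvd d (qscale d x).
Proof. by apply/qdvdP; exists x. Qed.

Lemma qdvd_mull d x y : qdvd d y -> qdvd d (qmul x y).
Proof. by move=> /qdvdP[z ->]; rewrite qscale_mulr qdvd_scale. Qed.

Lemma qdvd_conj d x : qdvd d (qconj x) = qdvd d x.
Proof. by case: x => [[[a b] c] e]; rewrite /= !dvdzN. Qed.

Lemma qdvd_scalel d r x : (d %| r)%Z -> qdvd d (qscale r x).
Proof. by case: x => [[[a b] c] e] /= h; rewrite !dvdz_mulr. Qed.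

Lemma qdvd_addr d x y : qdvd d y -> qdvd d (qadd x y) = qdvd d x.
Proof.
case: x y => [[[a b] c] e] [[[a' b'] c'] e'] /= /and4P[? ? ? ?].
by do 4 rewrite rpredDr //.
Qed.

Lemma qscale_inj d : d != 0 -> injective (qscale d).
Proof.
move=> d0 [[[a b] c] e] [[[a' b'] c'] e'] [].
by do 4 move=> /(mulfI d0) ->.
Qed.

(* Modulo p the quaternions form a matrix algebra in which B has rank at
   most one; here [B x A B = tr (x A B) B] for the x = 1, i, j, k. *)
Lemma qdvd_mul3 (p : nat) (A B C : int * int * int * int) :
  prime p -> (2 < p)%N -> (p %| qnorm B)%Z ->
  qdvd p (qmul A (qmul B C)) -> qdvd p (qmul A B) || qdvd p (qmul B C).
Proof.
move=> pp p2 pB pABC; apply/orP.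
have key x : (p %| 2%:R * qre (qmul x (qmul A B)))%Z \/ qdvd p (qmul B C).
  have : qdvd p (qmul B (qmul x (qmul A (qmul B C)))) by do 2 apply: qdvd_mull.
  have -> : qmul B (qmul x (qmul A (qmul B C))) = qmul (qmul B (qmul (qmul x A) B)) C.
    by rewrite !qmulA.
  rewrite qsandwich qmulDl qdvd_addr ?qscale_mull; last by rewrite qdvd_scalel ?dvdzN.
  have -> : qre (qmul B (qmul x A)) = qre (qmul x (qmul A B)).
    by rewrite qre_mulC qmulA.
  move: (2%:R * _) => t; case: (qmul B C) => [[[a b] c] e] /=.
  by rewrite !Euclid_dvdzM //; case: (p %| t)%Z => //= ?; [left | right].
case: (boolP (qdvd p (qmul B C))) => [|nBC]; [by right|left].
have np2 : (p %| 2)%Z = false by rewrite dvdzE /= gtnNdvd.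
have {}key x : (p %| qre (qmul x (qmul A B)))%Z.
  by case: (key x) nBC => [|->//]; rewrite Euclid_dvdzM // np2.
case: (qmul A B) key => [[[a b] c] e] key.
move: (key (1, 0, 0, 0)) (key (0, 1, 0, 0)) (key (0, 0, 1, 0)) (key (0, 0, 0, 1)).
rewrite /qre /= !mul0r !mul1r !subr0 !add0r ?sub0r ?oppr0 ?addr0 ?subr0 !dvdzN.
by move=> -> -> -> ->.
Qed.

End IntQuaternions.

(** * Quaternion generators of a free group *)

Lemma exists_floor_root (e N : nat) : (0 < e)%N ->
  exists L : nat, (L ^ e <= N < L.+1 ^ e)%N.
Proof.
move=> e0; have ex : exists L : nat, (N < L.+1 ^ e)%N.
  by exists N; apply: leq_trans (ltnSn N) _; rewrite -{1}(expn1 N.+1) leq_pexp2l.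
have [L] := ex_minnP ex; case: L => [|L] NL minL.
  by exists 0%N; rewrite NL exp0n.
exists L.+1; rewrite NL andbT leqNgt; apply/negP => /minL.
by rewrite ltnn.
Qed.

(** A prime divisor of (M!)^2 + 1 exceeds M, and M! is a square root of -1 modulo it. *)
Lemma exists_prime_sqrtN1 (M : nat) :
  exists p iota : nat, [/\ prime p, (M < p)%N & (p %| iota ^ 2 + 1)%N].
Proof.
pose N := ((M`!) ^ 2 + 1)%N; have N1 : (1 < N)%N by rewrite /N addn1 ltnS expn_gt0 fact_gt0.
exists (pdiv N), M`!; split; [exact: pdiv_prime | | exact: pdiv_dvd].
rewrite ltnNge; apply/negP => le.
have d : (pdiv N %| (M`!) ^ 2)%N by rewrite dvdn_exp // dvdn_fact // pdiv_gt0.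
have := pdiv_dvd N; rewrite {2}/N dvdn_addr // dvdn1 => /eqP e.
by have := pdiv_prime N1; rewrite e.
Qed.

Section SplitQuaternions.
Variables (F : fieldType) (iota : F).
Implicit Types x y : F * F * F * F.

(* The quaternion (a, b, c, d) corresponds to the matrix with rows
   (a + b iota, c + d iota) and (- c + d iota, a - b iota). *)
Definition qkills (r : F) x : Prop :=
  let: (a, b, c, d) := x in
  (a + b * iota) + (c + d * iota) * r = 0 /\ (- c + d * iota) + (a - b * iota) * r = 0.

Hypothesis iota2 : iota ^+ 2 = - 1.
Hypothesis two0 : 2%:R != 0 :> F.

(** The matrix of x kills the column (1, r), so its determinant, which is the norm of x,
    vanishes. *)
Lemma qkills_norm r x : qkills r x -> qnorm x = 0.
Proof.
case: x => [[[a b] c] d] [h1 h2] /=.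
have : (a + b * iota + (c + d * iota) * r) * (a - b * iota)
  - (c + d * iota) * (- c + d * iota + (a - b * iota) * r) =
  a ^+ 2 + b ^+ 2 + c ^+ 2 + d ^+ 2 by ring: iota2.
by rewrite h1 h2 mul0r mulr0 subr0.
Qed.

Lemma half_matrix_eq0 r a b c d : qkills r (a, b, c, d) ->
  c + d * iota = 0 -> a - b * iota = 0 -> (a, b, c, d) = (0, 0, 0, 0).
Proof.
move=> [h1 h2] v u; move: h1 h2; rewrite u v !mul0r !addr0 => h1 h2.
have i0 : iota != 0.
  by apply/eqP => i0; move/eqP: iota2; rewrite i0 expr0n eq_sym oppr_eq0 oner_eq0.
have z2 (x y : F) : x = 0 -> y = 0 -> (x + y) / 2%:R = 0.
  by move=> -> ->; rewrite addr0 mul0r.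
apply: quat_ext.
- by rewrite -(z2 _ _ h1 u); field.
- apply: (mulIf i0); rewrite mul0r -(z2 _ _ h1 (_ : b * iota - a = 0)); first by field.
  by rewrite -opprB u oppr0.
- rewrite -(z2 _ _ v (_ : c - d * iota = 0)); first by field.
  by rewrite -[LHS]opprK opprB addrC h2 oppr0.
- by apply: (mulIf i0); rewrite mul0r -(z2 _ _ v h2); field.
Qed.

(** The matrix of y^* is the adjugate of that of y; if y is nonzero, its image is the kernel of y,
    the line of (1, r'). So x kills (1, r') besides (1, r), hence everything. *)
Lemma qmul_conj_eq0 r r' x y : qkills r x -> qkills r' y -> r != r' ->
  qmul x (qconj y) = (0, 0, 0, 0) -> x = (0, 0, 0, 0) \/ y = (0, 0, 0, 0).
Proof.
case: x y => [[[a b] c] d] [[[a' b'] c'] d'] kx ky rr.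
case => m1 m2 m3 m4.
have rr0 : r' - r != 0 by rewrite subr_eq0 eq_sym.
have [h1 h2] := kx; have [h3 h4] := ky.
pose u := a + b * iota; pose v := c + d * iota.
pose v1 := - c + d * iota; pose u1 := a - b * iota.
pose w := a' + b' * iota; pose z := c' + d' * iota.
pose z1 := - c' + d' * iota; pose w1 := a' - b' * iota.
have comb (s t s' t' : F) : s' = 0 -> t' = 0 -> s * s' + t * t' = 0.
  by move=> -> ->; rewrite !mulr0 addr0.
have e1 : u * w1 - v * z1 = 0.
  by rewrite -[RHS](comb 1 iota _ _ m1 m2) /u /v /w1 /z1; ring: iota2.
have e2 : - u * z + v * w = 0.
  by rewrite -[RHS](comb 1 iota _ _ m3 m4) /u /v /w /z; ring: iota2.
have e3 : v1 * w1 - u1 * z1 = 0.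
  by rewrite -[RHS](comb (-1) iota _ _ m3 m4) /u1 /v1 /w1 /z1; ring: iota2.
have e4 : - v1 * z + u1 * w = 0.
  by rewrite -[RHS](comb 1 (- iota) _ _ m1 m2) /u1 /v1 /w /z; ring: iota2.
(* First columns are -r or -r' times second columns. Substituted into [e1] to [e4], the entries of
   the matrix of x y^*, this leaves, up to sign, r' - r times products of second-column entries. *)
have su : u = - (v * r) by apply/eqP; rewrite -addr_eq0; apply/eqP.
have sv1 : v1 = - (u1 * r) by apply/eqP; rewrite -addr_eq0; apply/eqP.
have sw : w = - (z * r') by apply/eqP; rewrite -addr_eq0; apply/eqP.
have sz1 : z1 = - (w1 * r') by apply/eqP; rewrite -addr_eq0; apply/eqP.
have pr t t' : (r' - r) * (t * t') = 0 -> (t == 0) || (t' == 0).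
  by move/eqP; rewrite !mulf_eq0 (negPf rr0).
have p1 : (v == 0) || (w1 == 0) by apply: pr; rewrite -e1 su sz1; ring.
have p2 : (v == 0) || (z == 0).
  by apply: pr; rewrite -[RHS]oppr0 -e2 su sw; ring.
have p3 : (u1 == 0) || (w1 == 0) by apply: pr; rewrite -e3 sv1 sz1; ring.
have p4 : (u1 == 0) || (z == 0).
  by apply: pr; rewrite -[RHS]oppr0 -e4 sv1 sw; ring.
have [v0|v0] := eqVneq v 0; last first.
  right; apply: (half_matrix_eq0 ky); apply/eqP; first by rewrite (negPf v0) in p2.
  by rewrite (negPf v0) in p1.
have [u0|u0] := eqVneq u1 0; first by left; apply: (half_matrix_eq0 kx).
right; apply: (half_matrix_eq0 ky); apply/eqP; first by rewrite (negPf u0) in p4.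
by rewrite (negPf u0) in p3.
Qed.

End SplitQuaternions.

Section QuaternionsModP.
Variables (p : nat).
Hypothesis pp : prime p.

Lemma intr_Fp_eq0 (a : int) : (a%:~R == 0 :> 'F_p) = (p %| a)%Z.
Proof. by rewrite (dvdz_pcharf (pchar_Fp pp)). Qed.

Definition qcast (R : comNzRingType) (x : int * int * int * int) : R * R * R * R :=
  let: (a, b, c, d) := x in (a%:~R, b%:~R, c%:~R, d%:~R).

Lemma qcast_mul (R : comNzRingType) x y : qcast R (qmul x y) = qmul (qcast R x) (qcast R y).
Proof.
case: x y => [[[a b] c] d] [[[a' b'] c'] d'].
by rewrite /qcast /qmul !(rmorphD, rmorphN, rmorphM).
Qed.

Lemma qcast_conj (R : comNzRingType) x : qcast R (qconj x) = qconj (qcast R x).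
Proof. by case: x => [[[a b] c] d]; rewrite /qcast /qconj !rmorphN. Qed.

Lemma qcast_norm (R : comNzRingType) x : qnorm (qcast R x) = (qnorm x)%:~R.
Proof. by case: x => [[[a b] c] d]; rewrite /qcast /qnorm !intrD !rmorphXn. Qed.

Lemma qcast_eq0 x : (qcast 'F_p x == (0, 0, 0, 0)) = qdvd p x.
Proof. by case: x => [[[a b] c] d]; rewrite /= !xpair_eqE /= !intr_Fp_eq0 -!andbA. Qed.

(** Thue's argument: with m the integer part of sqrt p, there are (m + 1)^4 > p^2 quaternions with
    coordinates in [0, m], for two linear conditions modulo p. The difference of two that collide
    has coordinates at most sqrt p in absolute value. *)
Lemma pigeonhole_quaternion (iota r : nat) :
  exists x : int * int * int * int,
    [/\ x <> (0, 0, 0, 0), (qnorm x <= (4 * p)%N%:Z) &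
        qkills (iota%:R : 'F_p) r%:R (qcast 'F_p x)].
Proof.
have [m /andP[m_le m_gt]] := @exists_floor_root 2 p isT.
pose T := ('I_m.+1 * 'I_m.+1 * 'I_m.+1 * 'I_m.+1)%type.
pose z (t : T) : int * int * int * int :=
  let: (a, b, c, d) := t in (a%:Z, b%:Z, c%:Z, d%:Z).
pose g (x : int * int * int * int) : 'F_p * 'F_p :=
  let: (a, b, c, d) := qcast 'F_p x in
  ((a + b * iota%:R) + (c + d * iota%:R) * r%:R,
   (- c + d * iota%:R) + (a - b * iota%:R) * r%:R).
have : ~~ injectiveb (g \o z).
  apply/injectiveP => /leq_card; rewrite !card_prod !card_ord (Fp_cast pp).
  rewrite leqNgt => /negP; apply.
  by rewrite -mulnA !mulnn ltn_exp2r.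
case/injectivePn => t [t' tt' e].
exists (qadd (z t) (qscale (-1) (z t'))); split.
- case: t t' tt' {e} => [[[a b] c] d] [[[a' b'] c'] d'] /eqP tt' [h1 h2 h3 h4]; apply: tt'.
  by apply: quat_ext; apply: val_inj => /=; lia.
- have sq (a b : 'I_m.+1) : (a%:Z + -1 * b%:Z) ^+ 2 <= p%:Z.
    have : `|a%:Z + -1 * b%:Z| <= m%:Z by have := ltn_ord a; have := ltn_ord b; lia.
    move: m_le; rewrite -(lez_nat _ p) => m_le h; apply: le_trans m_le.
    by rewrite -(real_normK (num_real _)) -[(m ^ 2)%N%:Z]natz natrX natz ler_sqr ?nnegrE.
  case: t t' {tt' e} => [[[a b] c] d] [[[a' b'] c'] d'] /=.
  have := sq a a'; have := sq b b'; have := sq c c'; have := sq d d'.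
  move: (_ ^+ 2) (_ ^+ 2) (_ ^+ 2) (_ ^+ 2) => x1 x2 x3 x4; lia.
- move: e; rewrite /g /=; case: t t' {tt'} => [[[a b] c] d] [[[a' b'] c'] d'] /=.
  rewrite !(rmorphD, rmorphM, rmorphN1) => /eqP.
  rewrite xpair_eqE => /andP[/eqP e1 /eqP e2].
  have sub (x y : 'F_p) : x = y -> x - y = 0 by move=> ->; rewrite subrr.
  by split; [rewrite -(sub _ _ e1) | rewrite -(sub _ _ e2)]; ring.
Qed.

End QuaternionsModP.

Lemma mem_int_sqr_range (B : nat) (a : int) : a ^+ 2 <= (B ^ 2)%N%:Z -> a \in zrange B.
Proof.
by rewrite mem_zrange -(real_normK (num_real a)) -[(B ^ 2)%N%:Z]natz natrX natz ler_sqr ?nnegrE.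
Qed.

Definition quat_range (B : nat) : seq (int * int * int * int) :=
  [seq (x, d) | x <- [seq (x, c) | x <- [seq (a, b) | a <- zrange B, b <- zrange B], c <- zrange B], d <- zrange B].

Lemma size_quat_range B : size (quat_range B) = ((2 * B).+1 ^ 4)%N.
Proof. by rewrite !size_allpairs !size_zrange -mulnA !mulnn -expnM. Qed.

Lemma mem_quat_range B x : qnorm x <= (B ^ 2)%N%:Z -> x \in quat_range B.
Proof.
case: x => [[[a b] c] d] /= h.
have [ha hb hc hd] : [/\ a \in zrange B, b \in zrange B, c \in zrange B & d \in zrange B].
  have := sqr_ge0 a; have := sqr_ge0 b; have := sqr_ge0 c; have := sqr_ge0 d.
  move=> h1 h2 h3 h4; split; apply: mem_int_sqr_range; move: h h1 h2 h3 h4;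
    move: (a ^+ 2) (b ^+ 2) (c ^+ 2) (d ^+ 2) (B ^ 2)%N; clear; lia.
by do 3! [apply: (allpairs_f pair) => //].
Qed.

(* The elements have distinct kernels modulo p, which takes care of [x y^*].
   For fixed x the condition [p | x^* y] leaves at most [9 ^ 4] values for y,
   since [x^* y / p] has norm [c ^ 2]: a maximal subset avoiding it is large. *)
Lemma exists_tree_generators (M : nat) : exists (p c k : nat) (s : 'I_k -> int * int * int * int),
  [/\ prime p, (M < p)%N, (0 < c <= 4)%N, (k <= p)%N & (p <= 4 * 9 ^ 4 * k)%N] /\
  ((forall a, qnorm (s a) = (c * p)%N%:Z) /\
   forall a b, a != b ->
     ~~ qdvd p (qmul (s a) (qconj (s b))) /\ ~~ qdvd p (qmul (qconj (s a)) (s b))).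
Proof.
have [p [iota [pp pM iota2]]] := exists_prime_sqrtN1 (maxn M 5).
have {pM} [pM p5] : (M < p)%N /\ (5 < p)%N by lia.
have p0 := prime_gt0 pp.
pose i0 : 'F_p := iota%:R.
have i02 : i0 ^+ 2 = -1.
  apply/eqP; rewrite -addr_eq0 /i0 -natrX -[1]/(1%:R) -natrD.
  by have := intr_Fp_eq0 pp (iota ^ 2 + 1)%N; rewrite dvdzE /= iota2 pmulrn => ->.
have two0 : 2%:R != 0 :> 'F_p.
  by have := intr_Fp_eq0 pp 2; rewrite dvdzE /= pmulrn => ->; rewrite gtnNdvd //; lia.
have /choice[x xP] : forall r : 'F_p, exists x : int * int * int * int,
    [/\ x <> (0, 0, 0, 0), (qnorm x <= (4 * p)%N%:Z) & qkills i0 r (qcast 'F_p x)].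
  by move=> r; have := pigeonhole_quaternion pp iota r; rewrite natr_Zp.
(* A nonzero multiple of p has norm at least p^2 > 4 p. *)
have x_ndvd r : ~~ qdvd p (x r).
  have [x0 xn _] := xP r; apply/negP => /qdvdP[y yx]; apply: x0.
  move: xn; rewrite yx qnorm_scale.
  case: y yx => [[[a b] c] d] _ /= h.
  have {h} : a ^+ 2 + b ^+ 2 + c ^+ 2 + d ^+ 2 < 1.
    rewrite -(ltr_pM2l (_ : 0 < p%:Z ^+ 2)); last by rewrite exprn_gt0 // ltz_nat.
    apply: le_lt_trans h _; rewrite mulr1 expr2 PoszM ltr_pM2r; lia.
  have := sqr_ge0 a; have := sqr_ge0 b; have := sqr_ge0 c; have := sqr_ge0 d.
  have z (t : int) : t ^+ 2 = 0 -> t = 0 by move/eqP; rewrite sqrf_eq0 => /eqP.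
  move=> h1 h2 h3 h4 h.
  have [/z -> /z -> /z -> /z ->] : [/\ a ^+ 2 = 0, b ^+ 2 = 0, c ^+ 2 = 0 & d ^+ 2 = 0].
    move: h h1 h2 h3 h4; move: (a ^+ 2) (b ^+ 2) (c ^+ 2) (d ^+ 2); clear.
    by split; lia.
  by rewrite !mulr0.
have norm_dvd r : (p %| qnorm (x r))%Z.
  have [_ _ k] := xP r.
  by rewrite -(intr_Fp_eq0 pp) -qcast_norm (qkills_norm i02 k).
have norm_gt0 r : 0 < qnorm (x r).
  have [x0 _ _] := xP r; rewrite lt_neqAle; case: (x r) x0 => [[[a b] c] d] /= x0.
  rewrite !addr_ge0 ?sqr_ge0 // andbT eq_sym; apply/eqP => /eqP.
  rewrite !paddr_eq0 ?addr_ge0 ?sqr_ge0 // !sqrf_eq0.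
  by move=> /andP[/andP[/andP[/eqP a0 /eqP b0] /eqP c0] /eqP d0]; apply: x0; rewrite a0 b0 c0 d0.
have distinct r r' : r != r' -> ~~ qdvd p (qmul (x r) (qconj (x r'))).
  move=> rr; have [_ _ k] := xP r; have [_ _ k'] := xP r'.
  rewrite -qcast_eq0 // qcast_mul qcast_conj; apply/eqP => /(qmul_conj_eq0 i02 two0 k k' rr).
  by case=> /eqP; rewrite qcast_eq0 // (negPf (x_ndvd _)).
have /choice[cc ccP] : forall r, exists c : 'I_5, qnorm (x r) = (c * p)%N%:Z /\ (0 < c)%N.
  move=> r; have /dvdzP[c0 e] := norm_dvd r; have [_ le _] := xP r.
  move: (norm_gt0 r) le; rewrite e => c_gt0 le.
  have c0_gt0 : 0 < c0 by move: c_gt0; rewrite pmulr_lgt0 // ltz_nat.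
  have c0_le : c0 <= 4 by move: le; rewrite PoszM ler_pM2r // ltz_nat.
  have lt5 : (absz c0 < 5)%N by lia.
  by exists (Ordinal lt5) => /=; rewrite PoszM gez0_abs; lia.
(* Pigeonhole: one of the four values 1, ..., 4 of norm / p is taken for at least a quarter of the p
   parameters r. *)
have [c0 c0P] : exists c0 : 'I_5, (p <= 4 * #|[set r | cc r == c0]|)%N /\ (0 < c0)%N.
  have cov : (p = \sum_(c < 5) #|[set r | cc r == c]|)%N.
    rewrite -{1}(card_Fp pp) -sum1_card (partition_big cc xpredT) //=.
    by apply: eq_bigr => c _; rewrite -sum1_card; apply: eq_bigl => r; rewrite inE.
  have [h|/existsPn h] := boolP [exists c0 : 'I_5, (p <= 4 * #|[set r | cc r == c0]|)%N && (0 < c0)%N].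
    by have /existsP[c0 /andP[h1 h2]] := h; exists c0.
  have z0 : #|[set r | cc r == ord0]| = 0%N.
    by apply: eq_card0 => r; rewrite !inE; apply/eqP => e; have := (ccP r).2; rewrite e.
  move: cov; rewrite !big_ord_recl big_ord0 z0.
  have := h (lift ord0 ord0); have := h (lift ord0 (lift ord0 ord0)).
  have := h (lift ord0 (lift ord0 (lift ord0 ord0))).
  have := h (lift ord0 (lift ord0 (lift ord0 (lift ord0 ord0)))).
  rewrite !andbT; move: #|_| #|_| #|_| #|_|; clear; lia.
set T := [set r | cc r == c0] in c0P.
pose bad r r' := qdvd p (qmul (qconj (x r)) (x r')).
pose indep (S : {set 'F_p}) := (S \subset T) && [forall r in S, forall r' in S, (r != r') ==> ~~ bad r r'].
have [S /andP[ST /forall_inP Sind] Smax] : exists2 S : {set 'F_p}, indep S & forall S', indep S' -> (#|S'| <= #|S|)%N.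
  have ind0 : indep finset.set0 by rewrite /indep finset.sub0set; apply/forall_inP => r; rewrite inE.
  by case: (arg_maxnP (fun S : {set 'F_p} => #|S|) ind0) => S h1 h2; exists S.
have bad_sym r r' : bad r r' = bad r' r.
  by rewrite /bad -qdvd_conj qconjM qconjK.
(* Otherwise r, which is bad with itself, would lie outside S and could be added to it, against
   maximality. *)
have cover r : r \in T -> exists2 s, s \in S & bad s r.
  move=> rT; have [/exists_inP//|nex] := boolP [exists s in S, bad s r].
  have nS s : s \in S -> ~~ bad s r.
    by move=> sS; apply: contraNN nex => h; apply/exists_inP; exists s.
  have rS : r \notin S.
    apply/negP => /nS; rewrite /bad qmulVN qdvd_scalel //; exact: norm_dvd.
  have : (#|r |: S| <= #|S|)%N; last by rewrite finset.cardsU1 rS ltnn.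
  apply: Smax; rewrite /indep finset.subUset finset.sub1set rT ST /=.
  apply/forall_inP => s /finset.setU1P sS; apply/forall_inP => s' /finset.setU1P s'S; apply/implyP => ss'.
  case: sS s'S => [es|sS] [es'|s'S]; rewrite ?es ?es' in ss' *.
  - by rewrite eqxx in ss'.
  - by rewrite bad_sym nS.
  - exact: nS.
  - by have /forall_inP/(_ _ s'S) := Sind _ sS; rewrite ss'.
have fiber s : s \in S -> (#|[set r in T | bad s r]| <= 9 ^ 4)%N.
  move=> sS; pose D := [set r in T | bad s r].
  pose f r := let: (a, b, c, d) := qmul (qconj (x s)) (x r) in
    ((a %/ p)%Z, (b %/ p)%Z, (c %/ p)%Z, (d %/ p)%Z).
  have fE r : r \in D -> qmul (qconj (x s)) (x r) = qscale p%:Z (f r).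
    rewrite inE /bad /f => /andP[_].
    by case: (qmul _ _) => [[[a b] c] d] /and4P[? ? ? ?]; rewrite /qscale ![p%:Z * _]mulrC !divzK.
  have norm_T r : r \in T -> qnorm (x r) = (c0 * p)%N%:Z.
    by rewrite inE (ccP r).1 => /eqP ->.
  have sT : s \in T by apply: (fintype.subsetP ST).
  have p20 : 0 < p%:Z ^+ 2 by rewrite exprn_gt0 // ltz_nat.
  have fin : {in D, forall r, f r \in quat_range 4}.
    move=> r rD; apply: mem_quat_range; rewrite -(ler_pM2l p20) -qnorm_scale -fE //.
    have rT : r \in T by move: rD; rewrite inE => /andP[].
    rewrite qnormM qnorm_conj !norm_T // -expr2 PoszM exprMn mulrC ler_pM2l //.
    by have := ltn_ord c0; case: (c0 : nat) => [|[|[|[|[|]]]]].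
  have finj : {in D &, injective f}.
    move=> r r' rD rD' e; apply/eqP/negP => /negP /distinct /negP; apply.
    have -> : x r = x r'.
      apply: (@qscale_inj (qnorm (x s))); first by rewrite gt_eqF.
      have cancel t : qscale (qnorm (x s)) (x t) = qmul (x s) (qmul (qconj (x s)) (x t)).
        by rewrite qmulA qmulN qscale_mull q1mul.
      by rewrite !cancel !fE // e.
    by rewrite qmulN qdvd_scalel.
  rewrite -[9%N]/((2 * 4).+1) -size_quat_range cardE -(size_map f).
  apply: uniq_leq_size; first by rewrite map_inj_in_uniq ?enum_uniq // => r r'; rewrite !mem_enum; apply: finj.
  by move=> _ /mapP[r + ->]; rewrite mem_enum; apply: fin.
have cardT : (#|T| <= #|S| * 9 ^ 4)%N.
  rewrite -sum1_card -sum_nat_const.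
  apply: (@leq_trans (\sum_(r in T) \sum_(s in S) bad s r)%N).
    apply: leq_sum => r /cover[s sS b]; rewrite (bigD1 s) //= b; exact: leq_addr.
  rewrite exchange_big; apply: leq_sum => s /fiber; rewrite -sum1_card; apply: leq_trans.
  by rewrite big_mkcond [X in (_ <= X)%N]big_mkcond; apply: leq_sum => r _; rewrite inE; case: (r \in T); case: (bad s r).
exists p, c0, #|S|, (fun a => x (enum_val a)).
have inT (a : 'I_#|S|) : cc (enum_val a) = c0.
  by have := fintype.subsetP ST _ (enum_valP a); rewrite inE => /eqP.
split.
  case: c0P => h h'; split=> //; first by rewrite h' -ltnS ltn_ord.
    by have := max_card (mem S); rewrite card_Fp.
  by apply: leq_trans h _; rewrite -mulnA leq_pmul2l // mulnC.
split=> [a|a b ab]; first by rewrite (ccP _).1 inT.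
have ab' : enum_val a != enum_val b by apply: contraNneq ab => /enum_val_inj ->.
split; first exact: distinct.
have /forall_inP := Sind _ (enum_valP a); move=> /(_ _ (enum_valP b)).
by rewrite ab'.
Qed.

(** * Counting words with scalar value *)

(* If [y0 = h] modulo q and [y0 ^ 2 = h ^ 2] modulo [q ^ 2] then [y0 = h]
   modulo [q ^ 2]: there are few values of y0, and then few values of y1; the
   remaining coordinates lie on a circle. *)
Lemma size_near_scalar (h q L : nat) (S : seq (int * int * int * int)) :
  prime q -> ~~ (q %| 2 * h)%N -> (0 < L)%N -> (h <= q * L ^ 4)%N -> uniq S ->
  {in S, forall Y, [/\ qnorm Y = (h ^ 2)%N%:Z, Y <> (h%:Z, 0, 0, 0) &
     let: (a, b, c, d) := Y in
     [/\ (q %| a - h%:Z)%Z, (q %| b)%Z, (q %| c)%Z & (q %| d)%Z]]} ->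
  (q ^ 3 * size S <= 144 * h ^ 2 * L ^ 3)%N.
Proof.
move=> pq qh L0 hL uS SP.
have q0 := prime_gt0 pq; have q1 := prime_gt1 pq.
have q00 : q%:Z != 0 by lia.
have decomp Y : Y \in S -> exists (w : nat) (z1 z2 z3 : int),
   [/\ Y = (h%:Z - (q ^ 2)%N%:Z * w%:Z, q%:Z * z1, q%:Z * z2, q%:Z * z3),
     (0 < w)%N, (q ^ 2 * w <= 2 * h)%N &
     z1 ^+ 2 + z2 ^+ 2 + z3 ^+ 2 = 2 * h%:Z * w%:Z - (q ^ 2)%N%:Z * w%:Z ^+ 2].
  move=> /SP; case: Y => [[[a b] c] d] [/= nY Yh [qa /dvdzP[z1 eb] /dvdzP[z2 ec] /dvdzP[z3 ed]]].
  have qq : q%:Z ^+ 2 = (q ^ 2)%N%:Z by rewrite -[(q ^ 2)%N%:Z]natz natrX natz.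
  have hh : h%:Z ^+ 2 = (h ^ 2)%N%:Z by rewrite -[(h ^ 2)%N%:Z]natz natrX natz.
  have e : (h%:Z - a) * (h%:Z + a) = q%:Z ^+ 2 * (z1 ^+ 2 + z2 ^+ 2 + z3 ^+ 2).
    transitivity (h%:Z ^+ 2 - a ^+ 2); first by ring.
    by rewrite hh -nY eb ec ed; ring.
  (* By [e], q^2 divides (h - a)(h + a), and h + a, congruent to 2 h modulo q, is prime to q. *)
  have cop : coprimez (q%:Z ^+ 2) (h%:Z + a).
    rewrite coprimezXl // /coprimez.
    have -> : h%:Z + a = (2 * h)%N%:Z + (a - h%:Z) by rewrite PoszM; ring.
    have /dvdzP[t ->] := qa.
    by rewrite addrC gcdzMDl -[gcdz _ _ == _]/(coprimez q (2 * h)%N) coprimezE prime_coprime.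
  have : (q%:Z ^+ 2 %| h%:Z - a)%Z.
    by rewrite -(Gauss_dvdzl _ cop) e dvdz_mulr.
  move=> /dvdzP[w ew].
  have ha : `|a| <= h%:Z.
    rewrite -ler_sqr ?nnegrE // real_normK ?num_real // hh -nY.
    by rewrite -!addrA lerDl !addr_ge0 // sqr_ge0.
  have w0 : 0 <= w.
    have : 0 <= w * q%:Z ^+ 2 by rewrite -ew subr_ge0 (le_trans (ler_norm a)).
    by rewrite pmulr_lge0 // exprn_gt0 // ltz_nat.
  have eN : z1 ^+ 2 + z2 ^+ 2 + z3 ^+ 2 = 2 * h%:Z * w - q%:Z ^+ 2 * w ^+ 2.
    apply: (mulfI (_ : q%:Z ^+ 2 != 0)); first by rewrite expf_neq0.
    rewrite -e ew; have -> : a = h%:Z - w * q%:Z ^+ 2 by rewrite -ew; ring.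
    by ring.
  have wE : w = (absz w)%:Z by rewrite gez0_abs.
  exists (absz w), z1, z2, z3; rewrite -wE -qq; split=> //.
  - by rewrite eb ec ed ![q%:Z * _]mulrC; congr (_, _, _, _); rewrite mulrC -ew; ring.
  - rewrite lt0n; apply/eqP => wz; apply: Yh.
    have w00 : w = 0 by rewrite wE wz.
    have : z1 ^+ 2 + z2 ^+ 2 + z3 ^+ 2 = 0 by rewrite eN w00 expr0n /= !mulr0 subrr.
    move/eqP; rewrite !paddr_eq0 ?addr_ge0 ?sqr_ge0 // !sqrf_eq0.
    move=> /andP[/andP[/eqP z10 /eqP z20] /eqP z30].
    rewrite eb ec ed z10 z20 z30 !mul0r; congr (_, _, _, _).
    by apply/eqP; rewrite -subr_eq0 -opprB ew w00 mul0r oppr0.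
  - rewrite -lez_nat PoszM -qq -wE mulrC -ew PoszM.
    by move: ha; clear; lia.
have [->|[Y0 Y0S]] : S = [::] \/ exists Y, Y \in S.
    by case: (S) => [|Y S']; [left | right; exists Y; rewrite mem_head].
  by rewrite muln0.
(* This absorbs the additive 1 in the number of values of z1. *)
have qh2 : (q <= h)%N.
  have [w [z1 [z2 [z3 [_ w0 wh _]]]]] := decomp _ Y0S.
  have : (q ^ 2 <= 2 * h)%N by apply: leq_trans wh; rewrite leq_pmulr.
  by rewrite -mulnn; nia.
pose V := [seq (w, z) | w <- [seq i%:Z | i <- iota 1 (2 * h %/ q ^ 2)], z <- zrange (h %/ q)].
pose f (Y : int * int * int * int) := let: (a, b, c, d) := Y in
   (((h%:Z - a) %/ (q ^ 2)%N%:Z)%Z, (b %/ q)%Z).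
have q20 : (q ^ 2)%N%:Z != 0 by rewrite eqz_nat expn_eq0 (gtn_eqF q0).
have fE w z1 z2 z3 : f (h%:Z - (q ^ 2)%N%:Z * w, q%:Z * z1, q%:Z * z2, q%:Z * z3) = (w, z1).
  by rewrite /f opprB addrC subrK !mulKz.
(* The difference of the two sides is the square of h - q^2 w. With h <= q L^4 it bounds the radius
   of the circles by L^4. *)
have Nle w : (q%:Z * q%:Z) * (2 * h%:Z * w - (q ^ 2)%N%:Z * w ^+ 2) <= h%:Z ^+ 2.
  have -> : (q ^ 2)%N%:Z = q%:Z * q%:Z by rewrite -mulnn PoszM.
  rewrite -subr_ge0; have -> : h%:Z ^+ 2 - q%:Z * q%:Z * (2 * h%:Z * w - q%:Z * q%:Z * w ^+ 2) =
    (h%:Z - q%:Z * q%:Z * w) ^+ 2 by ring.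
  exact: sqr_ge0.
have NL w : 2 * h%:Z * w - (q ^ 2)%N%:Z * w ^+ 2 <= (L ^ 8)%N%:Z.
  rewrite -(ler_pM2l (_ : 0 < q%:Z * q%:Z)); last by rewrite mulr_gt0 // ltz_nat.
  apply: le_trans (Nle w) _; rewrite expr2 -!PoszM lez_nat.
  by rewrite (_ : q * q * L ^ 8 = (q * L ^ 4) * (q * L ^ 4))%N ?leq_mul //; ring.
have : (size S <= 24 * L ^ 3 * size V)%N.
  apply: (size_le_fibers (f := f)) => [Y /decomp|u].
    move=> [w [z1 [z2 [z3 [-> w0 wh eN]]]]].
    rewrite fE; apply: allpairs_f.
      by apply: map_f; rewrite mem_iota w0 add1n ltnS leq_divRL ?expn_gt0 ?q0 // mulnC.
    rewrite mem_zrange -abszE lez_nat leq_divRL // -(absz_nat q) -abszM -lez_nat abszE.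
    rewrite -ler_sqr ?nnegrE // real_normK ?num_real //.
    apply: le_trans (Nle w); rewrite -eN exprMn mulrC expr2 ler_pM2l ?mulr_gt0 ?ltz_nat //.
    by rewrite -addrA lerDl addr_ge0 // sqr_ge0.
  case: u => [uw uz].
  pose g (Y : int * int * int * int) := let: (a, b, c, d) := Y in ((c %/ q)%Z, (d %/ q)%Z).
  have gE w z1 z2 z3 : g (h%:Z - (q ^ 2)%N%:Z * w, q%:Z * z1, q%:Z * z2, q%:Z * z3) = (z2, z3).
    by rewrite /g !mulKz.
  rewrite -(size_map g).
  apply: (@size_circle_points _ (2 * h%:Z * uw - (q ^ 2)%N%:Z * uw ^+ 2 - uz ^+ 2)) => //.
  - by rewrite lerBlDr (le_trans (NL uw)) // lerDl sqr_ge0.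
  - rewrite map_inj_in_uniq ?filter_uniq // => Y Y'.
    rewrite !mem_filter => /andP[/eqP fY /decomp[w [z1 [z2 [z3 [YE _ _ _]]]]]].
    move=> /andP[/eqP fY' /decomp[w' [z1' [z2' [z3' [YE' _ _ _]]]]]].
    move: fY fY'; rewrite YE YE' !fE !gE => <- [-> ->] [-> ->].
    by [].
  - move=> z /mapP[Y]; rewrite mem_filter => /andP[/eqP fY /decomp[w [z1 [z2 [z3 [YE _ _ eN]]]]]].
    move: fY; rewrite YE fE gE => -[<- <-] -> /=.
    by rewrite -eN; ring.
rewrite size_allpairs size_map size_iota size_zrange => le.
have d1 := leq_trunc_div (2 * h) (q ^ 2); have d2 := leq_trunc_div h q.
apply: leq_trans (leq_mul (leqnn _) le) _.
move: (L ^ 3)%N d1 d2 qh2; move: (_ %/ q ^ 2)%N (_ %/ q)%N => x y l d1 d2 qh2.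
rewrite (_ : q ^ 3 * _ = 24 * l * ((x * q ^ 2) * (2 * (y * q) + q)))%N; last by ring.
rewrite (_ : 144 * _ * _ = 24 * l * ((2 * h) * (2 * h + h)))%N; last by ring.
by apply: leq_mul => //; apply: leq_mul => //; lia.
Qed.

Fixpoint words (T : Type) (letters : seq T) (t : nat) : seq (seq T) :=
  if t is t'.+1 then [seq a :: w | a <- letters, w <- words letters t'] else [:: [::]].

Lemma count_words (T : Type) (letters : seq T) t (P : pred (seq T)) :
  count P (words letters t.+1) =
  (\sum_(a <- letters) count (fun w => P (a :: w)) (words letters t))%N.
Proof.
rewrite /= /allpairs_dep count_flatten -map_comp sumnE big_map.
by apply: eq_bigr => a _; rewrite /= count_map.
Qed.

Lemma size_words (T : eqType) (letters : seq T) t w :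
  w \in words letters t -> size w = t.
Proof.
elim: t w => [|t IH] w; first by rewrite inE => /eqP->.
by case/allpairsP => [[a v] [_ /IH <- ->]].
Qed.

Lemma count_le_sum (T U : eqType) (f : T -> U) (P : pred T) (s : seq T) (V : seq U) :
  {in s, forall x, P x -> f x \in V} ->
  (count P s <= \sum_(u <- V) count (fun x => f x == u) s)%N.
Proof.
elim: s => [|x s IH] /= PV; first by rewrite big1.
rewrite big_split leq_add //=; last first.
  by apply: IH => y ys; apply: PV; rewrite inE ys orbT.
case: (boolP (P x)) => //= /(PV _ (mem_head _ _)) fxV.
by rewrite (big_rem _ fxV) /= eqxx leq_addr.
Qed.

Section WordCount.
Variables (p c k : nat) (s : 'I_k -> int * int * int * int).
Hypotheses (pp : prime p) (k0 : (0 < k)%N) (p5 : (5 < p)%N) (c0 : (0 < c <= 4)%N).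
Hypothesis norm_s : forall a, qnorm (s a) = (c * p)%N%:Z.
Hypothesis s_indep : forall a b, a != b ->
     ~~ qdvd p (qmul (s a) (qconj (s b))) /\ ~~ qdvd p (qmul (qconj (s a)) (s b)).

Let n := (c * p)%N.
Let ws := words (enum 'I_k).

Definition letter (b : bool) (a : 'I_k) := if b then qconj (s a) else s a.

Fixpoint alt_prod (b : bool) (w : seq 'I_k) : int * int * int * int :=
  if w is a :: w' then qmul (letter b a) (alt_prod (~~ b) w') else qone _.

Lemma letter_conj b a : qconj (letter b a) = letter (~~ b) a.
Proof. by case: b; rewrite /= ?qconjK. Qed.

Lemma norm_letter b a : qnorm (letter b a) = n%:Z.
Proof. by case: b; rewrite /= ?qnorm_conj norm_s. Qed.

Lemma n_gt0 : (0 < n)%N.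
Proof. by case/andP: c0 => c1 _; rewrite muln_gt0 c1 prime_gt0. Qed.

Lemma norm_alt_prod b w : qnorm (alt_prod b w) = (n ^ size w)%N%:Z.
Proof.
elim: w b => [|a w IH] b /=; first by rewrite !expr0n expr1n !addr0.
by rewrite qnormM norm_letter IH expnS PoszM.
Qed.

Lemma letter_inj b a : injective (qmul (letter b a)).
Proof.
move=> x y e; apply: (@qscale_inj n%:Z); first by rewrite eqz_nat gtn_eqF ?n_gt0.
by rewrite -(norm_letter b a) -!qconj_mul_cancel e.
Qed.

Lemma p_dvd_n : (p %| n%:Z)%Z.
Proof. by rewrite dvdzE /= dvdn_mull. Qed.

Lemma letter_indep b a a' : a != a' -> ~~ qdvd p (qmul (letter (~~ b) a) (letter b a')).
Proof. by move=> /s_indep[h1 h2]; case: b. Qed.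

Lemma letter_ndvd b a : ~~ qdvd p (letter b a).
Proof.
apply/negP => /qdvdP[y e]; have := norm_letter b a; rewrite e qnorm_scale /n mulnC PoszM expr2 -mulrA.
have pz : p%:Z != 0 by rewrite eqz_nat gtn_eqF // prime_gt0.
move=> /(mulfI pz) e'.
have : (p %| c%:Z)%Z by rewrite -e' dvdz_mulr.
by case/andP: c0 => c1 c4; rewrite dvdzE /= gtnNdvd //; apply: leq_ltn_trans c4 _; lia.
Qed.

(* Modulo p the letters have rank one and pairwise distinct images. *)
Lemma letter_unique b a a' v x y :
  a != a' -> qdvd (p ^ v)%N%:Z x -> qdvd (p ^ v)%N%:Z y ->
  qmul (letter b a) x = qmul (letter b a') y ->
  qdvd (p ^ v.+1)%N%:Z (qmul (letter b a) x).
Proof.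
move=> aa' /qdvdP[x' ->] /qdvdP[y' ->]; rewrite !qscale_mulr => e.
have pv0 : (p ^ v)%N%:Z != 0 by rewrite eqz_nat expn_eq0 gtn_eqF // prime_gt0.
have {}e := qscale_inj pv0 e.
have h : qdvd p (qmul (letter (~~ b) a) (qmul (letter b a') y')).
  by rewrite -e -letter_conj qconj_mul_cancel norm_letter qdvd_scalel ?p_dvd_n.
have /(qdvd_mul3 pp _)/(_ h) : (p %| qnorm (letter b a'))%Z by rewrite norm_letter p_dvd_n.
rewrite (negPf (letter_indep b aa')) -e /= => /(_ (ltnW (ltnW (ltnW p5)))) /qdvdP[z ->].
by rewrite qscaleA -PoszM -expnSr qdvd_scale.
Qed.

(** Induction on t, stripping the first letter: x = s y. By [letter_unique] at most one letter
    leaves a y divisible by p^v, and it contributes at most 2^t k^v. Each of the other letters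
    leaves a y of smaller valuation and contributes at most 2^t k^(v-1). Together this is 2^(t+1)
    k^v. *)
Lemma count_word_value b t v x : ~~ qdvd (p ^ v.+1)%N%:Z x ->
  (count (fun w => alt_prod b w == x) (ws t) <= 2 ^ t * k ^ v)%N.
Proof.
elim: t b v x => [|t IH] b v x nx.
  rewrite /= expn0 mul1n addn0.
  by apply: leq_trans (leq_b1 _) _; rewrite expn_gt0 k0.
have sub a w : qmul (letter b a) w = x -> ~~ qdvd (p ^ v.+1)%N%:Z w.
  by move=> e; apply: contraNN nx => h; rewrite -e qdvd_mull.
pose B a := count (fun w => qmul (letter b a) (alt_prod (~~ b) w) == x) (ws t).
have countE : count (fun w => alt_prod b w == x) (ws t.+1) = (\sum_a B a)%N.
  by rewrite /ws count_words big_enum.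
have shift a y : qmul (letter b a) y = x ->
    B a = count (fun w => alt_prod (~~ b) w == y) (ws t).
  by move=> e; apply: eq_count => w /=; rewrite -e (inj_eq (@letter_inj b a)).
have none a : (forall y, qmul (letter b a) y <> x) -> B a = 0%N.
  move=> h; rewrite -(count_pred0 (ws t)); apply: eq_count => w /=.
  by apply/eqP/h.
have Ble a : (B a <= 2 ^ t * k ^ v)%N.
  have [[y e]|h] := pselect (exists y, qmul (letter b a) y = x).
    by rewrite (shift _ _ e) IH // (sub a).
  by rewrite none // => y e; apply: h; exists y.
pose exc a := `[< exists2 y, qmul (letter b a) y = x & qdvd (p ^ v)%N%:Z y >].
(* For v = 0 every y is divisible by p^0, so the letters that are not exceptional admit no y at
   all. *)
pose rest := (if v is v'.+1 then 2 ^ t * k ^ v' else 0)%N.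
have Brest a : ~~ exc a -> (B a <= rest)%N.
  move=> /asboolPn h.
  have [[y e]|h'] := pselect (exists y, qmul (letter b a) y = x); last first.
    by rewrite none // => y e; apply: h'; exists y.
  have : ~~ qdvd (p ^ v)%N%:Z y by apply/negP => d; apply: h; exists y.
  rewrite (shift _ _ e) /rest; case: (v) => [|v']; last exact: IH.
  by rewrite expn0; case: (y) => [[[? ?] ?] ?] /=; rewrite !dvd1z.
have krest : (k * rest <= 2 ^ t * k ^ v)%N.
  by rewrite /rest; case: (v) => [|v']; rewrite ?muln0 // expnS mulnCA.
have sum_rest (Q : pred 'I_k) : (forall a, Q a -> ~~ exc a) -> (\sum_(a | Q a) B a <= k * rest)%N.
  move=> h; apply: leq_trans (_ : (\sum_(a | Q a) rest <= _)%N).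
    by apply: leq_sum => a /h /Brest.
  by rewrite sum_nat_const leq_mul2r; apply/orP; right; rewrite -[X in (_ <= X)%N]card_ord max_card.
rewrite countE expnS -mulnA mul2n -addnn.
have [[a /asboolP exa]|nex] := pselect (exists a, exc a); last first.
  apply: leq_trans (leq_addl _ _); apply: leq_trans (sum_rest xpredT _) krest => a _.
  by apply/negP => h; apply: nex; exists a.
rewrite (bigD1 a) //=; apply: leq_add; first exact: Ble.
apply: leq_trans (sum_rest _ _) krest => a' a'a; apply/negP => /asboolP[y' e' d'].
case: exa => y e d; case/negP: nx; rewrite -e; apply: (@letter_unique b a a' v y y') => //.
  by rewrite eq_sym.
by rewrite e e'.
Qed.

(** The second claim carries the induction: with B the first letter and C the rest of the word,
    [qdvd_mul3] allows p to divide A B C only if it divides A B, excluded for distinct letters, or B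
    C, excluded by the first claim. *)
Lemma reduced_word_ndvd b a w : sorted (fun a a' => a != a') (a :: w) ->
  ~~ qdvd p (alt_prod b (a :: w)) /\
  forall a', a' != a -> ~~ qdvd p (qmul (letter (~~ b) a') (alt_prod b (a :: w))).
Proof.
elim: w a b => [|a2 w IH] a b.
  move=> _; rewrite /= qmul1; split=> [|a' a'a]; first exact: letter_ndvd.
  exact: letter_indep.
rewrite [sorted _ _]/= => /andP[aa2 /IH h].
have {h}[h1 h2] := h (~~ b).
have hh : ~~ qdvd p (alt_prod b [:: a, a2 & w]).
  by have := h2 _ aa2; rewrite negbK.
split=> // a' a'a; apply: contraNN hh => h.
have /(qdvd_mul3 pp _)/(_ h) : (p %| qnorm (letter b a))%Z by rewrite norm_letter p_dvd_n.
by rewrite (negPf (letter_indep b a'a)) /=; apply; lia.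
Qed.

Definition near_scalar (q h : nat) (x : int * int * int * int) : bool :=
  let: (a, b, c, d) := x in
  [&& (q %| a - h%:Z)%Z, (q %| b)%Z, (q %| c)%Z & (q %| d)%Z].

(** As c <= 4 < p, the prime p divides n = c p exactly once, so p^(m+1) cannot divide an x of norm
    n^(2m). *)
Lemma qdvd_valuation x m : qnorm x = (n ^ (2 * m))%N%:Z ->
  exists e : 'I_m.+1, qdvd (p ^ e)%N%:Z x && ~~ qdvd (p ^ e.+1)%N%:Z x.
Proof.
move=> nx; have nm : ~~ qdvd (p ^ m.+1)%N%:Z x.
  apply/negP => /qdvdP[y e]; move: nx; rewrite e qnorm_scale => h.
  have : ((p ^ m.+1)%N%:Z ^+ 2 %| (n ^ (2 * m))%N%:Z)%Z by rewrite -h dvdz_mulr.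
  rewrite dvdzE abszX /= -expnM /n expnMn mulnC mul2n doubleS -mul2n !expnSr -mulnA [(p ^ _ * _)%N]mulnC.
  rewrite dvdn_pmul2r ?expn_gt0 ?prime_gt0 // => /(dvdn_trans (dvdn_mulr p (dvdnn p))).
  rewrite Euclid_dvdX //; case/andP=> pc _; case/andP: c0 => c1 c4.
  by move: pc; rewrite gtnNdvd //; apply: leq_ltn_trans c4 _; lia.
have ex : exists e, ~~ qdvd (p ^ e.+1)%N%:Z x by exists m.
case: (ex_minnP ex) => e ne mine; have em : (e < m.+1)%N by rewrite ltnS mine.
exists (Ordinal em); rewrite /= ne andbT; case: e {em} ne mine => [|e] _ mine.
  by case: (x) => [[[? ?] ?] ?] /=; rewrite !dvd1z.
by apply/negPn/negP => /mine; rewrite ltnn.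
Qed.

(** Division by p^e reduces to [size_near_scalar] with h = n^m / p^e. The gain p^(2e) in h^2 pays
    for the factor k^e <= p^e. *)
Lemma size_valuation_class (q L m e : nat) (S : seq (int * int * int * int)) :
  prime q -> ~~ (q %| 2 * n)%N -> (0 < L)%N -> (n ^ m <= q * L ^ 4)%N -> (k <= p)%N ->
  (e <= m)%N -> uniq S ->
  {in S, forall x, [/\ near_scalar q (n ^ m) x, qnorm x = (n ^ (2 * m))%N%:Z,
     qdvd (p ^ e)%N%:Z x & x <> ((n ^ m)%N%:Z, 0, 0, 0)]} ->
  (q ^ 3 * (k ^ e * size S) <= 144 * n ^ (2 * m) * L ^ 3)%N.
Proof.
move=> pq q2n L0 nL kp em uS SP.
pose h := (c ^ m * p ^ (m - e))%N.
have hn : (n ^ m = p ^ e * h)%N by rewrite /h /n expnMn mulnCA -expnD subnKC.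
have pe0 : (0 < p ^ e)%N by rewrite expn_gt0 prime_gt0.
have pez : (p ^ e)%N%:Z != 0 by rewrite eqz_nat gtn_eqF.
have [q2 qc qp] : [/\ ~~ (q %| 2)%N, ~~ (q %| c)%N & ~~ (q %| p)%N].
  by move: q2n; rewrite /n !Euclid_dvdM // !negb_or => /and3P[].
have qpe : ~~ (q %| p ^ e)%N by rewrite Euclid_dvdX // negb_and qp.
pose f (x : int * int * int * int) := let: (a, b, c', d) := x in
    ((a %/ (p ^ e)%N)%Z, (b %/ (p ^ e)%N)%Z, (c' %/ (p ^ e)%N)%Z, (d %/ (p ^ e)%N)%Z).
have fK x : qdvd (p ^ e)%N%:Z x -> qscale (p ^ e)%N%:Z (f x) = x.
  case: x => [[[? ?] ?] ?] /and4P[? ? ? ?].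
  by rewrite /f /qscale ![(p ^ e)%N%:Z * _]mulrC !divzK.
have szle : (q ^ 3 * size (map f S) <= 144 * h ^ 2 * L ^ 3)%N.
  apply: size_near_scalar => //.
  - by rewrite /h !Euclid_dvdM // !Euclid_dvdX // (negPf q2) (negPf qc) (negPf qp).
  - by apply: leq_trans nL; rewrite hn leq_pmull.
  - rewrite map_inj_in_uniq // => x y /SP[_ _ dx _] /SP[_ _ dy _] e'.
    by rewrite -(fK x dx) -(fK y dy) e'.
  - move=> _ /mapP[x /SP[near nx dx x0] ->]; move: near nx x0; rewrite -{1 2 3}(fK x dx).
    case: (f x) => [[[a b] c'] d] near nx x0; split.
    + have : (p ^ e)%N%:Z ^+ 2 != 0 by rewrite expf_neq0.
      move=> /mulfI; apply; rewrite -qnorm_scale nx mulnC expnM hn expnMn PoszM.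
      by rewrite -[((p ^ e) ^ 2)%N%:Z]natz natrX natz.
    + by move=> [ea eb ec ed]; apply: x0; rewrite ea eb ec ed /qscale !mulr0 hn PoszM.
    + move: near; rewrite /qscale /near_scalar hn PoszM -mulrBr !Euclid_dvdzM //.
      have -> : (q %| (p ^ e)%N%:Z)%Z = false by rewrite dvdzE /= (negPf qpe).
      by move=> /and4P[].
rewrite size_map in szle; rewrite mulnCA.
apply: leq_trans (leq_mul (leqnn _) szle) _.
rewrite (_ : k ^ e * _ = 144 * L ^ 3 * (k ^ e * h ^ 2))%N; last by ring.
rewrite (_ : 144 * n ^ (2 * m) * L ^ 3 = 144 * L ^ 3 * n ^ (2 * m))%N; last by ring.
apply: leq_mul => //; rewrite [(2 * m)%N]mulnC expnM hn expnMn leq_mul2r; apply/orP; right.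
apply: (@leq_trans (p ^ e)%N); last by rewrite -mulnn leq_pmull.
by case: (e) => // e'; rewrite leq_exp2r.
Qed.

(** The words are sorted by their value x, and the values by the exact power p^e dividing them. The
    value n^m gives the first term. For each e <= m, the other values are at most 144 n^(2m) L^3 /
    (q^3 k^e) in number, each taken by at most 4^m k^e words: the powers of k cancel. *)
Lemma count_scalar_words (q L m : nat) :
  prime q -> ~~ (q %| 2 * n)%N -> (0 < L)%N -> (n ^ m <= q * L ^ 4)%N -> (k <= p)%N ->
  (q ^ 3 * count (fun w => near_scalar q (n ^ m) (alt_prod false w)) (ws (2 * m)) <=
   4 ^ m * k ^ m * q ^ 3 + 4 ^ m * m.+1 * (144 * n ^ (2 * m) * L ^ 3))%N.
Proof.
move=> pq q2n L0 nL kp.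
pose P w := near_scalar q (n ^ m) (alt_prod false w).
pose S := undup (map (alt_prod false) [seq w <- ws (2 * m) | P w]).
have SP x : x \in S -> near_scalar q (n ^ m) x /\ qnorm x = (n ^ (2 * m))%N%:Z.
  rewrite mem_undup => /mapP[w]; rewrite mem_filter => /andP[Pw /size_words sw] ->.
  by rewrite norm_alt_prod sw.
have le1 : (count P (ws (2 * m)) <= \sum_(x <- S) count (fun w => alt_prod false w == x) (ws (2 * m)))%N.
  by apply: count_le_sum => w wS Pw; rewrite mem_undup map_f // mem_filter Pw.
pose x0 : int * int * int * int := ((n ^ m)%N%:Z, 0, 0, 0).
pose cls e x := qdvd (p ^ e)%N%:Z x && (x != x0).
have le2 x : x \in S -> (count (fun w => alt_prod false w == x) (ws (2 * m)) <=
    (x == x0) * (4 ^ m * k ^ m) + \sum_(e < m.+1) cls e x * (4 ^ m * k ^ e))%N.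
  move=> /SP[_ nx]; have [e /andP[de nde]] := qdvd_valuation nx.
  have := count_word_value false (2 * m) nde; rewrite expnM => /leq_trans; apply.
  have [_|xx0] := eqVneq x x0.
    by rewrite mul1n; apply: leq_trans (leq_addr _ _); rewrite leq_mul2l leq_pexp2l ?orbT // -ltnS.
  by rewrite mul0n add0n (bigD1 e) //= /cls de xx0 mul1n leq_addr.
have uS : uniq S by apply: undup_uniq.
apply: leq_trans (leq_mul (leqnn _) le1) _.
apply: (@leq_trans (q ^ 3 * \sum_(x <- S) ((x == x0) * (4 ^ m * k ^ m) +
    \sum_(e < m.+1) cls e x * (4 ^ m * k ^ e)))%N).
  rewrite leq_mul2l; apply/orP; right; rewrite big_seq [X in (_ <= X)%N]big_seq.
  exact: leq_sum.
rewrite big_split /= mulnDr; apply: leq_add.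
  rewrite mulnC leq_mul2r -big_distrl /= -[X in (_ <= X)%N]mul1n leq_mul2r; apply/orP; right; apply/orP; right.
  apply: (@leq_trans (count_mem x0 S)); last by rewrite count_uniq_mem // leq_b1.
  by rewrite -sum1_count [X in (_ <= X)%N]big_mkcond; apply: leq_sum => x _ /=; case: (x == x0).
rewrite exchange_big /= big_distrr /=.
apply: leq_trans (_ : (\sum_(e < m.+1) 4 ^ m * (144 * n ^ (2 * m) * L ^ 3) <= _)%N); last first.
  by rewrite sum_nat_const card_ord; lia.
apply: leq_sum => e _; rewrite -big_distrl /=.
rewrite [(_ * (4 ^ m * k ^ e))%N]mulnC -mulnA mulnCA.
rewrite leq_mul2l; apply/orP; right.
have -> : (\sum_(x <- S) cls e x)%N = size [seq x <- S | cls e x].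
  by rewrite size_filter -sum1_count [RHS]big_mkcond; apply: eq_bigr => x _; case: (cls e x).
apply: size_valuation_class => //; [by rewrite -ltnS | exact: filter_uniq | ].
by move=> x; rewrite mem_filter => /andP[/andP[de /eqP xx0] /SP[near nx]].
Qed.

End WordCount.

(** * The spectral bound *)

Section Words.
Variable k : nat.
Let ws := words (enum 'I_k).

Lemma mem_words t w : (w \in ws t) = (size w == t).
Proof.
apply/idP/eqP => [/size_words //|<-].
elim: w => [|a w IH]; first by rewrite mem_head.
by apply: allpairs_f => //; rewrite mem_enum.
Qed.

Lemma uniq_words t : uniq (ws t).
Proof.
elim: t => //= t IH; apply: allpairs_uniq => //; first exact: enum_uniq.
by move=> [a w] [a' w'] _ _ [-> ->].
Qed.

Lemma size_enum_words t : size (ws t) = (k ^ t)%N.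
Proof. by elim: t => //= t IH; rewrite size_allpairs IH size_enum_ord expnS. Qed.

Lemma big_words_cat (V : Type) (idx : V) (op : Monoid.law idx) t u (f : seq 'I_k -> V) :
  \big[op/idx]_(w <- ws (t + u)) f w =
  \big[op/idx]_(w <- ws t) \big[op/idx]_(w' <- ws u) f (w ++ w').
Proof.
elim: t f => [|t IH] f; first by rewrite big_seq1.
rewrite addSn /= !big_allpairs_dep; apply: eq_bigr => a _.
by rewrite IH.
Qed.

Lemma big_words_rev (V : Type) (idx : V) (op : Monoid.com_law idx) t (f : seq 'I_k -> V) :
  \big[op/idx]_(w <- ws t) f (rev w) = \big[op/idx]_(w <- ws t) f w.
Proof.
rewrite -(big_map rev xpredT); apply: perm_big; apply: uniq_perm.
- by rewrite map_inj_uniq ?uniq_words //; apply: (can_inj revK).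
- exact: uniq_words.
move=> w; apply/mapP/idP => [[v]|]; first by rewrite !mem_words => sv ->; rewrite size_rev.
by rewrite mem_words => sw; exists (rev w); rewrite ?revK // mem_words size_rev.
Qed.

Section AltProduct.
Variables (Q : groupType) (t : 'I_k -> Q).
Local Open Scope group_scope.

Definition alt_letter (b : bool) (a : 'I_k) : Q := if b then (t a)^-1 else t a.

Fixpoint galt (b : bool) (w : seq 'I_k) : Q :=
  if w is a :: w' then alt_letter b a * galt (~~ b) w' else 1.

Lemma galt_cat b w w' : galt b (w ++ w') = galt b w * galt (b (+) odd (size w)) w'.
Proof.
elim: w b => [|a w IH] b /=; first by rewrite mul1g addbF.
by rewrite IH mulgA addbN addNb.
Qed.

Lemma galt_inv b w : (galt b w)^-1 = galt (b (+) odd (size w)) (rev w).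
Proof.
elim: w b => [|a w IH] b /=; first by rewrite invg1.
rewrite invMg IH rev_cons -cats1 galt_cat size_rev /= mulg1.
rewrite addbN addNb; congr (_ * _).
have -> : ~~ (b (+) odd (size w)) (+) odd (size w) = ~~ b by case: b; case: odd.
by case: b; rewrite /= ?invgK.
Qed.

End AltProduct.
End Words.

Section Bessel.
Variables (C : numClosedFieldType) (Q I : finType) (g : I -> Q -> C) (c : C).
Hypothesis c_gt0 : 0 < c.
Hypothesis orth : forall i j, \sum_x g i x * (g j x)^* = if i == j then c else 0.

Lemma bessel (v : Q -> C) :
  \sum_i `|\sum_x v x * (g i x)^*| ^+ 2 <= c * \sum_x `|v x| ^+ 2.
Proof.
pose co i := \sum_x v x * (g i x)^*.
(* Up to the factor c this is the component of v orthogonal to all [g i]; expanding its squared norm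
   gives the inequality. *)
pose r x := c * v x - \sum_i co i * g i x.
have c_real : c^* = c by apply: conj_Creal; rewrite gtr0_real.
have r_orth i : \sum_x r x * (g i x)^* = 0.
  rewrite /r; under eq_bigr => x _ do rewrite mulrBl -mulrA mulr_suml.
  rewrite sumrB -mulr_sumr exchange_big /=.
  under [X in _ - X]eq_bigr => j _.
    under eq_bigr => x _ do rewrite -mulrA.
    rewrite -mulr_sumr orth; over.
  suff -> : \sum_j co j * (if j == i then c else 0) = co i * c by rewrite mulrC subrr.
  rewrite (bigD1 i) //= eqxx big1 => [|j ji]; first by rewrite addr0.
  by rewrite (negPf ji) mulr0.
have : 0 <= \sum_x r x * (r x)^*.
  by apply: sumr_ge0 => x _; rewrite -normCK exprn_ge0.
have -> : \sum_x r x * (r x)^* = c * \sum_x r x * (v x)^*.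
  rewrite mulr_sumr.
  under eq_bigr => x _.
    rewrite {2}/r rmorphB rmorphM /= c_real rmorph_sum mulrBr mulr_sumr.
    over.
  rewrite sumrB exchange_big /= [X in _ - X]big1 ?subr0.
    by apply: eq_bigr => x _; rewrite mulrCA.
  move=> i _; under eq_bigr => x _ do rewrite rmorphM /= mulrCA.
  by rewrite -mulr_sumr r_orth mulr0.
rewrite pmulr_rge0 //.
rewrite /r; under eq_bigr => x _ do rewrite mulrBl -mulrA -normCK mulr_suml.
rewrite sumrB -mulr_sumr exchange_big /= subr_ge0 => /(le_trans _); apply.
rewrite le_eqVlt; apply/orP; left; apply/eqP; apply: eq_bigr => i _.
rewrite normCK /co rmorph_sum /= mulr_sumr; apply: eq_bigr => x _.
by rewrite rmorphM /= conjCK -/(co i) -mulrA [g i x * _]mulrC.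
Qed.

End Bessel.

Section SpectralBound.
Variables (C : numClosedFieldType) (Q : finGroupType) (I : finType) (g : I -> Q -> C) (c : C).
Hypothesis c_gt0 : 0 < c.
Hypothesis orth : forall i j, \sum_x g i x * (g j x)^* = if i == j then c else 0.
Variables (k : nat) (t : 'I_k -> Q) (nu : C) (l : nat).
Hypothesis nu_ge0 : 0 <= nu.
Let ws := words (enum 'I_k).
Hypothesis g_eigen : forall i x,
  \sum_(w <- ws (2 * l)) g i (x * galt t false w)%g = nu ^+ l * g i x.

Let ct y x : nat := count (fun w => (y * galt t false w)%g == x) (ws (2 * l)).

(** The left side counts pairs of words with equal value. The first followed by the reverse of the
    second is then a trivial word of twice the length. *)
Lemma sum_ct_sqr y :
  (\sum_x ct y x ^ 2)%N = count (fun w => galt t false w == 1%g) (ws (2 * (2 * l))).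
Proof.
transitivity (\sum_(w <- ws (2 * l)) ct y (y * galt t false w)%g)%N.
  under eq_bigr => x _.
    rewrite -mulnn {1}/ct -sum1_count big_distrl big_mkcond /=.
    over.
  rewrite exchange_big /=; apply: eq_bigr => w _.
  rewrite (bigD1 (y * galt t false w)%g) //= eqxx mul1n big1 ?addn0 // => x xw.
  by rewrite eq_sym (negPf xw).
have e2 : (2 * (2 * l) = 2 * l + 2 * l)%N by lia.
rewrite e2 -sum1_count [RHS]big_mkcond (big_words_cat _ (2 * l) (2 * l)) /=.
apply: eq_big_seq => w; rewrite mem_words => /eqP sw.
rewrite /ct -sum1_count [LHS]big_mkcond -[RHS]big_words_rev /=.
apply: eq_big_seq => w'; rewrite mem_words => /eqP sw'.
rewrite (inj_eq (mulgI y)) galt_cat sw mul2n odd_double addbF.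
have -> : galt t false (rev w') = (galt t false w')^-1%g.
  by rewrite galt_inv sw' mul2n odd_double.
by rewrite -eq_mulgV1 eq_sym.
Qed.

(** Bessel's inequality for [ct y], whose scalar product with [g i] is the conjugate of nu^l g_i(y),
    summed over y. *)
Lemma spectral_bound : #|I|%:R * nu ^+ (2 * l) <=
  #|Q|%:R * (count (fun w => galt t false w == 1%g) (ws (2 * (2 * l))))%:R :> C.
Proof.
set N := count _ _.
have nul : (nu ^+ l)^* = nu ^+ l by apply: conj_Creal; rewrite ger0_real // exprn_ge0.
have step y : \sum_i nu ^+ (2 * l) * `|g i y| ^+ 2 <= c * N%:R.
  have := bessel c_gt0 orth (fun x => (ct y x)%:R).
  have -> : \sum_x `|(ct y x)%:R| ^+ 2 = N%:R :> C.
    rewrite /N -(sum_ct_sqr y) natr_sum; apply: eq_bigr => x _.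
    by rewrite normr_nat natrX.
  apply: le_trans; rewrite le_eqVlt; apply/orP; left; apply/eqP.
  apply: eq_bigr => i _.
  have -> : \sum_x (ct y x)%:R * (g i x)^* = (nu ^+ l * g i y)^*.
    rewrite -g_eigen rmorph_sum /=.
    under eq_bigr => x _ do rewrite /ct -sum1_count natr_sum big_mkcond mulr_suml /=.
    rewrite exchange_big /=; apply: eq_bigr => w _.
    rewrite (bigD1 (y * galt t false w)%g) //= eqxx mul1r big1 ?addr0 // => x xw.
    by rewrite eq_sym (negPf xw) mul0r.
  by rewrite norm_conjC normrM exprMn (ger0_norm (exprn_ge0 _ nu_ge0)) -exprM mulnC.
have : \sum_(y : Q) \sum_i nu ^+ (2 * l) * `|g i y| ^+ 2 <= \sum_(y : Q) c * N%:R.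
  by apply: ler_sum => y _; apply: step.
rewrite sumr_const -(mulr_natl (c * _)) exchange_big /=.
have -> : \sum_i \sum_(y : Q) nu ^+ (2 * l) * `|g i y| ^+ 2 = \sum_(i : I) nu ^+ (2 * l) * c.
  apply: eq_bigr => i _; rewrite -mulr_sumr; congr (_ * _).
  by have := orth i i; rewrite eqxx => <-; apply: eq_bigr => x _; rewrite normCK.
rewrite sumr_const -(mulr_natl (_ * c)).
rewrite [_ ^+ _ * c]mulrC mulrCA [X in _ <= X]mulrCA.
by rewrite ler_pM2l.
Qed.

End SpectralBound.

(** * The group SL_2 over a finite field *)

Section SL2.
Variable F : finFieldType.

(* The matrix with rows (a, b) and (c, d) is encoded by (a, b, c, d). *)
Definition det2 (x : F * F * F * F) : F := let: (a, b, c, d) := x in a * d - b * c.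

Definition mul2 (x y : F * F * F * F) : F * F * F * F :=
  let: (a, b, c, d) := x in let: (a', b', c', d') := y in
  (a * a' + b * c', a * b' + b * d', c * a' + d * c', c * b' + d * d').

Definition sl2 := {x : F * F * F * F | det2 x == 1}.
HB.instance Definition _ := Finite.on sl2.
HB.instance Definition _ := SubType.on sl2.

Lemma det2_mul x y : det2 (mul2 x y) = det2 x * det2 y.
Proof. by case: x y => [[[a b] c] d] [[[a' b'] c'] d'] /=; ring. Qed.

Lemma sl2_one_subproof : det2 (1, 0, 0, 1) == 1.
Proof. by rewrite /= mulr1 mulr0 subr0. Qed.

Lemma sl2_mul_subproof (x y : sl2) : det2 (mul2 (val x) (val y)) == 1.
Proof. by rewrite det2_mul (eqP (valP x)) (eqP (valP y)) mulr1. Qed.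

Definition adj2 (x : F * F * F * F) : F * F * F * F :=
  let: (a, b, c, d) := x in (d, - b, - c, a).

Lemma sl2_inv_subproof (x : sl2) : det2 (adj2 (val x)) == 1.
Proof.
have /eqP := valP x; case: (val x) => [[[a b] c] d] /= h.
by rewrite -h; apply/eqP; ring.
Qed.

Definition sl2_one : sl2 := exist (fun x => det2 x == 1) _ sl2_one_subproof.
Definition sl2_mul (x y : sl2) : sl2 := exist (fun x => det2 x == 1) _ (sl2_mul_subproof x y).
Definition sl2_inv (x : sl2) : sl2 := exist (fun x => det2 x == 1) _ (sl2_inv_subproof x).

Lemma sl2_mulA : associative sl2_mul.
Proof.
move=> x y z; apply: val_inj => /=.
case: (val x) (val y) (val z) => [[[a b] c] d] [[[a' b'] c'] d'] [[[e f] g] h] /=.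
by apply: quat_ext; ring.
Qed.

Lemma sl2_mul1 : left_id sl2_one sl2_mul.
Proof.
move=> x; apply: val_inj => /=; case: (val x) => [[[a b] c] d] /=.
by apply: quat_ext; ring.
Qed.

Lemma sl2_mulV : left_inverse sl2_one sl2_inv sl2_mul.
Proof.
move=> x; apply: val_inj; have /eqP := valP x => /=.
by case: (val x) => [[[a b] c] d] /= h; apply: quat_ext; rewrite -?h; ring.
Qed.

HB.instance Definition _ := Finite_isGroup.Build sl2 sl2_mulA sl2_mul1 sl2_mulV.

Lemma val_sl2_mul (x y : sl2) : val (x * y)%g = mul2 (val x) (val y).
Proof. by []. Qed.

(** If a is nonzero then d is determined by the other entries; if a = 0 then b is nonzero and
    determines c. *)
Lemma card_sl2 : (#|{: sl2}| <= #|F| ^ 3)%N.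
Proof.
pose f (x : sl2) : F * F * F := let: (a, b, c, d) := val x in
  if a != 0 then (a, b, c) else (a, b, d).
have finj : injective f.
  move=> x y; have /eqP := valP x; have /eqP := valP y => hy hx.
  move=> e; apply: val_inj; move: hx hy e; rewrite /f.
  case: (val x) (val y) => [[[a b] c] d] [[[a' b'] c'] d'] /= hx hy.
  have [a0|a0] := eqVneq a 0; have [a'0|a'0] := eqVneq a' 0.
  - move=> [ea eb ed]; subst a a' b' d'; move: hx hy.
    rewrite !mul0r !sub0r => hx hy; congr (_, _, _, _).
    have b0 : b != 0.
      by apply/eqP => b0; move: hx; rewrite b0 mul0r oppr0 => /eqP; rewrite eq_sym oner_eq0.
    by apply: (mulfI b0); apply: oppr_inj; rewrite hx hy.
  - by move=> [ea]; rewrite -ea a0 eqxx in a'0.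
  - by move=> [ea]; rewrite ea a'0 eqxx in a0.
  - move=> [ea eb ec]; subst a' b' c'; congr (_, _, _, _).
    by apply: (mulfI a0); apply: (addIr (- (b * c))); rewrite hx hy.
by have := leq_card f finj; rewrite !card_prod -mulnA !expnS expn0 muln1.
Qed.

End SL2.

(** * Additive characters of the prime field *)

Section AdditiveCharacter.
Variables (C : numClosedFieldType) (q : nat).
Hypothesis pq : prime q.

Lemma exists_unity_root : exists z : C, z ^+ q = 1 /\ z != 1.
Proof.
pose P : {poly C} := \poly_(i < q) 1.
have q0 := prime_gt0 pq; have q1 := prime_gt1 pq.
have sP : size P = q by apply: size_poly_eq; rewrite oner_eq0.
have [z zP] : exists z, root P z by apply/closed_rootP; rewrite sP gtn_eqF.
exists z.
have PE x : P.[x] = \sum_(i < q) x ^+ i.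
  by rewrite horner_poly; apply: eq_bigr => i _; rewrite mul1r.
split.
  by apply/eqP; rewrite -subr_eq0 subrX1 -PE (eqP zP) mulr0.
apply/eqP => z1; move: zP; rewrite /root PE z1.
under eq_bigr do rewrite expr1n.
by rewrite sumr_const card_ord pnatr_eq0 gtn_eqF.
Qed.

Variable z : C.
Hypotheses (zq : z ^+ q = 1) (z1 : z != 1).

Definition chi (x : 'F_q) : C := z ^+ x.

Lemma chiD x y : chi (x + y) = chi x * chi y.
Proof. by rewrite /chi /= [X in (_ %% X)%N](Fp_cast pq) expr_mod // exprD. Qed.

Lemma chi0 : chi 0 = 1.
Proof. exact: expr0. Qed.

Lemma chi1 : chi 1 != 1.
Proof. by rewrite /chi /= (Fp_cast pq) modn_small ?prime_gt1. Qed.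

Lemma chi_norm x : chi x * (chi x)^* = 1.
Proof.
have nz : `|z| = 1.
  apply/eqP; rewrite -(@pexpr_eq1 _ _ q) ?prime_gt0 //.
  by rewrite -normrX zq normr1.
by rewrite -normCK normrX nz !expr1n.
Qed.

Lemma chiN x : chi (- x) = (chi x)^*.
Proof.
by rewrite -[LHS]mulr1 -(chi_norm x) mulrA -chiD addNr chi0 mul1r.
Qed.

Lemma sum_chi b : \sum_(x : 'F_q) chi (x * b) = if b == 0 then q%:R else 0.
Proof.
have [->|b0] := eqVneq b 0.
  under eq_bigr do rewrite mulr0 chi0.
  by rewrite sumr_const card_Fp.
set S := LHS.
have : S = S * chi 1.
  rewrite {1}/S (reindex_inj (addrI b^-1)) /= /S mulr_suml; apply: eq_bigr => x _.
  by rewrite mulrDl mulVf // chiD mulrC.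
move/eqP; rewrite -subr_eq0 -{1}[S]mulr1 -mulrBr mulf_eq0 => /orP[/eqP //|].
by rewrite subr_eq0 eq_sym (negPf chi1).
Qed.

End AdditiveCharacter.

(** * Multiplicity of eigenvalues on SL_2 *)

Section EigenFunctions.
Variables (C : numClosedFieldType) (q : nat) (z : C).
Hypotheses (pq : prime q) (q2 : (2 < q)%N) (zq : z ^+ q = 1) (z1 : z != 1).
Local Notation F := 'F_q.
Local Notation Q := (sl2 F).
Local Notation chi := (chi (q := q) z).

Lemma upper_subproof (s : F) : det2 (1, s, 0, 1) == 1.
Proof. by rewrite /= mulr1 mulr0 subr0. Qed.
Lemma weyl_subproof : det2 (0, 1, -1, 0 : F) == 1.
Proof. by rewrite /= mulr0 mul1r sub0r opprK. Qed.
Lemma diag_subproof (a : F) : a != 0 -> det2 (a, 0, 0, a^-1) == 1.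
Proof. by move=> a0; rewrite /= mulr0 subr0 divff. Qed.

Definition upper (s : F) : Q := exist (fun x => det2 x == 1) _ (upper_subproof s).
Definition weyl : Q := exist (fun x => det2 x == 1) _ weyl_subproof.
(** Written as a conjugate of an upper unipotent, so that a function all of whose left translates
    are invariant under [upper] is invariant under [lower] too. *)
Definition lower (s : F) : Q := (weyl * upper (- s) * weyl^-1)%g.

Lemma val_lower s : val (lower s) = (1, 0, s, 1).
Proof. by rewrite /= /mul2 /=; apply: quat_ext; ring. Qed.

(** A matrix whose lower left entry is nonzero is a product upper, lower, upper. If this entry is 0,
    multiplying by [lower 1] replaces it by a, which is then nonzero. *)
Lemma sl2_generation (P : Q -> Prop) :
  P 1%g -> (forall s x, P x <-> P (upper s * x)%g) -> (forall s x, P x <-> P (lower s * x)%g) ->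
  forall x, P x.
Proof.
move=> P1 Pu Pl.
have Pc x : (val x).1.2 != 0 -> P x.
  move: (valP x); case E: (val x) => [[[a b] c] d] /= /eqP h c0.
  have -> : x = (upper ((a - 1) / c)%R * (lower c * (upper ((d - 1) / c)%R * 1)))%g.
    apply: val_inj; rewrite mulg1 2!val_sl2_mul val_lower E /=.
    apply: quat_ext; [by field | | by field | by field].
    have -> : b = (a * d - 1) / c by rewrite -h; field.
    by field.
  by apply: (Pu _ _).1; apply: (Pl _ _).1; apply: (Pu _ _).1.
move=> x; have [c0|] := eqVneq (val x).1.2 0; last exact: Pc.
apply: (Pl 1 x).2; apply: Pc; rewrite val_sl2_mul val_lower.
move: (valP x) c0; case: (val x) => [[[a b] c] d] /= /eqP h c0; rewrite c0 in h *.
rewrite mul1r mulr0 addr0; apply/eqP => a0; move: h.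
by rewrite a0 mul0r mulr0 subr0 => /eqP; rewrite eq_sym oner_eq0.
Qed.

Variables (k : nat) (t : 'I_k -> Q).
Local Notation ws := (words (enum 'I_k)).

Definition right_eigen (nu : C) (f : Q -> C) : Prop :=
  forall x, \sum_(w <- ws 2) f (x * galt t false w)%g = nu * f x.

Lemma right_eigen_iter nu f l : right_eigen nu f ->
  forall x, \sum_(w <- ws (2 * l)) f (x * galt t false w)%g = nu ^+ l * f x.
Proof.
move=> fe; elim: l => [|l IH] x; first by rewrite muln0 big_seq1 mulg1 expr0 mul1r.
rewrite mulnS (big_words_cat _ 2 (2 * l)) exprSr -mulrA -fe mulr_sumr.
apply: eq_big_seq => w; rewrite mem_words => /eqP sw.
by rewrite -IH; apply: eq_bigr => w' _; rewrite galt_cat sw mulgA.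
Qed.

(** Otherwise f is constant by [sl2_generation], and the eigenvalue of a nonzero constant is k^2. *)
Lemma exists_moved_eigenfunction nu f : right_eigen nu f -> (exists x, f x != 0) ->
  nu != (k ^ 2)%:R -> exists g s x, f (g * (upper s * x))%g != f (g * x)%g.
Proof.
move=> fe [x0 fx0] nuk.
have [//|none] := pselect (exists g s x, f (g * (upper s * x))%g != f (g * x)%g).
have inv g s x : f (g * (upper s * x))%g = f (g * x)%g.
  by apply/eqP/negP => /negP h; apply: none; exists g, s, x.
have cst x : f x = f 1%g.
  apply: (sl2_generation (P := fun x => f x = f 1%g)) => // s y.
    by have := inv 1%g s y; rewrite !mul1g => ->.
  have -> : f (lower s * y)%g = f y; last by [].
  by rewrite /lower -!mulgA inv mulKVg.
move/eqP: nuk; case; apply: (mulIf fx0); rewrite -fe.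
under eq_bigr => w _ do rewrite cst -(cst x0).
by rewrite big_const_seq count_predT iter_addr_0 mulr_natl size_enum_words.
Qed.

Lemma upperD s s' : upper (s + s') = (upper s * upper s')%g.
Proof. by apply: val_inj; rewrite /= /mul2 /=; apply: quat_ext; ring. Qed.

(* A nonzero component of a moved eigenfunction for a nontrivial character of
   the group of upper unipotents. *)
Lemma exists_character_eigenfunction nu f : right_eigen nu f -> (exists x, f x != 0) ->
  nu != (k ^ 2)%:R -> exists (b : F) (h : Q -> C),
    [/\ b != 0, right_eigen nu h, exists x, h x != 0 &
        forall s x, h (upper s * x)%g = chi (b * s) * h x].
Proof.
move=> fe f0 nuk; have [g [s0 [x0 moved]]] := exists_moved_eigenfunction fe f0 nuk.
(* Fourier components along the upper unipotents; they sum to q f (g x). If all those with b nonzero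
   vanished, x |-> f (g x) would be invariant, against [moved]. *)
pose h b x := \sum_s chi (- (s * b)) * f (g * (upper s * x))%g.
have he b : right_eigen nu (h b).
  move=> x; rewrite exchange_big mulr_sumr /=; apply: eq_bigr => s _.
  rewrite -mulr_sumr mulrCA; congr (_ * _).
  by rewrite -fe; apply: eq_bigr => w _; rewrite !mulgA.
have hchi b s x : h b (upper s * x)%g = chi (b * s) * h b x.
  rewrite /h [in RHS](reindex_inj (addIr s)) /= mulr_sumr; apply: eq_bigr => s' _.
  rewrite upperD -mulgA mulrA -chiD //; congr (chi _ * _).
  by rewrite mulrDl opprD addrCA [b * s]mulrC subrr addr0.
have sum_h x : \sum_b h b x = q%:R * f (g * x)%g.
  rewrite exchange_big (bigD1 0) //= [X in _ + X]big1 ?addr0 => [|s s1].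
    under eq_bigr do rewrite mul0r oppr0 chi0 mul1r.
    rewrite sumr_const card_Fp // mulr_natl; congr (f (_ * _)%g *+ _).
    by apply: val_inj; rewrite /= /mul2; case: (val x) => [[[a b] c] d]; apply: quat_ext; ring.
  rewrite -mulr_suml (eq_bigr (fun b => chi (b * - s))) => [|b _]; last by rewrite mulrN mulrC.
  by rewrite sum_chi // oppr_eq0 (negPf s1) mul0r.
have [[b b0 hb]|none] := pselect (exists2 b, b != 0 & exists x, h b x != 0).
  by exists b, (h b).
have h0 b x : b != 0 -> h b x = 0.
  by move=> b0; apply/eqP/negP => /negP hx; apply: none; exists b => //; exists x.
have sum0 x : \sum_b h b x = h 0 x.
  by rewrite (bigD1 0) //= big1 ?addr0 // => b; apply: h0.
case/eqP: moved; apply: (mulfI (_ : q%:R != 0)); first by rewrite pnatr_eq0 gtn_eqF ?prime_gt0.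
by rewrite -!sum_h !sum0 hchi mul0r chi0 mul1r.
Qed.

(** The residues 1, ..., (q - 1)/2 contain one of each pair a, -a, hence have distinct squares. *)
Definition torus_param (i : 'I_(q.-1)./2) : F := (i.+1)%:R.

Lemma natr_Fp_eq0 (n : nat) : (n%:R == 0 :> F) = (q %| n)%N.
Proof. by have := intr_Fp_eq0 pq n%:Z; rewrite -pmulrn dvdzE. Qed.

Lemma torus_param_neq0 i : torus_param i != 0.
Proof. by rewrite natr_Fp_eq0 gtnNdvd //; have := ltn_ord i; lia. Qed.

Lemma torus_param_sqr_inj i j : torus_param i ^+ 2 = torus_param j ^+ 2 -> i = j.
Proof.
have hi := ltn_ord i; have hj := ltn_ord j.
move/eqP; rewrite eqf_sqr => /orP[]; last first.
  rewrite -addr_eq0 -natrD natr_Fp_eq0 gtnNdvd //; lia.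
rewrite -subr_eq0 => h; apply/val_inj/eqP => /=.
wlog ij : i j hi hj h / (i <= j)%N => [hw|].
  case: (leqP i j) => [|/ltnW] ij; first exact: hw.
  by rewrite eq_sym hw // -opprB oppr_eq0.
move: h; rewrite -oppr_eq0 opprB -natrB ?ltnS // natr_Fp_eq0 subSS.
case: (posnP (j - i)) => [|ji]; first lia.
by rewrite gtnNdvd //; lia.
Qed.

Definition torus i : Q := exist (fun x => det2 x == 1) _ (diag_subproof (torus_param_neq0 i)).

Lemma torus_upper i s : (torus i * upper s = upper (torus_param i ^+ 2 * s)%R * torus i)%g.
Proof.
apply: val_inj; rewrite /= /mul2 /=; have := torus_param_neq0 i.
by move: (torus_param i) => a a0; apply: quat_ext; field.
Qed.

(* The torus moves the given character of the unipotent group through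
   (q - 1) / 2 distinct ones, hence the eigenvalue has at least this
   multiplicity. *)
Lemma sl2_eigenvalue_bound nu f l : right_eigen nu f -> (exists x, f x != 0) ->
  nu != (k ^ 2)%:R -> 0 <= nu ->
  ((q.-1)./2)%:R * nu ^+ (2 * l) <=
  (q ^ 3 * count (fun w => galt t false w == 1%g) (ws (2 * (2 * l))))%:R.
Proof.
move=> fe f0 nuk nu0.
have [b [h [b0 he [x0 hx0] hchi]]] := exists_character_eigenfunction fe f0 nuk.
pose g i x := h (torus i * x)%g.
pose c := \sum_x `|h x| ^+ 2.
have c0 : 0 < c.
  rewrite /c (bigD1 x0) //=; apply: ltr_wpDr; last by rewrite exprn_gt0 // normr_gt0.
  by apply: sumr_ge0 => x _; apply: exprn_ge0.
have orth i j : \sum_x g i x * (g j x)^* = if i == j then c else 0.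
  have [<-|ij] := eqVneq i j.
    rewrite /c [RHS](reindex_inj (mulgI (torus i))); apply: eq_bigr => x _.
    by rewrite normCK.
  set S := LHS.
  pose d := torus_param i ^+ 2 - torus_param j ^+ 2.
  have d0 : d != 0 by rewrite subr_eq0; apply: contraNneq ij => /torus_param_sqr_inj ->.
  (* Translating x by [upper (b * d)^-1] multiplies the two factors by characters whose product is
     chi 1, which is not 1. *)
  have : S = chi 1 * S.
    rewrite {1}/S (reindex_inj (mulgI (upper (b * d)^-1))) /= /S mulr_sumr.
    apply: eq_bigr => x _; rewrite /g !mulgA !torus_upper -!mulgA !hchi rmorphM /= mulrACA.
    congr (_ * _); rewrite -chiN // -chiD //; congr (chi _).
    rewrite -[RHS](divff (mulf_neq0 b0 d0)); set s := (b * d)^-1.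
    by rewrite /d; ring.
  move/eqP; rewrite -subr_eq0 -{1}[S]mul1r -mulrBl mulf_eq0 => /orP[|/eqP //].
  by rewrite subr_eq0 eq_sym (negPf (chi1 _ _)).
have ge i x : \sum_(w <- ws (2 * l)) g i (x * galt t false w)%g = nu ^+ l * g i x.
  by rewrite -(right_eigen_iter l he) /g; apply: eq_bigr => w _; rewrite mulgA.
have := spectral_bound c0 orth nu0 ge; rewrite card_ord => /le_trans; apply.
by rewrite -natrM ler_nat leq_mul2r (leq_trans (card_sl2 _)) ?card_Fp ?orbT.
Qed.

End EigenFunctions.

(** * Expanding quotients *)

Section Numerics.
(* Here L is about [q ^ (2 / 7)] and [n ^ m] about [q * L ^ 4]; all the constants
   are absorbed by [B ^ m], which is at most [L ^ (1 / 4)] as B is small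
   compared to n. *)
Variables (C0 k n q L m : nat).
(** Here 72 = 9 * 4 * 2: 9 from nu > k^2 / 9, 4 from the word count, 2 from m + 1 <= 2^m. The factor
    C0^2 pays for replacing n^(2m) by k^(2m). *)
Let B := (72 * C0 ^ 2)%N.
Hypotheses (C0_gt0 : (0 < C0)%N) (nk : (n <= C0 * k)%N) (Bn : (B ^ 36 <= n)%N).
Hypotheses (q2 : (2 < q)%N) (Lq : (L ^ 7 <= q ^ 2)%N) (qL : (q ^ 2 < L.+1 ^ 7)%N).
Hypotheses (L_large : (1152 ^ 4 < L)%N) (L_large' : (8192 ^ 2 * n ^ 8 <= L)%N).
Hypotheses (nm : (n ^ m <= q * L ^ 4)%N) (nm2 : (q * L ^ 4 < n ^ (m + 2))%N).

Let X := (B ^ m)%N.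

Lemma X_gt0 : (0 < X)%N.
Proof. by rewrite expn_gt0 muln_gt0 expn_gt0 C0_gt0. Qed.

Lemma cutoff_gt0 : (0 < L)%N.
Proof. exact: leq_ltn_trans (leq0n _) L_large. Qed.

Lemma q2_le : (q ^ 2 <= 128 * L ^ 7)%N.
Proof.
apply: ltnW; apply: leq_trans qL _; rewrite -[128%N]/(2 ^ 7)%N -expnMn leq_exp2r //.
by have := cutoff_gt0; lia.
Qed.

(** From X^36 <= n^m <= q L^4 and q^2 <= 128 L^7 follows X^72 <= 128 L^15 <= L^18. *)
Lemma X4_le : (X ^ 4 <= L)%N.
Proof.
have h : (X ^ 36 <= q * L ^ 4)%N.
  by apply: leq_trans nm; rewrite /X -expnM mulnC expnM; case: (m) => // m'; rewrite leq_exp2r.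
have L128 : (128 <= L)%N.
  apply: leq_trans (ltnW L_large); rewrite (expnD 1152 1 3).
  by apply: leq_trans (leq_pmulr _ _); rewrite ?expn_gt0.
have : ((X ^ 4) ^ 18 <= L ^ 18)%N.
  rewrite -expnM -[(4 * 18)%N]/(36 * 2)%N expnM.
  apply: leq_trans (_ : ((q * L ^ 4) ^ 2 <= _)%N); first by rewrite leq_exp2r.
  rewrite expnMn -expnM.
  apply: leq_trans (leq_mul q2_le (leqnn _)) _.
  rewrite -mulnA -expnD; apply: leq_trans (leq_mul L128 (leqnn _)) _.
  by rewrite -expnS leq_pexp2l ?cutoff_gt0.
by rewrite leq_exp2r.
Qed.

Lemma sq_lt a b : (a ^ 2 < b ^ 2)%N -> (a < b)%N.
Proof. by rewrite ltn_exp2r. Qed.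

(** By maximality of m up to two, n^m > q L^4 / n^2. Squaring leaves 8192 X^2 n^4 <= L, with 8192 =
    64 * 128; [L_large'] and [X4_le] each supply a square root of L. *)
Lemma numeric1 : (8 * X * q ^ 2 < n ^ m)%N.
Proof.
have n_gt0 : (0 < n)%N by apply: leq_trans Bn; rewrite expn_gt0 muln_gt0 expn_gt0 C0_gt0.
rewrite -(ltn_pmul2r (_ : 0 < n ^ 2)%N) ?expn_gt0 ?n_gt0 // -expnD.
apply: leq_ltn_trans nm2.
rewrite (_ : 8 * X * q ^ 2 * n ^ 2 = q * (8 * X * n ^ 2 * q))%N; last by ring.
rewrite leq_mul2l; apply/orP; right.
rewrite -leq_sqr; rewrite (_ : (8 * X * n ^ 2 * q) ^ 2 = (64 * X ^ 2 * n ^ 4) * q ^ 2)%N; last by ring.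
apply: leq_trans (leq_mul (leqnn _) q2_le) _.
rewrite (_ : 64 * X ^ 2 * n ^ 4 * (128 * L ^ 7) = 8192 * X ^ 2 * n ^ 4 * L ^ 7)%N; last by ring.
rewrite -expnM (expnD L 1 7) leq_mul2r; apply/orP; right.
rewrite expn1 -leq_sqr; apply: leq_trans (leq_mul L_large' X4_le).
by rewrite leq_eqVlt; apply/orP; left; apply/eqP; move: 8192%N => c; ring.
Qed.

Lemma numeric2 : (1152 * X * L ^ 3 < q)%N.
Proof.
apply: sq_lt; apply: leq_trans Lq.
rewrite (expnD L 1 6) expn1 (_ : (1152 * X * L ^ 3) ^ 2 = (1152 ^ 2 * X ^ 2) * L ^ 6)%N; last first.
  by move: 1152%N => c; ring.
rewrite ltn_pmul2r ?expn_gt0 ?cutoff_gt0 //; apply: sq_lt.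
rewrite (_ : (1152 ^ 2 * X ^ 2) ^ 2 = 1152 ^ 4 * X ^ 4)%N; last by move: 1152%N => c; ring.
rewrite -[(L ^ 2)%N]mulnn; apply: leq_trans (leq_mul (leqnn L) X4_le).
rewrite ltn_pmul2r; first exact: L_large.
by rewrite expn_gt0 X_gt0.
Qed.

(** Eight times either term on the left is at most q k^(2m), the first by [numeric1] and the second
    by [numeric2], and q <= 4 (q - 1)/2. *)
Lemma numeric_bound :
  (9 ^ m * (4 ^ m * k ^ m * q ^ 3 + 4 ^ m * m.+1 * (144 * n ^ (2 * m) * L ^ 3)) <
   (q.-1)./2 * k ^ (2 * m))%N.
Proof.
have k_gt0 : (0 < k)%N.
  rewrite lt0n; apply/eqP => k0; move: nk Bn; rewrite k0 muln0 leqn0 => /eqP ->.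
  by rewrite leqNgt expn_gt0 muln_gt0 expn_gt0 C0_gt0.
have XE : X = (72 ^ m * C0 ^ (2 * m))%N by rewrite /X /B expnMn -expnM.
have XC : (36 ^ m * C0 ^ m <= X)%N.
  rewrite XE leq_mul //; first by case: (m) => // m'; rewrite leq_exp2r.
  by rewrite leq_pexp2l // leq_pmull.
have nkm : (n ^ m <= C0 ^ m * k ^ m)%N.
  by rewrite -expnMn; case: (m) => // m'; rewrite leq_exp2r.
have c0m : (0 < C0 ^ m)%N by rewrite expn_gt0 C0_gt0.
have km : (0 < k ^ m)%N by rewrite expn_gt0 k_gt0.
have h1 : (8 * 36 ^ m * q ^ 2 < k ^ m)%N.
  rewrite -(ltn_pmul2l c0m); apply: leq_trans nkm; apply: leq_ltn_trans numeric1.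
  rewrite (_ : C0 ^ m * _ = (36 ^ m * C0 ^ m) * (8 * q ^ 2))%N; last by ring.
  by rewrite (_ : 8 * X * q ^ 2 = X * (8 * q ^ 2))%N ?leq_mul //; ring.
have m2 : (m.+1 <= 2 ^ m)%N by apply: ltn_expl.
have h2 : (1152 * 36 ^ m * m.+1 * n ^ (2 * m) * L ^ 3 < q * k ^ (2 * m))%N.
  apply: (@leq_ltn_trans (1152 * X * L ^ 3 * k ^ (2 * m))%N); last first.
    by rewrite ltn_pmul2r ?numeric2 // expn_gt0 k_gt0.
  have n2 : (n ^ (2 * m) <= C0 ^ (2 * m) * k ^ (2 * m))%N.
    by rewrite -expnMn; case: (2 * m)%N => // m'; rewrite leq_exp2r.
  have e36 : (36 ^ m * m.+1 <= 72 ^ m)%N.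
    by rewrite -[72%N]/(36 * 2)%N expnMn leq_mul.
  have := leq_mul (leq_mul e36 n2) (leqnn (1152 * L ^ 3)).
  rewrite XE; move: 1152%N (36 ^ m)%N (72 ^ m)%N (C0 ^ _)%N (k ^ _)%N (n ^ _)%N (L ^ 3)%N => *; lia.
have q4 : (q <= 4 * (q.-1)./2)%N by move: q2; clear; lia.
have e : (9 ^ m * 4 ^ m = 36 ^ m)%N by rewrite -expnMn.
rewrite -(ltn_pmul2l (_ : 0 < 8)%N) //.
apply: (@leq_trans (2 * (q * k ^ (2 * m)))); last first.
  rewrite (_ : 8 * _ = 2 * (4 * q.-1./2 * k ^ (2 * m)))%N; last by ring.
  by rewrite leq_mul2l leq_mul.
rewrite mulnDr mulnDr [X in (_ < X)%N]mul2n -addnn.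
have h1' : (8 * (9 ^ m * (4 ^ m * k ^ m * q ^ 3)) < q * k ^ (2 * m))%N.
  rewrite (_ : 8 * _ = q * k ^ m * (8 * (9 ^ m * 4 ^ m) * q ^ 2))%N; last by ring.
  rewrite e (_ : q * k ^ (2 * m) = q * k ^ m * k ^ m)%N; last first.
    by rewrite mul2n -addnn (expnD k m m) mulnA.
  by rewrite ltn_pmul2l // muln_gt0 km andbT; move: q2; clear; lia.
have h2' : (8 * (9 ^ m * (4 ^ m * m.+1 * (144 * n ^ (2 * m) * L ^ 3))) <= q * k ^ (2 * m))%N.
  apply: leq_trans (ltnW h2); rewrite -e leq_eqVlt; apply/orP; left; apply/eqP.
  by ring.
by rewrite -addSn; exact: leq_add.
Qed.

End Numerics.

(** * From integer quaternions to SL_2 *)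

Section QuaternionsToSL2.
Variables (F : finFieldType) (iota : F).
Hypothesis iota2 : iota ^+ 2 = - 1.
Hypothesis two0 : 2%:R != 0 :> F.
Implicit Types x y : F * F * F * F.

Definition qmat x : F * F * F * F := let: (a, b, c, d) := x in
  (a + b * iota, c + d * iota, - c + d * iota, a - b * iota).

Lemma qmat_mul x y : qmat (qmul x y) = mul2 (qmat x) (qmat y).
Proof.
case: x y => [[[a b] c] d] [[[a' b'] c'] d'] /=.
by apply: quat_ext; ring: iota2.
Qed.

Lemma qmat_conj x : qmat (qconj x) = adj2 (qmat x).
Proof. by case: x => [[[a b] c] d]; apply: quat_ext; ring. Qed.

Lemma det_qmat x : det2 (qmat x) = qnorm x.
Proof. by case: x => [[[a b] c] d] /=; ring: iota2. Qed.

Lemma qmat_scale r x : qmat (qscale r x) = qscale r (qmat x).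
Proof. by case: x => [[[a b] c] d] /=; apply: quat_ext; ring. Qed.

Lemma mul2_scalel r x y : mul2 (qscale r x) y = qscale r (mul2 x y).
Proof. by case: x y => [[[a b] c] d] [[[a' b'] c'] d'] /=; apply: quat_ext; ring. Qed.

Lemma mul2_scaler r x y : mul2 x (qscale r y) = qscale r (mul2 x y).
Proof. by case: x y => [[[a b] c] d] [[[a' b'] c'] d'] /=; apply: quat_ext; ring. Qed.

Lemma adj2_scale r x : adj2 (qscale r x) = qscale r (adj2 x).
Proof. by case: x => [[[a b] c] d] /=; apply: quat_ext; ring. Qed.

Lemma det2_scale r x : det2 (qscale r x) = r ^+ 2 * det2 x.
Proof. by case: x => [[[a b] c] d] /=; ring. Qed.

Lemma qmat_scalar_inj x r : qmat x = (r, 0, 0, r) -> x = (r, 0, 0, 0).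
Proof.
case: x => [[[a b] c] d] [h1 h2 h3 h4].
have k0 : qkills iota 0 (a - r, b, c, d).
  by rewrite /qkills !mulr0 !addr0 h3; split=> //; rewrite addrAC h1 subrr.
have h5 : a - r - b * iota = 0 by rewrite addrAC h4 subrr.
have [ar -> -> ->] := half_matrix_eq0 iota2 two0 k0 h2 h5.
by congr (_, _, _, _); apply/eqP; rewrite -subr_eq0 ar.
Qed.

Variables (k n : nat) (s : 'I_k -> int * int * int * int) (a0 : 'I_k).
Hypothesis n0 : n%:R != 0 :> F.
Hypothesis norm_s : forall a, qnorm (s a) = n%:Z.
Local Notation ni := (n%:R^-1 : F).

Lemma sl2_letter_subproof a :
  det2 (qscale ni (qmat (qcast F (qmul (s a) (qconj (s a0)))))) == 1.
Proof.
rewrite det2_scale det_qmat qcast_norm qnormM qnorm_conj !norm_s rmorphM /= -pmulrn.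
by rewrite -expr2 -exprMn mulVf // expr1n.
Qed.

(* The factor [qconj (s a0)] makes the determinant equal to 1 and cancels in the
   quotients of two letters. *)
Definition sl2_letter a : sl2 F := exist (fun x => det2 x == 1) _ (sl2_letter_subproof a).

Lemma val_galt_sl2 r w : size w = (2 * r)%N ->
  val (galt sl2_letter false w) = qscale (ni ^+ r) (qmat (qcast F (alt_prod s false w))).
Proof.
elim: r w => [|r IH] w.
  rewrite muln0 => /size0nil -> /=; apply: quat_ext; ring.
rewrite mulnS; case: w => [|a [|b w]] // [sw].
have -> : galt sl2_letter false [:: a, b & w] =
    (sl2_letter a * ((sl2_letter b)^-1 * galt sl2_letter false w))%g by [].
have val_inv (x : sl2 F) : val (x^-1)%g = adj2 (val x) by [].
have val_letter c : val (sl2_letter c) =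
  qscale ni (qmat (qcast F (qmul (s c) (qconj (s a0))))) by [].
rewrite 2!val_sl2_mul IH // val_inv !val_letter.
rewrite adj2_scale -qmat_conj -qcast_conj qconjM qconjK.
rewrite !(mul2_scalel, mul2_scaler, qscaleA) -!qmat_mul -!qcast_mul.
have -> : qmul (qmul (s a) (qconj (s a0))) (qmul (qmul (s a0) (qconj (s b))) (alt_prod s false w)) =
    qscale n%:Z (alt_prod s false [:: a, b & w]).
  by rewrite -[qmul (qmul (s a0) _) _]qmulA -qmulA qconj_mul_cancel norm_s qscale_mulr.
have -> (x : int * int * int * int) : qcast F (qscale n%:Z x) = qscale n%:R (qcast F x).
  by case: x => [[[? ?] ?] ?]; rewrite /qcast /qscale !rmorphM.
rewrite qmat_scale qscaleA; congr (qscale _ _).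
by rewrite exprS; field.
Qed.

End QuaternionsToSL2.

Lemma near_scalar_qcast (q N : nat) (x : int * int * int * int) : prime q ->
  qcast 'F_q x = (N%:R, 0, 0, 0) -> near_scalar q N x.
Proof.
move=> pq; case: x => [[[a b] c] d] [ha hb hc hd].
by rewrite /near_scalar -!(intr_Fp_eq0 pq) rmorphB /= ha hb hc hd -pmulrn subrr !eqxx.
Qed.

(** The norm bounds all coordinates by N, so the numbers divisible by q are at most 2 N < q in
    absolute value, hence zero. *)
Lemma near_scalar_eq (q N : nat) x : near_scalar q N x -> qnorm x = (N ^ 2)%N%:Z ->
  (2 * N < q)%N -> x = (N%:Z, 0, 0, 0).
Proof.
case: x => [[[a b] c] d] /and4P[ha hb hc hd] /= nx Nq.
have sqN : (N ^ 2)%N%:Z = N%:Z ^+ 2 by rewrite -[(N ^ 2)%N%:Z]natz natrX natz.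
have bound t : t ^+ 2 <= (N ^ 2)%N%:Z -> `|t| <= N%:Z.
  by rewrite sqN -(real_normK (num_real t)) ler_sqr ?nnegrE.
have [ba bb bc bd] : [/\ `|a| <= N%:Z, `|b| <= N%:Z, `|c| <= N%:Z & `|d| <= N%:Z].
  move: (sqr_ge0 a) (sqr_ge0 b) (sqr_ge0 c) (sqr_ge0 d) => h1 h2 h3 h4.
  split; apply: bound; rewrite -nx; move: h1 h2 h3 h4;
    move: (a ^+ 2) (b ^+ 2) (c ^+ 2) (d ^+ 2); clear; lia.
have Nq' : N%:Z < q%:Z by move: Nq; clear; lia.
have small t : (q %| t)%Z -> `|t| < q%:Z -> t = 0.
  move=> /dvdzP[u ->]; rewrite normrM (ger0_norm (_ : 0 <= q%:Z)) // -[X in _ < X]mul1r ltr_pM2r; last by rewrite ltz_nat; apply: leq_ltn_trans Nq.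
  move=> u1; have -> : u = 0 by move: u1; clear; lia.
  by rewrite mul0r.
congr (_, _, _, _); last 3 first; [by apply: small => //; apply: le_lt_trans Nq'..|].
by apply/eqP; rewrite -subr_eq0; apply/eqP/small => //; move: ba Nq; clear; lia.
Qed.

(** The exponent of n is taken even because [spectral_bound] concerns words of 2 (2 l) letters. *)
Lemma exists_cutoffs (n Lmin q : nat) : (1 < n)%N -> (0 < q)%N -> (0 < Lmin)%N -> (Lmin ^ 7 <= q ^ 2)%N ->
  exists L l : nat, [/\ (Lmin <= L)%N, (L ^ 7 <= q ^ 2 < L.+1 ^ 7)%N &
     (n ^ (2 * l) <= q * L ^ 4 < n ^ (2 * l + 2))%N].
Proof.
move=> n1 q0 Lm0 Lq; have [L hL] := @exists_floor_root 7 (q ^ 2) isT.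
have LL : (Lmin <= L)%N.
  rewrite leqNgt; apply/negP => h; case/andP: hL => _; rewrite ltnNge => /negP; apply.
  by apply: leq_trans Lq; rewrite leq_exp2r.
have L0 := leq_trans Lm0 LL.
exists L, (trunc_log (n ^ 2) (q * L ^ 4)); split=> //.
have n21 : (1 < n ^ 2)%N by rewrite -(exp1n 2) ltn_exp2r.
have qL0 : (0 < q * L ^ 4)%N by rewrite muln_gt0 q0 expn_gt0 L0.
have /andP[h1 h2] := trunc_log_bounds n21 qL0.
by rewrite expnM h1 /= -mulnSr expnM.
Qed.

Section ExpandingQuotients.
Local Open Scope complex_scope.

Lemma exists_expanding_quotients (R : rcfType) : exists k : nat, (18 <= k)%N /\
  forall T : nat, exists (Q : finGroupType) (t : 'I_k -> Q),
    (forall r w, (0 < r <= T)%N -> size w = (2 * r)%N ->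
       sorted (fun a b => a != b) w -> galt t false w <> 1%g) /\
    (forall (nu : R) (f : Q -> R),
       (forall x, \sum_(w <- words (enum 'I_k) 2) f (x * galt t false w)%g = nu * f x) ->
       (k ^ 2)%:R / 9%:R < nu < (k ^ 2)%:R -> forall x, f x = 0).
Proof.
have [C1 [C1E C1_gt0]] : exists C1, C1 = (4 * 9 ^ 4)%N /\ (0 < C1)%N.
  by exists (4 * 9 ^ 4)%N; split=> //; rewrite muln_gt0 expn_gt0.
pose C0 := (4 * C1)%N; pose B := (72 * C0 ^ 2)%N.
(* The three summands ensure B^36 <= n, k >= 18 and p > 5. *)
have [p [c [k [s [[pp pM c0 kp pk] [norm_s s_indep]]]]]] :=
  exists_tree_generators (B ^ 36 + 18 * C1 + 5).
rewrite -C1E {C1E} in pk.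
have /andP[c_gt0 c_le4] := c0.
have p_le : (p <= c * p)%N by rewrite leq_pmull.
have k18 : (18 <= k)%N.
  rewrite -(leq_pmul2l C1_gt0); apply: leq_trans pk; rewrite mulnC.
  by apply: leq_trans (ltnW pM); rewrite -addnA addnCA leq_addr.
have k0 : (0 < k)%N by apply: leq_trans k18.
have p5 : (5 < p)%N by apply: leq_ltn_trans (leq_addl _ _) pM.
pose n := (c * p)%N.
have n_gt1 : (1 < n)%N by apply: leq_trans p_le; apply: leq_trans p5.
have nk : (n <= C0 * k)%N by rewrite /C0 -mulnA leq_mul.
have Bn : (B ^ 36 <= n)%N.
  by apply: leq_trans p_le; apply: leq_trans (ltnW pM); rewrite -addnA leq_addr.
exists k; split=> // T.
have [Lmin [Lmin_gt0 Lmin1 Lmin2]] : exists Lmin, [/\ 0 < Lmin, 1152 ^ 4 < Lmin & 8192 ^ 2 * n ^ 8 <= Lmin]%N.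
  have gen (a b : nat) : exists c, [/\ 0 < c, a < c & b <= c]%N.
    by exists (a + b).+1; clear; split; lia.
  exact: gen.
(* The size of q makes L >= Lmin, excludes short trivial words through 2 n^T < q, and makes q prime
   to 2 n. *)
have [q [iota [pq qM iota2q]]] := exists_prime_sqrtN1 (Lmin ^ 7 + 2 * n ^ T + 2 * n + 2).
have q_gt2 : (2 < q)%N by apply: leq_ltn_trans qM; rewrite leq_addl.
have q0 := prime_gt0 pq.
have [aux1 aux2 aux3] : [/\ forall a b c : nat, (a <= a + b + c + 2)%N,
    forall a b c : nat, (b <= a + b + c + 2)%N & forall a b c : nat, (c <= a + b + c + 2)%N].
  by clear; split; lia.
have qT : (2 * n ^ T < q)%N := leq_ltn_trans (aux2 _ _ _) qM.
have q2n : ~~ (q %| 2 * n)%N.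
  have h : (0 < 2 * n)%N by rewrite mul2n double_gt0 ltnW.
  rewrite (gtnNdvd h) //.
  exact: leq_ltn_trans (aux3 _ _ _) qM.
have qL : (Lmin ^ 7 <= q ^ 2)%N.
  apply: leq_trans (_ : (q <= _)%N); first exact: leq_trans (aux1 _ _ _) (ltnW qM).
  by rewrite -mulnn leq_pmulr.
have [L [l [LL /andP[L7 L7'] /andP[nm nm2]]]] := exists_cutoffs n_gt1 q0 Lmin_gt0 qL.
have L_large := leq_trans Lmin1 LL; have L_large' := leq_trans Lmin2 LL.
have L0 : (0 < L)%N by apply: leq_ltn_trans L_large.
pose i0 : 'F_q := iota%:R.
have i02 : i0 ^+ 2 = -1.
  apply/eqP; rewrite -addr_eq0 /i0 -natrX -[1]/(1%:R) -natrD.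
  by rewrite natr_Fp_eq0.
have two0 : 2%:R != 0 :> 'F_q by rewrite natr_Fp_eq0 // gtnNdvd.
have n0 : n%:R != 0 :> 'F_q.
  by rewrite natr_Fp_eq0 //; apply: contraNN q2n => h; rewrite dvdn_mull.
pose a0 : 'I_k := Ordinal k0.
have iq0 : n%:R^-1 != 0 :> 'F_q by rewrite invr_eq0.
pose t := sl2_letter i02 a0 n0 norm_s.
have trivial_scalar r w : size w = (2 * r)%N -> galt t false w = 1%g ->
    near_scalar q (n ^ r) (alt_prod s false w).
  move=> sw /(congr1 val); rewrite (val_galt_sl2 _ _ _ _ sw) => e.
  apply: near_scalar_qcast => //; apply: (qmat_scalar_inj i02 two0).
  move/(congr1 (qscale (n%:R ^+ r))): e; rewrite qscaleA -exprMn divff // expr1n qscale1 => ->.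
  by rewrite /= !mulr0 !mulr1 natrX.
exists (sl2 'F_q), t; split.
  (* A short reduced word trivial in Q has value exactly n^r, a multiple of p, against
     [reduced_word_ndvd]. *)
  move=> r w /andP[r0 rT] sw red /(trivial_scalar _ _ sw) near.
  have nrm : qnorm (alt_prod s false w) = ((n ^ r) ^ 2)%N%:Z.
    by rewrite (norm_alt_prod norm_s) sw -expnM [(r * 2)%N]mulnC.
  have small : (2 * n ^ r < q)%N.
    by apply: leq_ltn_trans qT; rewrite leq_mul2l leq_pexp2l // ltnW.
  have e := near_scalar_eq near nrm small.
  case: w sw red e {near nrm} => [|a w] sw red e; first by move: sw r0; clear; case: r.
  have [] := reduced_word_ndvd pp k0 p5 c0 norm_s s_indep false red.
  rewrite e /qdvd !dvdz0 !andbT dvdzE /= => /negP nd _; apply: nd.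
  case: (r) r0 => // r' _.
  by rewrite expnS /n -mulnA dvdn_mull // dvdn_mulr.
move=> nu f fe /andP[nu_gt nu_lt] x; apply/eqP/negP => /negP fx.
have [z [zq z1]] := exists_unity_root R[i] pq.
have fe' : right_eigen t (nu%:C) (fun x => (f x)%:C).
  by move=> y; rewrite -rmorphM -fe rmorph_sum.
have k2_gt0 : 0 <= (k ^ 2)%:R / 9%:R :> R by rewrite divr_ge0.
have nu0 : 0 <= nu by apply: le_trans (ltW nu_gt).
have := @sl2_eigenvalue_bound _ q z pq q_gt2 zq z1 k t nu%:C _ l fe'.
have -> : (exists x, (f x)%:C != 0) = True.
  by apply/propext; split=> // _; exists x; rewrite (inj_eq (@complexI R)).
have -> : (nu%:C != (k ^ 2)%:R) = true.
  by rewrite -(rmorph_nat (real_complex R)) (inj_eq (@complexI R)) lt_eqF.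
have -> : (0 <= nu%:C) = true by rewrite lecR.
move=> /(_ I isT isT); rewrite -rmorphXn /= -!(rmorph_nat (real_complex R)) -rmorphM lecR.
set N := count _ _ => bound.
have N_le : (q ^ 3 * N <= 4 ^ (2 * l) * k ^ (2 * l) * q ^ 3 +
     4 ^ (2 * l) * (2 * l).+1 * (144 * n ^ (2 * (2 * l)) * L ^ 3))%N.
  apply: leq_trans (count_scalar_words pp k0 p5 c0 norm_s s_indep pq q2n L0 nm kp).
  rewrite leq_mul2l; apply/orP; right; rewrite /N -!size_filter.
  apply: uniq_leq_size; first by rewrite filter_uniq // uniq_words.
  move=> w; rewrite !mem_filter mem_words => /andP[/eqP w1 /eqP sw].
  by rewrite (trivial_scalar _ _ sw w1) sw eqxx.
have C0_gt0 : (0 < C0)%N by rewrite muln_gt0.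
have := numeric_bound C0_gt0 nk Bn q_gt2 L7 L7' L_large L_large' nm nm2.
rewrite ltnNge => /negP; apply.
(* Since nu > k^2 / 9, the eigenvalue bound with nu^(2l) replaced by (k^2 / 9)^(2l) contradicts
   [numeric_bound] for m = 2 l. *)
apply: leq_trans (leq_mul (leqnn _) N_le).
rewrite -(ler_nat R) natrM natrM [(9 ^ _)%:R]natrX [X in _ <= X]mulrC -ler_pdivrMr ?exprn_gt0 ?ltr0n //.
apply: le_trans bound; rewrite -mulrA ler_wpM2l // expnM natrX -expr_div_n.
by rewrite lerXn2r ?nnegrE // ltW.
Qed.

End ExpandingQuotients.

(** * Quotients of the tree *)

Section TreeGroup.
Variables (k' : nat) (i j : 'I_3).
Local Notation k := k'.+2.
Local Notation G := (Gk k).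
Local Notation P := (Pij k i j).
Local Notation xi := (gen k i).
Local Notation xj := (gen k j).
Local Open Scope quotient_scope.
Local Open Scope group_scope.
Local Open Scope classical_set_scope.

Lemma gen_expk l : gen k l ^+ k = 1.
Proof.
have powE n : gen k l ^+ n = \pi_(presented_group (@relators k)) (nseq n (l, false)).
  elim: n => [|n IH]; first by [].
  by rewrite expgS IH [LHS]pres_mulE.
rewrite powE; apply/pi_wordP.
by have := @WordRel _ (@relators k) [::] [::] (nseq k (l, false)); rewrite cats0; apply; exists l.
Qed.

Lemma generated_subgroup (H : groupType) (A : set H) : is_subgroup (Defs.generated A).
Proof.
split=> [B [[B1 _] _] //|g h Ag Ah B [HB AB]].
by apply: (HB.2); [apply: Ag | apply: Ah].
Qed.

Lemma generated_sub (H : groupType) (A B : set H) :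
  is_subgroup B -> A `<=` B -> Defs.generated A `<=` B.
Proof. by move=> HB AB g; apply. Qed.

Lemma sub_generated (H : groupType) (A : set H) : A `<=` Defs.generated A.
Proof. by move=> a Aa B [_ AB]; apply: AB. Qed.

Lemma subgroupM (H : groupType) (A : set H) g h : is_subgroup A -> A g -> A h -> A (g * h).
Proof.
move=> [A1 AM] Ag Ah; rewrite -[h]invgK; apply: (AM) => //.
by rewrite -[h^-1]mul1g; apply: (AM).
Qed.

Lemma subgroupV (H : groupType) (A : set H) g : is_subgroup A -> A g -> A g^-1.
Proof. by move=> [A1 AM] Ag; rewrite -[g^-1]mul1g; apply: (AM). Qed.

Lemma subgroupX (H : groupType) (A : set H) g n : is_subgroup A -> A g -> A (g ^+ n).
Proof.
move=> AG Ag; elim: n => [|n IH]; first by case: AG.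
by rewrite expgS; apply: subgroupM.
Qed.

Lemma P_subgroup : is_subgroup P. Proof. exact: generated_subgroup. Qed.
Lemma P_xi : P xi. Proof. by apply: sub_generated; left. Qed.
Lemma P_xj : P xj. Proof. by apply: sub_generated; right. Qed.

Lemma expg_ordD l (a b : 'I_k) : gen k l ^+ (a + b)%R = gen k l ^+ a * gen k l ^+ b.
Proof.
have -> : ((a + b)%R : nat) = ((a + b) %% k)%N by [].
by rewrite -expgD [in RHS](divn_eq (a + b) k) expgD mulnC expgM gen_expk expg1n mul1g.
Qed.

(** For distinct i, j the quotient of the tree by P_ij,0 has two vertices and k edges between them;
    this is the loop that goes out along edge a and back along edge 0. *)
Definition path_gen (a : 'I_k) : G := xi ^+ a * xj ^- a.

Lemma path_gen_step (a : 'I_k) :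
  xi ^+ a * xj = path_gen a * (path_gen (a + 1)%R)^-1 * xi ^+ (a + 1)%R.
Proof.
rewrite /path_gen !expg_ordD invMg invgK expg1 -!mulgA; congr (_ * _).
rewrite mulVg mulg1 -?mulgA.
by rewrite !mulgA mulVg mul1g.
Qed.

(** Equal neighbours cancel in an alternating product, and removing two letters preserves the signs
    of the others. The reduced word serves all groups at once, in particular both P_ij and Q. *)
Lemma reduce_word r (w : seq 'I_k) : size w = (2 * r)%N ->
  exists r' w', [/\ size w' = (2 * r')%N, sorted (fun a b => a != b) w' &
    forall (Q : groupType) (t : 'I_k -> Q), galt t false w = galt t false w'].
Proof.
elim: r w => [|r IH] w sw.
  by exists 0, [::]; move: sw => /size0nil ->.
have [red|] := boolP (sorted (fun a b => a != b) w); first by exists r.+1, w.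
move=> nred; have [u [a [v wE]]] : exists u a v, w = u ++ [:: a, a & v].
  elim: w nred {sw IH} => [|a [|b w] IH] //=.
  rewrite negb_and negbK => /orP[/eqP <-|/IH[u [c [v ->]]]]; first by exists [::], a, w.
  by exists (a :: u), c, v.
have sw' : size (u ++ v) = (2 * r)%N by move: sw; rewrite wE !size_cat /=; lia.
have [r' [w' [h1 h2 h3]]] := IH _ sw'; exists r', w'; split=> // Q' t'.
rewrite -h3 wE !galt_cat; congr (_ * _).
rewrite /= negbK mulgA -[RHS]mul1g; congr (_ * _).
by case: odd; rewrite /alt_letter /= ?mulgV ?mulVg.
Qed.

(* Pushing the letters of an element of P to the left leaves an alternating
   product of the free generators [path_gen a], and a power of [x_i]. *)
Lemma P_normal_form g : P g -> exists r w (c : 'I_k),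
  size w = (2 * r)%N /\ g = galt path_gen false w * xi ^+ c.
Proof.
pose S : set G := [set g | exists r w (c : 'I_k),
  size w = (2 * r)%N /\ g = galt path_gen false w * xi ^+ c].
have Si g0 : S g0 -> S (g0 * xi).
  move=> [r [w [c [sw ->]]]]; exists r, w, (c + 1)%R; split=> //.
  by rewrite expg_ordD expg1 mulgA.
have Sj g0 : S g0 -> S (g0 * xj).
  move=> [r [w [c [sw ->]]]]; exists r.+1, (w ++ [:: c; c + 1])%R, (c + 1)%R; split.
    by rewrite size_cat sw /= mulnS addnC.
  rewrite -mulgA path_gen_step galt_cat sw mul2n odd_double /= mulg1.
  by rewrite !mulgA.
have SX x g0 n : (forall g0, S g0 -> S (g0 * x)) -> S g0 -> S (g0 * x ^+ n).
  move=> Sx; elim: n g0 => [|n IH] g0 Sg0; first by rewrite mulg1.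
  by rewrite expgS mulgA; apply/IH/Sx.
pose S' : set G := [set g | forall g0, S g0 -> S (g0 * g) /\ S (g0 * g^-1)].
have S'gen l : (forall g0, S g0 -> S (g0 * gen k l)) -> S' (gen k l).
  move=> Sl g0 Sg0; split; first exact: Sl.
  have -> : (gen k l)^-1 = gen k l ^+ k.-1; last exact: SX.
  by apply: (mulgI (gen k l)); rewrite mulgV -expgS gen_expk.
have S'G : is_subgroup S'.
  split=> [g0 Sg0|g1 g2 S1 S2 g0 Sg0]; first by rewrite invg1 mulg1.
  rewrite invMg invgK !mulgA; split; first by apply: (S2 _ _).2; apply: (S1 _ _).1.
  by apply: (S1 _ _).2; apply: (S2 _ _).1.
have S1 : S 1 by exists 0, [::], 0%R; rewrite mulg1.
move=> /(generated_sub S'G) Pg; rewrite -[g]mul1g.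
suff : S' g by case/(_ _ S1).
by apply: Pg => x [->|->]; apply: S'gen.
Qed.

End TreeGroup.

Section Action.
Variables (k' : nat) (i j : 'I_3) (Q : finGroupType) (t : 'I_k'.+2 -> Q).
Hypothesis ij : i != j.
Local Notation k := k'.+2.
Local Notation G := (Gk k).
Local Notation P := (Pij k i j).
Local Notation P0 := (Pij0 k i j).
Local Notation xi := (gen k i).
Local Notation xj := (gen k j).
Local Open Scope group_scope.
Local Open Scope classical_set_scope.

(* Edges of the Cayley-type graph with left vertices q and right vertices
   [q * t a]: the edge (q, a) joins q to [q * t a]. The generators rotate the
   edges around their left and right endpoints. *)
Local Notation flag := (Q * 'I_k)%type.

Definition rot_left (w : flag) : flag := (w.1, w.2 + 1)%R.
Definition rot_right (w : flag) : flag := (w.1 * t w.2 * (t (w.2 + 1)%R)^-1, (w.2 + 1)%R).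

Lemma rot_left_inj : injective rot_left.
Proof.
move=> [q a] [q' a'] e; have /= e1 := congr1 fst e; have /= e2 := congr1 snd e.
by rewrite e1 (addIr _ e2).
Qed.

Lemma rot_right_inj : injective rot_right.
Proof.
move=> [q a] [q' a'] e; have /= e1 := congr1 fst e; have /= e2 := congr1 snd e.
by move: e1; rewrite (addIr _ e2) => /mulIg/mulIg ->.
Qed.

Definition gen_perm (l : 'I_3) : {perm flag} :=
  if l == j then perm rot_right_inj else perm rot_left_inj.

(** Permutations compose from left to right, so this is a right action of G on the edges. *)
Definition rho : G -> {perm flag} := plift gen_perm.

Lemma gen_permX l n q a : (gen_perm l ^+ n) (q, a) =
  (if l == j then q * t a * (t (a + n%:R)%R)^-1 else q, (a + n%:R)%R).
Proof.
elim: n => [|n IH]; first by rewrite expg0 perm1 addr0 mulgK; case: ifP.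
rewrite expgSr permM IH /gen_perm; case: (l == j); rewrite permE /rot_left /rot_right /=.
  by rewrite -addrA natr1 mulgKV.
by rewrite -addrA natr1.
Qed.

Lemma natr_k : k%:R = 0%R :> 'I_k.
Proof. by rewrite Zp_nat; apply/val_inj; rewrite /= modnn. Qed.

Lemma rho_relators r : @relators k r -> word_eval gen_perm r = 1.
Proof.
move=> [l _ <-]; rewrite word_eval_nseq; apply/permP => [[q a]].
by rewrite gen_permX natr_k addr0 perm1 mulgK; case: ifP.
Qed.

Lemma rhoM g h : rho (g * h) = rho g * rho h.
Proof. exact: (pliftM rho_relators). Qed.

Lemma rho_gen l : rho (gen k l) = gen_perm l.
Proof. exact: (plift_gen rho_relators). Qed.

Lemma rho1 : rho 1 = 1.
Proof. by apply: (mulgI (rho 1)); rewrite -rhoM !mulg1. Qed.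

Lemma rhoV g : rho g^-1 = (rho g)^-1.
Proof. by apply: (mulgI (rho g)); rewrite -rhoM !mulgV rho1. Qed.

Lemma rhoX g n : rho (g ^+ n) = rho g ^+ n.
Proof. by elim: n => [|n IH]; rewrite ?rho1 // !expgS rhoM IH. Qed.

Lemma rho_xi n q a : rho (xi ^+ n) (q, a) = (q, (a + n%:R)%R).
Proof. by rewrite rhoX rho_gen gen_permX (negPf ij). Qed.

Lemma rho_xj n q a : rho (xj ^+ n) (q, a) = (q * t a * (t (a + n%:R)%R)^-1, (a + n%:R)%R).
Proof. by rewrite rhoX rho_gen gen_permX eqxx. Qed.

Lemma P_ind (S : set G) : is_subgroup S -> S xi -> S xj -> P `<=` S.
Proof. by move=> SG Si Sj; apply: generated_sub => // x [->|->]. Qed.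

(** The rotations change the left vertex by right multiplications only. Hence what fixes the base
    edge fixes its left translates, which gives normality of the stabiliser. *)
Lemma rho_left g : P g -> forall q w, rho g (q * w.1, w.2) = (q * (rho g w).1, (rho g w).2).
Proof.
move: g; apply: P_ind.
- split=> [q [q' a]|g h Sg Sh q w]; first by rewrite rho1 !perm1.
  rewrite rhoM rhoV !permM Sg.
  have [w' ->] : exists w', rho g w = rho h w' by exists ((rho h)^-1 (rho g w)); rewrite permKV.
  by rewrite -Sh !permK.
- by move=> q [q' a]; rewrite -[xi]expg1 !rho_xi.
- by move=> q [q' a]; rewrite -[xj]expg1 !rho_xj /= !mulgA.
Qed.

Lemma rho_deg g : P g -> forall w, (rho g w).2 = (w.2 + deg g)%R.
Proof.
have k1 : (1 < k)%N by [].
move: g; apply: P_ind.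
- have deg1 : deg (1 : G) = 0%R.
    by apply: (addrI (deg (1 : G))); rewrite -degM // mulg1 addr0.
  split=> [w|g h Sg Sh w]; first by rewrite rho1 perm1 deg1 addr0.
  have degV : deg h^-1 = (- deg h)%R.
    by apply: (addrI (deg h)); rewrite -degM // mulgV deg1 subrr.
  rewrite rhoM rhoV permM degM // degV addrA -Sg.
  have [w' ->] : exists w', rho g w = rho h w' by exists ((rho h)^-1 (rho g w)); rewrite permKV.
  by rewrite permK Sh addrK.
- by move=> [q a]; rewrite -[X in rho X]expg1 rho_xi deg_gen.
- by move=> [q a]; rewrite -[X in rho X]expg1 rho_xj deg_gen.
Qed.

Local Notation base := (1 : Q, 0%R : 'I_k).
Definition pos g : flag := rho g base.

Lemma pos_mul g h : pos (g * h) = rho h (pos g).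
Proof. by rewrite /pos rhoM permM. Qed.

Definition stab : set G := [set g | P g /\ pos g = base].

Lemma stab_subgroup : is_subgroup stab.
Proof.
split=> [|g h [Pg eg] [Ph eh]]; first by split; [case: (P_subgroup k' i j) | rewrite /pos rho1 perm1].
have PG := P_subgroup k' i j; split; first exact: (subgroupM PG Pg (subgroupV PG Ph)).
by rewrite pos_mul eg rhoV -{1}eh /pos permK.
Qed.

Lemma stab_normal : is_normal stab P0.
Proof.
split; first exact: stab_subgroup.
  by move=> g [Pg eg]; split=> //; have := rho_deg Pg base; rewrite -/(pos g) eg add0r => /esym.
move=> g h gP0 [Ph eh]; have [Pg _] := gP0; have PG := P_subgroup k' i j.
have PVg := subgroupV PG Pg.
split; first by rewrite conjgE; apply: (subgroupM PG PVg (subgroupM PG Ph Pg)).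
rewrite conjgE pos_mul rhoM permM.
have pos1 : pos 1 = base by rewrite /pos rho1 perm1.
(* As g has degree 0, the position of its inverse is a left translate of the base edge. *)
have e : pos g^-1 = ((pos g^-1).1, 0%R).
  rewrite [LHS]surjective_pairing; congr (_, _).
  by have := rho_deg Pg (pos g^-1); rewrite -pos_mul mulVg pos1 gP0.2 addr0.
suff -> : rho h (pos g^-1) = pos g^-1 by rewrite -pos_mul mulVg.
have := rho_left Ph (pos g^-1).1 base; rewrite -/(pos h) eh /= mulg1 -e.
by move=> ->.
Qed.

(** For a right action the left coset of g depends only on the position of g^-1, for which there are
    finitely many possibilities. *)
Lemma left_coset_stab g : P g -> left_coset g stab = [set x | P x /\ rho x (pos g^-1) = base].
Proof.
move=> Pg; have PG := P_subgroup k' i j; apply/seteqP; split=> x.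
  move=> [h [Ph eh] <-]; split; first exact: (subgroupM PG Pg Ph).
  by rewrite -pos_mul mulKg.
move=> [Px ex]; exists (g^-1 * x); last by rewrite mulKVg.
by split; [exact: (subgroupM PG (subgroupV PG Pg) Px) | rewrite pos_mul].
Qed.

Lemma stab_finite_index : finite_index stab P0.
Proof.
apply: (@sub_finite_set _ _ ((fun w => [set x | P x /\ rho x w = base]) @` [set: flag])).
  by move=> _ [g [Pg _] <-]; exists (pos g^-1); rewrite ?left_coset_stab.
by apply: finite_image; exact: finite_finset.
Qed.

Lemma rho_path_gen a q : rho (path_gen i j a) (q, 0%R) = (q * t a * (t 0%R)^-1, 0%R).
Proof.
rewrite /path_gen rhoM permM rho_xi add0r natr_Zp rhoV.
apply: (@perm_inj _ (rho (xj ^+ a))); rewrite permKV rho_xj add0r natr_Zp.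
by rewrite mulgKV mulgK.
Qed.

Lemma rho_galt_path q r w : size w = (2 * r)%N ->
  rho (galt (path_gen i j) false w) (q, 0%R) = (q * galt t false w, 0%R).
Proof.
elim: r q w => [|r IH] q w; first by rewrite muln0 => /size0nil ->; rewrite rho1 perm1 mulg1.
rewrite mulnS; case: w => [|a [|b w]] // [sw] /=.
rewrite /alt_letter (rhoM (path_gen i j a)) permM rho_path_gen rhoM permM rhoV.
have -> : (rho (path_gen i j b))^-1 (q * t a * (t 0%R)^-1, 0%R) = (q * t a * (t b)^-1, 0%R).
  by apply: (@perm_inj _ (rho (path_gen i j b))); rewrite permKV rho_path_gen mulgKV.
by rewrite (IH _ _ sw) !mulgA.
Qed.

Definition lend g : Q := (pos g).1.
Definition rend g : Q := (pos g).1 * t (pos g).2.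

Lemma pos_mul_xi g n : pos (g * xi ^+ n) = (lend g, ((pos g).2 + n%:R)%R).
Proof. by rewrite pos_mul [pos g]surjective_pairing rho_xi. Qed.

Lemma pos_mul_xj g n :
  pos (g * xj ^+ n) = (rend g * (t ((pos g).2 + n%:R)%R)^-1, ((pos g).2 + n%:R)%R).
Proof. by rewrite pos_mul [pos g]surjective_pairing rho_xj. Qed.

Lemma lend_coset g x : Defs.generated [set xi] x -> lend (g * x) = lend g.
Proof.
move=> /(generated_sub (B := [set x | forall w, (rho x w).1 = w.1])) h.
rewrite /lend pos_mul h //.
- split=> [w|x1 x2 h1 h2 w]; first by rewrite rho1 perm1.
  by rewrite rhoM permM rhoV -[LHS]h2 permKV h1.
- by move=> _ -> [q a]; rewrite -[xi]expg1 rho_xi.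
Qed.

Lemma rend_coset g x : Defs.generated [set xj] x -> rend (g * x) = rend g.
Proof.
move=> /(generated_sub (B := [set x | forall w, (rho x w).1 * t (rho x w).2 = w.1 * t w.2])) h.
rewrite /rend pos_mul h //.
- split=> [w|x1 x2 h1 h2 w]; first by rewrite rho1 perm1.
  by rewrite rhoM permM rhoV -[LHS]h2 permKV h1.
- by move=> _ -> [q a]; rewrite -[xj]expg1 rho_xj /= mulgKV.
Qed.

Definition eorbit (g : G) : set G := [set n * g | n in stab].
Definition vorbit (l : 'I_3) (g : G) : set ('I_3 * set G) :=
  [set (l, left_coset n (left_coset g (Defs.generated [set gen k l]))) | n in stab].

Lemma left_cosetM (H : set G) g h : left_coset g (left_coset h H) = left_coset (g * h) H.
Proof.
apply/seteqP; split=> x; first by move=> [_ [y Hy <-] <-]; exists y; rewrite ?mulgA.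
by move=> [y Hy <-]; exists (h * y); [exists y | rewrite mulgA].
Qed.

Lemma vorbitE l g : vorbit l g = (@tree_vertex k l) @` eorbit g.
Proof.
apply/seteqP; split=> x.
  by move=> [n Kn <-]; exists (n * g); [exists n | rewrite /tree_vertex left_cosetM].
by move=> [_ [n Kn <-] <-]; exists n => //; rewrite /tree_vertex left_cosetM.
Qed.

Lemma stab_left n g : stab n -> pos (n * g) = pos g.
Proof. by move=> [_ e]; rewrite pos_mul e. Qed.

Lemma eorbitE g : P g -> eorbit g = [set x | P x /\ pos x = pos g].
Proof.
move=> Pg; have PG := P_subgroup k' i j; apply/seteqP; split=> x.
  by move=> [n Kn <-]; split; [exact: (subgroupM PG Kn.1 Pg) | exact: stab_left].
move=> [Px ex]; exists (x * g^-1); last by rewrite mulgKV.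
split; first exact: (subgroupM PG Px (subgroupV PG Pg)).
by rewrite pos_mul ex -pos_mul mulgV /pos rho1 perm1.
Qed.

Lemma eorbit_eq g g' : P g -> P g' -> eorbit g = eorbit g' <-> pos g = pos g'.
Proof.
move=> Pg Pg'; rewrite !eorbitE //; split=> [e|->//].
have : [set x | P x /\ pos x = pos g] g by [].
by rewrite e => -[].
Qed.

Lemma vorbit_self l g : vorbit l g (tree_vertex l g).
Proof. by rewrite vorbitE; exists g => //; exists 1; rewrite ?mul1g //; case: stab_subgroup. Qed.

Lemma vorbit_tag l l' g g' : vorbit l g = vorbit l' g' -> l = l'.
Proof. by move=> e; have := vorbit_self l g; rewrite e => -[n _ []]. Qed.

Lemma vorbit_coset l g x : Defs.generated [set gen k l] x -> vorbit l (g * x) = vorbit l g.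
Proof.
move=> Hx; have HG := generated_subgroup [set gen k l].
rewrite /vorbit; suff -> : left_coset (g * x) (Defs.generated [set gen k l]) =
  left_coset g (Defs.generated [set gen k l]) by [].
apply/seteqP; split=> _ [y Hy <-].
  by exists (x * y); rewrite ?mulgA //; exact: (subgroupM HG Hx Hy).
by exists (x^-1 * y); [exact: (subgroupM HG (subgroupV HG Hx) Hy) | rewrite mulgA mulgK].
Qed.

Lemma vorbit_coset_inv l g g' : vorbit l g = vorbit l g' ->
  exists n x, [/\ stab n, Defs.generated [set gen k l] x & n * g' = g * x].
Proof.
move=> e; have := vorbit_self l g; rewrite e => -[n Kn [e']].
have HG := generated_subgroup [set gen k l].
have : left_coset g (Defs.generated [set gen k l]) (n * g').
  by rewrite -e' left_cosetM; exists 1; rewrite ?mulg1 //; case: HG.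
by move=> [x Hx xE]; exists n, x.
Qed.

Lemma eorbit_vorbit l g g' : eorbit g = eorbit g' -> vorbit l g = vorbit l g'.
Proof. by rewrite !vorbitE => ->. Qed.

Lemma P_mulX g l n : P g -> (l == i) || (l == j) -> P (g * gen k l ^+ n).
Proof.
move=> Pg lij; have PG := P_subgroup k' i j; apply: (subgroupM PG Pg).
apply: (subgroupX _ PG); case/orP: lij => /eqP ->; [exact: P_xi | exact: P_xj].
Qed.

Lemma gen_mem l n : Defs.generated [set gen k l] (gen k l ^+ n).
Proof. by apply: (subgroupX _ (generated_subgroup _)); apply: sub_generated. Qed.

(** Edges with the same left end differ by a rotation around it, that is by a power of x_i, which
    does not change the coset. Left vertices of the quotient thus become elements of Q. *)
Lemma vorbit_left_eq g g' : P g -> P g' -> vorbit i g = vorbit i g' <-> lend g = lend g'.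
Proof.
move=> Pg Pg'; split.
  move=> /vorbit_coset_inv[n [x [Kn Hx e]]].
  by rewrite -(lend_coset g Hx) -e /lend stab_left.
move=> e; pose c := ((pos g').2 - (pos g).2)%R : 'I_k.
rewrite -(vorbit_coset g (@gen_mem i c)); apply: eorbit_vorbit.
apply/eorbit_eq => //; first by apply: P_mulX; rewrite ?eqxx.
by rewrite pos_mul_xi natr_Zp /c addrC subrK e [RHS]surjective_pairing.
Qed.

Lemma vorbit_right_eq g g' : P g -> P g' -> vorbit j g = vorbit j g' <-> rend g = rend g'.
Proof.
move=> Pg Pg'; split.
  move=> /vorbit_coset_inv[n [x [Kn Hx e]]].
  by rewrite -(rend_coset g Hx) -e /rend stab_left.
move=> e; pose c := ((pos g').2 - (pos g).2)%R : 'I_k.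
rewrite -(vorbit_coset g (@gen_mem j c)); apply: eorbit_vorbit.
apply/eorbit_eq => //; first by apply: P_mulX; rewrite ?eqxx ?orbT.
by rewrite pos_mul_xj natr_Zp /c addrC subrK e /rend mulgK [RHS]surjective_pairing.
Qed.

Local Notation Gamma := (tree_quotient stab i j).

Lemma quotient_vertices : @vertices Gamma = [set vorbit i g | g in P] `|` [set vorbit j g | g in P].
Proof.
apply/seteqP; split=> u.
  by move=> [_ [[g Pg <-]|[g Pg <-]] <-]; [left | right]; exists g.
by move=> [[g Pg <-]|[g Pg <-]]; [exists (tree_vertex i g) => //; left; exists g | exists (tree_vertex j g) => //; right; exists g].
Qed.

Lemma quotient_src g : @src Gamma (eorbit g) = vorbit i g.
Proof. by rewrite vorbitE. Qed.

Lemma quotient_tgt g : @tgt Gamma (eorbit g) = vorbit j g.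
Proof. by rewrite vorbitE. Qed.

Lemma sorted_map_iota (T : eqType) (f : nat -> T) m n :
  (forall x, f x != f x.+1) -> sorted (fun a b => a != b) [seq f x | x <- iota m n].
Proof.
move=> h; case: n m => //= n m; elim: n m => //= n IH m.
by rewrite h; exact: IH.
Qed.

(** A circuit alternates between left and right vertices, so its length is even. Read from a left
    vertex, the labels of its edges form a word, reduced because consecutive edges are distinct, and
    trivial in Q because the circuit closes up. *)
Lemma circuit_length_ge7 n :
  (forall r w, (0 < r <= 3)%N -> size w = (2 * r)%N ->
     sorted (fun a b => a != b) w -> galt t false w <> 1) ->
  circuit_length Gamma n -> (7 <= n)%N.
Proof.
move=> noword [v [e [n0 vinj einj ve]]]; rewrite ltnNge; apply/negP => n6.
pose idx m : 'I_n := Ordinal (ltn_pmod m n0).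
have idxS m : ordS (idx m) = idx m.+1.
  by apply: val_inj; rewrite /= -addn1 modnDml addn1.
have /choice[g gP] : forall s : 'I_n, exists g, P g /\ e s = eorbit g.
  by move=> s; have [_ [g Pg eg] _] := ve s; exists g.
pose f m := g (idx m).
have Pf m : P (f m) by case: (gP (idx m)).
have ef m : e (idx m) = eorbit (f m) by case: (gP (idx m)).
have tags h h' : vorbit i h <> vorbit j h' by move=> /vorbit_tag e'; move: ij; rewrite e' eqxx.
pose dir m := `[< vorbit i (f m) = v (idx m) >].
have joinsE m : (vorbit i (f m) = v (idx m) /\ vorbit j (f m) = v (idx m.+1)) \/
    (vorbit i (f m) = v (idx m.+1) /\ vorbit j (f m) = v (idx m)).
  by have [_ _] := ve (idx m); rewrite /joins ef quotient_src quotient_tgt idxS.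
have dirT m : dir m -> vorbit i (f m) = v (idx m) /\ vorbit j (f m) = v (idx m.+1).
  by move=> /asboolP d; case: (joinsE m) => // -[_]; rewrite -d => /esym/tags.
have dirF m : ~~ dir m -> vorbit i (f m) = v (idx m.+1) /\ vorbit j (f m) = v (idx m).
  by move=> /asboolPn d; case: (joinsE m) => // -[].
have dirS m : dir m.+1 = ~~ dir m.
  have [dm|dm] := boolP (dir m) => /=; last first.
    have [e1 _] := dirF _ dm; apply/negPn/negP => /dirF[_ e2].
    by apply: (@tags (f m) (f m.+1)); rewrite e1 e2.
  have [_ e1] := dirT _ dm; apply/negP => /dirT[e2 _].
  by apply: (@tags (f m.+1) (f m)); rewrite e1 e2.
have dirD m s : dir (m + s)%N = dir m (+) odd s.
  by elim: s => [|s IH]; rewrite ?addn0 ?addbF // addnS dirS IH /= addbN.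
have fn m : f (m + n)%N = f m by congr g; apply: val_inj; rewrite /= modnDr.
have n_even : ~~ odd n.
  have : dir (0 + n)%N = dir 0 by rewrite /dir /f; congr (`[< vorbit i (g _) = v _ >]); apply: val_inj; rewrite /= modnDr.
  by rewrite dirD; case: (dir 0); case: odd.
have [m0 dm0] : exists m, dir m.
  by have [d|d] := boolP (dir 0); [exists 0%N | exists 1%N; rewrite dirS].
pose a m := (pos (f m)).2.
have stepT m : dir m -> rend (f m) = rend (f m.+1).
  move=> d; have [_ e1] := dirT _ d; have /dirF[_ e2] : ~~ dir m.+1 by rewrite dirS d.
  by apply/vorbit_right_eq => //; rewrite e1 e2.
have stepF m : ~~ dir m -> lend (f m) = lend (f m.+1).
  move=> d; have [e1 _] := dirF _ d; have /dirT[e2 _] : dir m.+1 by rewrite dirS d.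
  by apply/vorbit_left_eq => //; rewrite e1 e2.
(* Two edges with a common end and the same label have the same position, hence coincide. *)
have a_neq m : a m != a m.+1.
  apply/eqP => am; have : pos (f m) = pos (f m.+1).
    rewrite [LHS]surjective_pairing [RHS]surjective_pairing -/(a m) -/(a m.+1) am; congr (_, _).
    have [d|d] := boolP (dir m); last exact: stepF.
    by have := stepT _ d; rewrite /rend -/(a m) -/(a m.+1) am => /mulIg.
  move=> /(eorbit_eq (Pf _) (Pf _)); rewrite -!ef => /einj idxE.
  have : dir m.+1 = dir m by rewrite /dir /f idxE.
  by rewrite dirS; case: (dir m).
have walk r m : dir m -> lend (f (m + 2 * r)%N) = lend (f m) * galt t false [seq a x | x <- iota m (2 * r)].
  elim: r m => [|r IH] m d; first by rewrite muln0 addn0 mulg1.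
  have d1 : ~~ dir m.+1 by rewrite dirS d.
  have d2 : dir m.+2 by rewrite dirS.
  rewrite mulnS addnA addn2 (IH _ d2) /= -(stepF _ d1) /alt_letter !mulgA; congr (_ * _).
  by have := stepT _ d; rewrite /rend -/(a m) -/(a m.+1) /lend => ->; rewrite mulgK.
have n2 : (2 * n./2 = n)%N by rewrite mul2n halfK (negPf n_even) subn0.
have n20 : (0 < n./2 <= 3)%N.
  have small q : (0 < q)%N -> (q <= 6)%N -> ~~ odd q -> (0 < q./2 <= 3)%N.
    by case: q => [|[|[|[|[|[|[|q]]]]]]].
  exact: small.
apply: (noword n./2 [seq a x | x <- iota m0 (2 * n./2)]) => //.
- by rewrite size_map size_iota.
- exact: sorted_map_iota.
- by apply: (mulgI (lend (f m0))); rewrite -walk // n2 fn mulg1.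
Qed.

Lemma stab_rotund (R : realType) :
  (forall r w, (0 < r <= 3)%N -> size w = (2 * r)%N ->
     sorted (fun a b => a != b) w -> galt t false w <> 1) ->
  rotund R i j stab.
Proof.
move=> noword; split; [exact: stab_normal | exact: stab_finite_index |].
apply: (@lt_le_trans _ _ (7%:R%:E)%E); first by rewrite lte_fin ltr_nat.
apply/ereal_infP => _ [n /(circuit_length_ge7 noword) n7 <-].
by rewrite lee_fin ler_nat.
Qed.

Lemma card_fset_set_seq (T : choiceType) (A : set T) (s : seq T) :
  uniq s -> (forall x, A x <-> x \in s) -> #|` fset_set A| = size s.
Proof.
move=> us As; have finA : finite_set A.
  apply: (@sub_finite_set _ _ [set` s]); last exact: finite_seq.
  by move=> x /As.
have /perm_size // : perm_eq (enum_fset (fset_set A)) s.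
apply: uniq_perm => //.
move=> x; rewrite -[LHS]/(x \in fset_set A) in_fset_set //; apply/idP/idP => [/set_mem/As //|/As xA].
exact: mem_set.
Qed.

Lemma card_fset_set_image (T : choiceType) (I : finType) (A : set T) (E : I -> T) (p : pred I) :
  injective E -> (forall e, A e <-> exists2 c, p c & e = E c) ->
  #|` fset_set A| = (\sum_c p c)%N.
Proof.
move=> Einj Ap; rewrite (@card_fset_set_seq _ _ [seq E c | c <- enum I & p c]).
- rewrite size_map size_filter -sum1_count big_mkcond /= big_enum /=.
  by apply: eq_bigr => c _; case: (p c).
- by rewrite map_inj_uniq // filter_uniq // enum_uniq.
- move=> e; rewrite Ap; split=> [[c pc ->]|/mapP[c]].
    by apply: map_f; rewrite mem_filter pc mem_enum.
  by rewrite mem_filter => /andP[pc _] ->; exists c.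
Qed.

Lemma finite_vertices : finite_set (@vertices Gamma).
Proof.
have finE : finite_set (@edges Gamma).
  apply: (@sub_finite_set _ _ ((fun w => [set x | P x /\ pos x = w]) @` [set: flag])).
    by move=> _ [g Pg <-]; exists (pos g); rewrite // -/(eorbit g) eorbitE.
  by apply: finite_image; exact: finite_finset.
rewrite quotient_vertices finite_setU; split.
  apply: (@sub_finite_set _ _ ((fun e => @src Gamma e) @` (@edges Gamma))).
    by move=> _ [g Pg <-]; exists (eorbit g); rewrite ?quotient_src //; exists g.
  exact: finite_image.
apply: (@sub_finite_set _ _ ((fun e => @tgt Gamma e) @` (@edges Gamma))).
  by move=> _ [g Pg <-]; exists (eorbit g); rewrite ?quotient_tgt //; exists g.
exact: finite_image.
Qed.

Local Notation V := (fset_set (@vertices Gamma)).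
Local Notation vertex a := (val (enum_val a) : vtype Gamma).

Lemma sum_neighbours (R : realType) (F : vtype Gamma -> R) (other : 'I_k -> vtype Gamma) :
  (forall c, @vertices Gamma (other c)) ->
  (\sum_(b : 'I_#|{: V}|) F (vertex b) * (\sum_c (other c == vertex b))%N%:R = \sum_c F (other c))%R.
Proof.
move=> ov; under eq_bigr => b _ do rewrite natr_sum mulr_sumr.
rewrite exchange_big /=; apply: eq_bigr => c _.
have oV : other c \in V by rewrite in_fset_set ?mem_set //; exact: finite_vertices.
have ob : vertex (enum_rank ([` oV]%fset)) = other c by rewrite enum_rankK.
rewrite (bigD1 (enum_rank ([` oV]%fset))) //= ob eqxx mulr1 big1 ?addr0 // => b bne.
have [e|] := eqVneq (other c) (vertex b); last by rewrite mulr0.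
case/eqP: bne; apply: enum_val_inj; apply: val_inj; rewrite -[LHS]e.
by rewrite enum_rankK.
Qed.

Lemma orbit_xi_inj g : P g -> injective (fun c : 'I_k => eorbit (g * xi ^+ c)).
Proof.
move=> Pg c c' /eorbit_eq e; have {}e : pos (g * xi ^+ c) = pos (g * xi ^+ c').
  by apply: e; apply: P_mulX; rewrite ?eqxx.
by move: (congr1 snd e); rewrite !pos_mul_xi !natr_Zp /= => /addrI.
Qed.

Lemma orbit_xj_inj g : P g -> injective (fun c : 'I_k => eorbit (g * xj ^+ c)).
Proof.
move=> Pg c c' /eorbit_eq e; have {}e : pos (g * xj ^+ c) = pos (g * xj ^+ c').
  by apply: e; apply: P_mulX; rewrite ?eqxx ?orbT.
by move: (congr1 snd e); rewrite !pos_mul_xj !natr_Zp /= => /addrI.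
Qed.

Lemma edge_at_left g h : P g -> P h -> vorbit i g = vorbit i h ->
  exists c : 'I_k, eorbit h = eorbit (g * xi ^+ c).
Proof.
move=> Pg Ph /vorbit_left_eq e; exists ((pos h).2 - (pos g).2)%R.
apply/eorbit_eq => //; first by apply: P_mulX; rewrite ?eqxx.
by rewrite pos_mul_xi natr_Zp addrC subrK e // [LHS]surjective_pairing.
Qed.

Lemma edge_at_right g h : P g -> P h -> vorbit j g = vorbit j h ->
  exists c : 'I_k, eorbit h = eorbit (g * xj ^+ c).
Proof.
move=> Pg Ph /vorbit_right_eq e; exists ((pos h).2 - (pos g).2)%R.
apply/eorbit_eq => //; first by apply: P_mulX; rewrite ?eqxx ?orbT.
by rewrite pos_mul_xj natr_Zp addrC subrK e // /rend mulgK [LHS]surjective_pairing.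
Qed.

Lemma vorbit_ij_neq g h : vorbit i g <> vorbit j h.
Proof. by move=> /vorbit_tag e; move: ij; rewrite e eqxx. Qed.

Lemma oriented_edges_into_left g w : oriented_edges w (vorbit i g : vtype Gamma) = set0.
Proof.
apply/seteqP; split=> // e [[h Ph <-] _].
by rewrite quotient_tgt => /esym/vorbit_ij_neq.
Qed.

Lemma oriented_edges_from_right g w : oriented_edges (vorbit j g : vtype Gamma) w = set0.
Proof.
apply/seteqP; split=> // e [[h Ph <-]].
by rewrite quotient_src => /vorbit_ij_neq.
Qed.

Lemma vertex_left g : P g -> @vertices Gamma (vorbit i g).
Proof. by move=> Pg; rewrite quotient_vertices; left; exists g. Qed.

Lemma vertex_right g : P g -> @vertices Gamma (vorbit j g).
Proof. by move=> Pg; rewrite quotient_vertices; right; exists g. Qed.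

(** All edges run from left to right vertices, so one of the two terms of [adjacency] vanishes;
    those leaving this vertex are the k distinct rotations of one edge. *)
Lemma adjacency_left (R : realType) (F : vtype Gamma -> R) g (a : 'I_#|{: V}|) : P g ->
  vertex a = vorbit i g ->
  (\sum_b F (vertex b) * adjacency Gamma R b a = \sum_(c < k) F (vorbit j (g * xi ^+ c)%g))%R.
Proof.
move=> Pg ag; have Pc c : P (g * xi ^+ c) by apply: P_mulX; rewrite ?eqxx.
rewrite -sum_neighbours; last by move=> c; exact: vertex_right.
apply: eq_bigr => b _; congr (_ * _)%R; rewrite mxE /= ag oriented_edges_into_left fset_set0 cardfs0 add0n.
congr (_%:R)%R; apply: (card_fset_set_image (orbit_xi_inj Pg)) => e; split.
  move=> [[h Ph <-] ]; rewrite quotient_src quotient_tgt => hg hb.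
  have [c ec] := edge_at_left Pg Ph (esym hg); exists c => //.
  by rewrite -hb (eorbit_vorbit _ ec) eqxx.
move=> [c /eqP oc ->]; have vc : vorbit i (g * xi ^+ c) = vorbit i g.
  by apply: vorbit_coset; exact: gen_mem.
split; first by exists (g * xi ^+ c) => //; apply: Pc.
  by rewrite quotient_src ?vc.
by rewrite quotient_tgt ?vc.
Qed.

Lemma adjacency_right (R : realType) (F : vtype Gamma -> R) g (a : 'I_#|{: V}|) : P g ->
  vertex a = vorbit j g ->
  (\sum_b F (vertex b) * adjacency Gamma R b a = \sum_(c < k) F (vorbit i (g * xj ^+ c)%g))%R.
Proof.
move=> Pg ag; have Pc c : P (g * xj ^+ c) by apply: P_mulX; rewrite ?eqxx ?orbT.
rewrite -sum_neighbours; last by move=> c; exact: vertex_left.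
apply: eq_bigr => b _; congr (_ * _)%R; rewrite mxE /= ag oriented_edges_from_right fset_set0 cardfs0 addn0.
congr (_%:R)%R; apply: (card_fset_set_image (orbit_xj_inj Pg)) => e; split.
  move=> [[h Ph <-] ]; rewrite quotient_src quotient_tgt => hb hg.
  have [c ec] := edge_at_right Pg Ph (esym hg); exists c => //.
  by rewrite -hb (eorbit_vorbit _ ec) eqxx.
move=> [c /eqP oc ->]; have vc : vorbit j (g * xj ^+ c) = vorbit j g.
  by apply: vorbit_coset; exact: gen_mem.
split; first by exists (g * xj ^+ c) => //; apply: Pc.
  by rewrite quotient_src ?vc.
by rewrite quotient_tgt ?vc.
Qed.

Lemma big_words2 (R : realType) (F : Q -> R) h :
  (\sum_(w <- words (enum 'I_k) 2) F (h * galt t false w)%g =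
   \sum_a \sum_b F (h * t a * (t b)^-1)%g)%R.
Proof.
have step n (f : seq 'I_k -> R) : (\sum_(w <- words (enum 'I_k) n.+1) f w =
    \sum_a \sum_(w <- words (enum 'I_k) n) f (a :: w))%R.
  by rewrite /= big_allpairs_dep big_enum.
rewrite step; apply: eq_bigr => a _; rewrite step; apply: eq_bigr => b _.
by rewrite big_seq1 /= /alt_letter mulg1 !mulgA.
Qed.

(* A function on the vertices satisfying the adjacency equations restricts to
   an eigenfunction of the squared operator on the left vertices, extended by
   0 outside the component. *)
Lemma vertex_function_eq0 (R : realType) (F : vtype Gamma -> R) (mu : R) :
  (forall (nu : R) (f : Q -> R),
     (forall x, \sum_(w <- words (enum 'I_k) 2) f (x * galt t false w)%g = nu * f x)%R ->
     ((k ^ 2)%:R / 9%:R < nu < (k ^ 2)%:R)%R -> forall x, f x = 0%R) ->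
  (forall g, P g -> (mu * F (vorbit i g) = \sum_(c < k) F (vorbit j (g * xi ^+ c)%g))%R) ->
  (forall g, P g -> (mu * F (vorbit j g) = \sum_(c < k) F (vorbit i (g * xj ^+ c)%g))%R) ->
  (k%:R / 3%:R < mu < k%:R)%R ->
  forall u, @vertices Gamma u -> F u = 0%R.
Proof.
move=> gap Fi Fj /andP[mu_gt mu_lt].
have k0 : (0 < k%:R :> R)%R by rewrite ltr0n.
have mu0 : (0 < mu)%R by apply: lt_trans mu_gt; rewrite divr_gt0 // ltr0n.
(* Elements of Q that are not left ends of edges in the component get the value 0. *)
pose f h := match pselect (exists g, P g /\ lend g = h) with
  | left e => F (vorbit i (projT1 (cid e))) | right _ => 0%R end.
have fE g : P g -> f (lend g) = F (vorbit i g).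
  move=> Pg; rewrite /f; case: pselect => [e|[]]; last by exists g.
  case: (cid e) => g' [Pg' e'] /=.
  by congr F; apply/vorbit_left_eq.
have f0 h : ~ (exists g, P g /\ lend g = h) -> f h = 0%R.
  by rewrite /f; case: pselect.
have f_eigen h : (\sum_(w <- words (enum 'I_k) 2) f (h * galt t false w)%g = mu ^+ 2 * f h)%R.
  rewrite big_words2.
  have [[g [Pg <-]]|nh] := pselect (exists g, P g /\ lend g = h); last first.
    rewrite (f0 h nh) mulr0 big1 // => a _; rewrite big1 // => b _; apply: f0 => -[g [Pg e]].
    (* From left end h t_a t_b^-1, turn to the edge labelled b, whose right end is h t_a, and turn
       there to the edge labelled a: its left end is h. *)
    apply: nh; exists (g * xi ^+ (b - (pos g).2)%R * xj ^+ (a - b)%R); split.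
      by apply: P_mulX; rewrite ?eqxx ?orbT //; apply: P_mulX; rewrite ?eqxx.
    rewrite /lend pos_mul_xj natr_Zp /rend pos_mul_xi natr_Zp [LHS]/=.
    by rewrite [((pos g).2 + _)%R]addrC subrK [(b + _)%R]addrC subrK e mulgKV mulgK.
  rewrite fE // expr2 -mulrA Fi // mulr_sumr.
  rewrite (reindex_inj (addrI (pos g).2)) /=; apply: eq_bigr => c _.
  have Pc : P (g * xi ^+ c) by apply: P_mulX; rewrite ?eqxx.
  rewrite Fj // (reindex_inj (addrI ((pos g).2 + c)%R)) /=; apply: eq_bigr => d _.
  rewrite -fE; last by apply: P_mulX; rewrite ?eqxx ?orbT.
  by rewrite [in RHS]/lend pos_mul_xj natr_Zp /rend pos_mul_xi natr_Zp.
have {}f_eq0 : forall h, f h = 0%R.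
  apply: (gap (mu ^+ 2)%R) => //; apply/andP; split.
    have -> : ((k ^ 2)%:R / 9%:R = (k%:R / 3%:R) ^+ 2 :> R)%R.
      by rewrite expr_div_n -!natrX.
    by rewrite ltrXn2r ?nnegrE // ?divr_ge0 // ltW.
  by rewrite natrX ltrXn2r ?nnegrE // ltW.
have Fi0 g : P g -> F (vorbit i g) = 0%R by move=> Pg; rewrite -fE.
move=> u; rewrite quotient_vertices => -[[g Pg <-]|[g Pg <-]]; first exact: Fi0.
have /eqP := Fj _ Pg; rewrite big1 => [|c _].
  by rewrite mulf_eq0 (gt_eqF mu0) => /eqP.
by apply: Fi0; apply: P_mulX; rewrite ?eqxx ?orbT.
Qed.

Lemma eigen_laplacian (R : realType) (v : 'rV[R]_#|{: V}|) l :
  (v *m laplacian Gamma R k = l *: v)%R <->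
  forall a, (\sum_b v ord0 b * adjacency Gamma R b a = k%:R * (1 - l) * v ord0 a)%R.
Proof.
have k0 : (k%:R != 0 :> R)%R by rewrite pnatr_eq0.
have -> : (v *m laplacian Gamma R k = v - k%:R^-1 *: (v *m adjacency Gamma R))%R.
  by rewrite /laplacian mulmxBr mulmx1 scalemxAr.
split=> [e a|h].
  have : (v *m adjacency Gamma R = k%:R *: (v - l *: v))%R.
    by rewrite -e opprB addrCA subrr addr0 scalerA divff // scale1r.
  by move=> /matrixP/(_ ord0 a); rewrite !mxE => ->; ring.
apply/matrixP => x a; rewrite !mxE !ord1 h mulrA mulrA mulVf // mul1r; ring.
Qed.

Lemma vertexP u : @vertices Gamma u ->
  (exists2 g, P g & u = vorbit i g) \/ (exists2 g, P g & u = vorbit j g).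
Proof. by rewrite quotient_vertices => -[[g Pg <-]|[g Pg <-]]; [left | right]; exists g. Qed.

(** The graph is bipartite: 1 on left and -1 on right vertices is an eigenvector. So a positive
    eigenvalue exists, and the infimum [lambda1] is not the default value 0. *)
Lemma eigenvalue2 (R : realType) : eigenvalue (laplacian Gamma R k) 2%:R.
Proof.
pose F (u : vtype Gamma) : R := if `[< exists2 g, P g & u = vorbit i g >] then 1%R else (-1)%R.
have Fi g : P g -> F (vorbit i g) = 1%R.
  by move=> Pg; rewrite /F; case: asboolP => // -[]; exists g.
have Fj g : F (vorbit j g) = (-1)%R.
  by rewrite /F; case: asboolP => // -[h _ /esym/vorbit_ij_neq].
have P1 : P 1 by case: (P_subgroup k' i j).
have v1V : vorbit i 1 \in V by rewrite in_fset_set ?mem_set //; [exact: vertex_left | exact: finite_vertices].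
apply/eigenvalueP; exists (\row_b F (vertex b))%R; last first.
  apply/eqP => /matrixP/(_ ord0 (enum_rank ([` v1V]%fset))) /eqP.
  by rewrite !mxE enum_rankK /= Fi // oner_eq0.
apply/eigen_laplacian => a; under eq_bigr do rewrite mxE; rewrite mxE.
have -> : (k%:R * (1 - 2%:R) = - k%:R :> R)%R by ring.
have : @vertices Gamma (vertex a).
  by have := valP (enum_val a); rewrite (in_fset_set finite_vertices) => /set_mem.
case/vertexP => -[g Pg e]; rewrite e.
  rewrite (adjacency_left F Pg e) Fi //.
  under eq_bigr do rewrite Fj; by rewrite sumr_const card_ord; ring.
rewrite (adjacency_right F Pg e) Fj //.
rewrite (eq_bigr (fun=> 1%R)) => [|c _]; first by rewrite sumr_const card_ord; ring.
by apply: Fi; apply: P_mulX; rewrite ?eqxx ?orbT.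
Qed.

(** In fact [lambda1] is at least 2/3: an eigenvalue l strictly between 0 and 2/3 gives the
    adjacency eigenvalue k (1 - l) strictly between k/3 and k, whose square lies in the excluded
    interval. *)
Lemma stab_expansive (R : realType) :
  (forall (nu : R) (f : Q -> R),
     (forall x, \sum_(w <- words (enum 'I_k) 2) f (x * galt t false w)%g = nu * f x)%R ->
     ((k ^ 2)%:R / 9%:R < nu < (k ^ 2)%:R)%R -> forall x, f x = 0%R) ->
  expansive R i j stab.
Proof.
move=> gap; split; [exact: stab_normal | exact: stab_finite_index |].
apply: (@lt_le_trans _ _ (2%:R / 3%:R)%R); first lra.
apply: lb_le_inf; first by exists 2%:R%R; split; [rewrite ltr0n | exact: eigenvalue2].
move=> l [l0 /eigenvalueP[v /eigen_laplacian ve v0]].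
rewrite leNgt; apply/negP => l23; move/eqP: v0; apply.
pose F (u : vtype Gamma) : R := (\sum_b if vertex b == u then v ord0 b else 0)%R.
have FE b : F (vertex b) = v ord0 b.
  rewrite /F (bigD1 b) //= eqxx big1 ?addr0 // => b' bb'.
  case: eqP => // /val_inj/enum_val_inj e; by rewrite e eqxx in bb'.
have vE a : (\sum_b F (vertex b) * adjacency Gamma R b a = k%:R * (1 - l) * F (vertex a))%R.
  by rewrite FE -ve; apply: eq_bigr => b _; rewrite FE.
have k0 : (0 < k%:R :> R)%R by rewrite ltr0n.
have rank u : @vertices Gamma u -> exists a : 'I_#|{: V}|, vertex a = u.
  move=> vu; have uV : u \in V by rewrite in_fset_set ?mem_set //; exact: finite_vertices.
  by exists (enum_rank ([` uV]%fset)); rewrite enum_rankK.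
have Fz : forall u, @vertices Gamma u -> F u = 0%R.
  apply: (@vertex_function_eq0 R F (k%:R * (1 - l))%R gap).
  - by move=> g Pg; have [a ea] := rank _ (vertex_left Pg); rewrite -ea -vE (adjacency_left F Pg ea).
  - by move=> g Pg; have [a ea] := rank _ (vertex_right Pg); rewrite -ea -vE (adjacency_right F Pg ea).
  - by apply/andP; split; nra.
apply/matrixP => x a; rewrite ord1 mxE -FE Fz //.
by have := valP (enum_val a); rewrite (in_fset_set finite_vertices) => /set_mem.
Qed.

(** The position of the element is (value of w in Q, c). If it is the base edge, then c = 0 and w is
    trivial in Q, hence empty. *)
Lemma stab_reduced_word n r (w : seq 'I_k) (c : 'I_k) :
  (forall r w, (0 < r <= n)%N -> size w = (2 * r)%N ->
     sorted (fun a b => a != b) w -> galt t false w <> 1) ->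
  (r <= n)%N -> size w = (2 * r)%N -> sorted (fun a b => a != b) w ->
  stab (galt (path_gen i j) false w * xi ^+ c) -> galt (path_gen i j) false w * xi ^+ c = 1.
Proof.
move=> noword rn sw red [_]; rewrite pos_mul /pos (rho_galt_path _ sw) rho_xi natr_Zp mul1g add0r.
move=> e; have tw : galt t false w = 1 := congr1 fst e.
have -> : c = 0%R := congr1 snd e.
case: r rn sw => [|r] rn sw; first by move: sw => /size0nil ->; rewrite mulg1.
by case: (noword r.+1 w).
Qed.

End Action.

Local Open Scope classical_set_scope.

Theorem proposition1p6 (R : realType) :
  exists k : nat, (18 <= k)%N /\
    forall i j : 'I_3, (i < j)%N ->
      exists K : nat -> set (Gk k),
        (forall n : nat,
          [/\ is_normal (K n) (Pij0 k i j), rotund R i j (K n)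
            & expansive R i j (K n)]) /\
        \bigcap_(n in [set: nat]) K n = [set 1%g].
Proof.
have [k [k18 quotients]] := exists_expanding_quotients R.
exists k; split=> // i j ij; have {}ij : i != j by rewrite neq_ltn ij.
case: k k18 quotients => [|[|k']] // _ quotients.
have /choice[K KP] : forall n : nat, exists K : set (Gk k'.+2),
    [/\ is_normal K (Pij0 k'.+2 i j), rotund R i j K, expansive R i j K &
      forall r (w : seq 'I_k'.+2) (c : 'I_k'.+2), (r <= n)%N -> size w = (2 * r)%N ->
        sorted (fun a b => a != b) w ->
        K (galt (path_gen i j) false w * gen k'.+2 i ^+ c)%g ->
        (galt (path_gen i j) false w * gen k'.+2 i ^+ c = 1)%g].
  (* The 3 serves the girth, the n the separation of words of up to n pairs. *)
  move=> n; have [Q [t [noword gap]]] := quotients (n + 3)%N.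
  exists (stab i j t); split.
  - exact: stab_normal.
  - apply: stab_rotund => // r w /andP[r0 r3]; apply: noword.
    by rewrite r0 (leq_trans r3) // leq_addl.
  - exact: stab_expansive.
  - move=> r w c rn; apply: (@stab_reduced_word _ _ _ _ _ ij (n + 3)%N) => //.
    by rewrite (leq_trans rn) // leq_addr.
exists K; split=> [n|]; first by have [] := KP n.
apply/seteqP; split=> [g Kg|_ -> n _]; last by have [[[K1 _] _ _] _ _ _] := KP n.
have Pg : Pij k'.+2 i j g by have [[_ KP0 _] _ _ _] := KP 0%N; case: (KP0 _ (Kg 0%N I)).
(* An element of the intersection has a reduced normal form with some number r' of pairs, and
   already its membership in [K r'] makes it trivial. *)
have [r [w [c [sw gE]]]] := P_normal_form Pg.
have [r' [w' [sw' red e]]] := reduce_word sw.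
have [_ _ _ short] := KP r'; move: (Kg r' I); rewrite gE e.
exact: (short _ _ _ (leqnn _) sw' red).
Qed.
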